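(* Let $\mu,\nu\in\mathbb{C}$. (i) For $\lambda\in I^{-\infty}_{\mu,\nu}$: $T^\lambda$ is a distribution on $\mathbb{R}$, $\lambda_\infty\in I^{-\infty}_{\mu,\nu}$, and $(\lambda_\infty)_\infty=\lambda$. (ii) For $(T_1,T_2)\in\mathcal{A}(J_{\mu,\nu})$ and $F\in I^\infty_{\mu,\nu}$, set $\Lambda(T_1,T_2)(F)=T_1(f_1)+T_2(f_2)$, where $(f_1,f_2)$ is a partition of $F$. This definition does not depend on the choice of the partition $(f_1,f_2)$ of $F$. Moreover, $\Lambda(T_1,T_2)\in I^{-\infty}_{\mu,\nu}$ for $(T_1,T_2)\in\mathcal{A}(J_{\mu,\nu})$. (iii) The $\mathbb{C}$-linear map $I^{-\infty}_{\mu,\nu}\ni\lambda\mapsto(T^\lambda,T^{\lambda_\infty})\in\mathcal{A}(J_{\mu,\nu})$ is bijective, and its inverse map is given by $(T_1,T_2)\mapsto\Lambda(T_1,T_2)$.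
   Context: Conventions: $\arg z\in(-\pi,\pi]$ is the principal argument. $G=SL(2,\mathbb{R})$, $\mathfrak{H}$ is the upper half plane; for $g=\begin{pmatrix}a&b\\c&d\end{pmatrix}\in G$ and $z\in\mathfrak{H}$, $gz=\frac{az+b}{cz+d}$ and $J(g,z)=cz+d$. $\widetilde G=\{(g,\theta)\in G\times\mathbb{R}: J(g,\sqrt{-1})e^{\sqrt{-1}\theta}=|J(g,\sqrt{-1})|\}$ is the universal covering group of $G$, with product $(g_1,\theta_1)(g_2,\theta_2)=\bigl(g_1g_2,\ \theta_1+\theta_2-\arg\frac{J(g_1,g_2\sqrt{-1})}{J(g_1,\sqrt{-1})}\bigr)$. Put $\tilde{\mathrm u}(x)=\bigl(\begin{pmatrix}1&x\\0&1\end{pmatrix},0\bigr)$ ($x\in\mathbb{R}$), $\tilde{\mathrm a}(y)=\bigl(\begin{pmatrix}\sqrt y&0\\0&1/\sqrt y\end{pmatrix},0\bigr)$ ($y>0$), $\tilde{\mathrm k}(\theta)=\bigl(\begin{pmatrix}\cos\theta&\sin\theta\\-\sin\theta&\cos\theta\end{pmatrix},\theta\bigr)$ ($\theta\in\mathbb{R}$), $\tilde w=\tilde{\mathrm k}(-\pi/2)$. $I^\infty_{\mu,\nu}$ is the space of smooth $F\colon\widetilde G\to\mathbb{C}$ with $F(\tilde{\mathrm u}(x)\tilde{\mathrm a}(y)\tilde{\mathrm k}(m\pi)\tilde g)=e^{\pi m\sqrt{-1}\mu}y^{\nu+1/2}F(\tilde g)$ for $x\in\mathbb{R}$, $y>0$,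 $m\in\mathbb{Z}$, $\tilde g\in\widetilde G$. $\rho$ denotes right translation, $(\rho(\tilde g)F)(\tilde h)=F(\tilde h\tilde g)$, and also the derived action of $\mathfrak{g}=\mathfrak{sl}(2,\mathbb{R})$ and of the universal enveloping algebra $\mathcal{U}(\mathfrak{g}_{\mathbb{C}})$. $I^\infty_{\mu,\nu}$ has the topology defined by the seminorms $\mathcal{Q}_X(F)=\sup_{-\pi\le\theta<\pi}|(\rho(X)F)(\tilde{\mathrm k}(\theta))|$, $X\in\mathcal{U}(\mathfrak{g}_{\mathbb{C}})$. $I^{-\infty}_{\mu,\nu}$ is the space of continuous linear maps $\lambda\colon I^\infty_{\mu,\nu}\to\mathbb{C}$. For $F\in I^\infty_{\mu,\nu}$ put $F_\infty=e^{\pi\sqrt{-1}\mu/2}\rho(\tilde w)F$ (an involution of $I^\infty_{\mu,\nu}$), and for $\lambda\in I^{-\infty}_{\mu,\nu}$ put $\lambda_\infty(F)=\lambda(F_\infty)$. For $f\in C_0^\infty(\mathbb{R})$, $\iota_{\mu,\nu}(f)\in I^\infty_{\mu,\nu}$ is the unique element with $\iota_{\mu,\nu}(f)(\tilde w\tilde{\mathrm u}(-x))=f(x)$ ($x\in\mathbb{R}$); explicitly, at $\tilde g=(g,\theta)$ with bottom row $(c,d)$ of $g$ it equals $e^{\sqrt{-1}\mu(\theta+\arg(J(g,\sqrt{-1})/c))}|c|^{-2\nu-1}f(-d/c)$ if $c\ne0$ and $0$ if $c=0$. Put $T^\lambda(f)=\lambda(\iota_{\mu,\nu}(f))$ for $f\in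 C_0^\infty(\mathbb{R})$. A partition of $F\in I^\infty_{\mu,\nu}$ is a pair $(f_1,f_2)$ of functions in $C_0^\infty(\mathbb{R})$ with $\iota_{\mu,\nu}(f_1)+(\iota_{\mu,\nu}(f_2))_\infty=F$ (every $F$ has a partition; it is not unique). A distribution on $\mathbb{R}$ is a linear map $T\colon C_0^\infty(\mathbb{R})\to\mathbb{C}$ such that for every $u>0$ there are $m\in\mathbb{Z}_{\ge0}$, $c>0$ with $|T(f)|\le c\sum_{i=0}^m\sup_x|f^{(i)}(x)|$ for $f$ supported in $\{|x|\le u\}$. For $f\in C_0^\infty(\mathbb{R}^\times)$ (regarded in $C_0^\infty(\mathbb{R})$ by $f(0)=0$) put $f_{\mu,\nu,\infty}(x)=e^{-\mathrm{sgn}(x)\pi\sqrt{-1}\mu/2}|x|^{-2\nu-1}f(-1/x)$. $\mathcal{A}(J_{\mu,\nu})$ is the space of pairs $(T_1,T_2)$ of distributions on $\mathbb{R}$ with $T_1(f)=T_2(f_{\mu,\nu,\infty})$ for all $f\in C_0^\infty(\mathbb{R}^\times)$. *)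

(* Defs.v *)
From Stdlib Require Import Reals Lra Lia Psatz ZArith List.
From Stdlib Require Import ClassicalEpsilon FunctionalExtensionality ProofIrrelevance.
From Coquelicot Require Import Coquelicot.
Open Scope R_scope.

Definition Cexp (z : C) : C := (exp (Re z) * cos (Im z), exp (Re z) * sin (Im z)).

(* [y ^ s] for [y > 0]. *)
Definition Rcpow (y : R) (s : C) : C := Cexp (s * RtoC (ln y))%C.

(* Principal argument, with values in (-PI, PI] for [z <> 0]. *)
Definition Carg (z : C) : R :=
  if Rle_dec 0 (Im z) then acos (Re z / Cmod z) else - acos (Re z / Cmod z).

Lemma Cexp_add (z w : C) : Cexp (z + w)%C = (Cexp z * Cexp w)%C.
Proof.
destruct z as [a b], w as [c d]; unfold Cexp, Cmult, Cplus, Re, Im; simpl.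
rewrite exp_plus, cos_plus, sin_plus; f_equal; ring.
Qed.

Lemma Cexp_0 : Cexp 0 = 1.
Proof. unfold Cexp, Re, Im; simpl; rewrite exp_0, cos_0, sin_0; unfold RtoC; f_equal; ring. Qed.

Lemma Cexp_neq0 (z : C) : Cexp z <> 0.
Proof.
intros H. assert (K : Cexp (z + - z)%C = 0) by (rewrite Cexp_add, H; ring).
replace (z + - z)%C with (RtoC 0) in K by ring. rewrite Cexp_0 in K.
injection K; lra.
Qed.

Lemma Cexp_Ci (t : R) : Cexp (Ci * RtoC t)%C = (cos t, sin t).
Proof.
unfold Cexp, Cmult, Ci, RtoC, Re, Im; simpl.
replace (0 * t - 1 * 0) with 0 by ring; replace (0 * 0 + 1 * t) with t by ring.
rewrite exp_0; f_equal; ring.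
Qed.

Lemma Cmod_sqr (z : C) : Cmod z * Cmod z = Re z * Re z + Im z * Im z.
Proof.
unfold Cmod. rewrite sqrt_sqrt; [unfold Re, Im; ring | nra].
Qed.

Lemma Cpolar (z : C) : z <> 0 -> z = (RtoC (Cmod z) * Cexp (Ci * RtoC (Carg z)))%C.
Proof.
intros Hz. pose proof (proj1 (Cmod_gt_0 z) Hz) as Hp.
pose proof (Cmod_sqr z) as Hs. rewrite Cexp_Ci.
set (r := Cmod z) in *. destruct z as [a b]; unfold Re, Im in *; simpl in *.
assert (Hb : -1 <= a / r <= 1).
{ split.
  - apply Rmult_le_reg_r with r; [lra|]. field_simplify; [|lra..]. nra.
  - apply Rmult_le_reg_r with r; [lra|]. field_simplify; [|lra..]. nra. }
assert (Hsin : sin (acos (a / r)) = Rabs b / r).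
{ rewrite sin_acos by lra.
  replace (1 - Rsqr (a / r)) with (Rsqr (Rabs b / r)).
  - apply sqrt_Rsqr. apply Rmult_le_pos; [apply Rabs_pos|]. left; apply Rinv_0_lt_compat; lra.
  - rewrite !Rsqr_div', <- Rsqr_abs. unfold Rsqr. field_simplify_eq; [|lra]. nra. }
unfold Carg, Re, Im; simpl. fold r.
destruct (Rle_dec 0 b) as [Hb0|Hb0].
- rewrite cos_acos by lra. rewrite Hsin, Rabs_pos_eq by lra.
  unfold Cmult, RtoC; simpl. f_equal; field; lra.
- rewrite cos_neg, sin_neg, cos_acos by lra. rewrite Hsin, Rabs_left by lra.
  unfold Cmult, RtoC; simpl. f_equal; field; lra.
Qed.

Lemma Cmod_cis (r t : R) : 0 < r -> Cmod (r * cos t, r * sin t) = r.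
Proof.
intros Hr. unfold Cmod; simpl.
replace (_ + _) with (r * r).
- apply sqrt_square; lra.
- pose proof (sin2_cos2 t) as H; unfold Rsqr in H. nra.
Qed.

Lemma Carg_cis (r t : R) : 0 < r -> - PI < t <= PI -> Carg (r * cos t, r * sin t) = t.
Proof.
intros Hr Ht. unfold Carg. rewrite Cmod_cis by lra. unfold Re, Im; simpl.
replace (r * cos t / r) with (cos t) by (field; lra).
destruct (Rle_dec 0 (r * sin t)) as [H|H].
- apply acos_cos. split; [|lra].
  destruct (Rle_dec 0 t); [lra|]. exfalso.
  assert (sin t < 0) by (apply sin_lt_0_var; lra). nra.
- rewrite <- cos_neg, acos_cos; [ring|].
  assert (t < 0); [|lra].
  destruct (Rlt_dec t 0) as [|K]; [lra|]. exfalso.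
  assert (0 <= sin t) by (apply sin_ge_0; lra). nra.
Qed.

Lemma Carg_1 : Carg 1 = 0.
Proof.
pose proof PI_RGT_0.
pose proof (Carg_cis 1 0 ltac:(lra) ltac:(lra)) as K.
rewrite cos_0, sin_0 in K.
replace ((1 * 1, 1 * 0) : C) with (RtoC 1) in K; [exact K|].
unfold RtoC; f_equal; ring.
Qed.

(* The matrix with rows [(ma, mb)] and [(mc, md)]. *)
Record SL2 := mkSL2 { ma : R; mb : R; mc : R; md : R; mdet : ma * md - mb * mc = 1 }.

Lemma SL2mul_det (g h : SL2) :
  (ma g * ma h + mb g * mc h) * (mc g * mb h + md g * md h)
  - (ma g * mb h + mb g * md h) * (mc g * ma h + md g * mc h) = 1.
Proof.
destruct g as [a b c d D], h as [a' b' c' d' D']; simpl.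
replace 1 with ((a * d - b * c) * (a' * d' - b' * c')) by (rewrite D, D'; ring). ring.
Qed.

Definition SL2mul (g h : SL2) : SL2 := mkSL2 _ _ _ _ (SL2mul_det g h).

Definition J (g : SL2) (z : C) : C := (RtoC (mc g) * z + RtoC (md g))%C.

Definition mobius (g : SL2) (z : C) : C := ((RtoC (ma g) * z + RtoC (mb g)) / J g z)%C.

Record Gt := mkGt {
  mat : SL2;
  ang : R;
  angP : (J mat Ci * Cexp (Ci * RtoC ang))%C = RtoC (Cmod (J mat Ci)) }.

Lemma J_Ci (g : SL2) : J g Ci = (md g, mc g).
Proof. unfold J, Cmult, Cplus, Ci, RtoC; simpl; f_equal; ring. Qed.

Lemma J_Ci_neq0 (g : SL2) : J g Ci <> 0.
Proof.
rewrite J_Ci. intros H. injection H; intros H1 H2.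
pose proof (mdet g) as D. rewrite H1, H2 in D. lra.
Qed.

Lemma J_mul (g h : SL2) (z : C) : J h z <> 0 -> J (SL2mul g h) z = (J g (mobius h z) * J h z)%C.
Proof.
intros H. unfold mobius, Cdiv.
replace (J g ((ma h * z + mb h) * / J h z) * J h z)%C
  with (RtoC (mc g) * (RtoC (ma h) * z + RtoC (mb h)) * (/ J h z * J h z)
        + RtoC (md g) * J h z)%C by (unfold J; ring).
rewrite Cinv_l by exact H.
unfold J, SL2mul; cbn [mc md]. rewrite !RtoC_plus, !RtoC_mult. ring.
Qed.

Lemma J_mobius_neq0 (g h : SL2) : J g (mobius h Ci) <> 0.
Proof.
intros H. apply (J_Ci_neq0 (SL2mul g h)).
rewrite J_mul by apply J_Ci_neq0. rewrite H. ring.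
Qed.

Lemma Cexp_angle (z : C) (t : R) : z <> 0 ->
  (z * Cexp (Ci * RtoC t))%C = RtoC (Cmod z) <-> Cexp (Ci * RtoC t) = (RtoC (Cmod z) / z)%C.
Proof.
intros Hz; split; intros H.
- rewrite <- H. field. exact Hz.
- rewrite H. field. exact Hz.
Qed.

Lemma Cexp_Carg_opp (z : C) : z <> 0 -> Cexp (Ci * RtoC (- Carg z)) = (RtoC (Cmod z) / z)%C.
Proof.
intros Hz. pose proof (Cpolar z Hz) as P.
set (E := Cexp (Ci * RtoC (Carg z))%C) in *.
set (E' := Cexp (Ci * RtoC (- Carg z))%C).
assert (HE : (E * E')%C = 1).
{ unfold E, E'. rewrite <- Cexp_add, RtoC_opp.
  replace (_ + _)%C with (RtoC 0) by ring. apply Cexp_0. }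
rewrite P at 2.
assert (E <> 0) by apply Cexp_neq0.
assert (RtoC (Cmod z) <> 0).
{ intros K. apply RtoC_inj in K. apply Cmod_eq_0 in K. contradiction. }
replace E' with (E * E' / E)%C by (field; assumption).
rewrite HE. field. split; assumption.
Qed.

Lemma Gmul_angP (g h : Gt) :
  let t := ang g + ang h - Carg (J (mat g) (mobius (mat h) Ci) / J (mat g) Ci) in
  (J (SL2mul (mat g) (mat h)) Ci * Cexp (Ci * RtoC t))%C
  = RtoC (Cmod (J (SL2mul (mat g) (mat h)) Ci)).
Proof.
intros t. apply Cexp_angle; [apply J_Ci_neq0|].
pose proof (J_Ci_neq0 (mat g)) as H1. pose proof (J_Ci_neq0 (mat h)) as H2.
pose proof (J_mobius_neq0 (mat g) (mat h)) as H3.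
pose proof (proj1 (Cexp_angle _ _ H1) (angP g)) as E1.
pose proof (proj1 (Cexp_angle _ _ H2) (angP h)) as E2.
rewrite (J_mul (mat g) (mat h)) by exact H2.
set (z1 := J (mat g) Ci) in *. set (z2 := J (mat h) Ci) in *.
set (z3 := J (mat g) (mobius (mat h) Ci)) in *.
assert (H4 : (z3 / z1)%C <> 0).
{ intros K. apply H3. replace z3 with (z3 / z1 * z1)%C by (field; exact H1).
  rewrite K. ring. }
pose proof (Cexp_Carg_opp _ H4) as E3.
unfold t. unfold Rminus. rewrite !RtoC_plus.
rewrite !Cmult_plus_distr_l, !Cexp_add, E1, E2, E3.
rewrite Cmod_div by exact H1. rewrite Cmod_mult.
assert (M1 : Cmod z1 <> 0) by (intros K; apply Cmod_eq_0 in K; contradiction).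
rewrite RtoC_div, RtoC_mult by exact M1.
assert (RtoC (Cmod z1) <> 0) by (intros K; apply RtoC_inj in K; contradiction).
field. repeat split; assumption.
Qed.

Definition Gmul (g h : Gt) : Gt := mkGt (SL2mul (mat g) (mat h)) _ (Gmul_angP g h).

Lemma ut_det (x : R) : 1 * 1 - x * 0 = 1. Proof. ring. Qed.

Lemma at_det (y : posreal) : sqrt y * (1 / sqrt y) - 0 * 0 = 1.
Proof. pose proof (sqrt_lt_R0 y (cond_pos y)). field. lra. Qed.

Lemma kt_det (t : R) : cos t * cos t - sin t * - sin t = 1.
Proof. pose proof (sin2_cos2 t) as H; unfold Rsqr in H; lra. Qed.

Definition umat (x : R) : SL2 := mkSL2 1 x 0 1 (ut_det x).
Definition amat (y : posreal) : SL2 := mkSL2 (sqrt y) 0 0 (1 / sqrt y) (at_det y).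
Definition kmat (t : R) : SL2 := mkSL2 (cos t) (sin t) (- sin t) (cos t) (kt_det t).

Lemma ut_angP (x : R) :
  (J (umat x) Ci * Cexp (Ci * RtoC 0))%C = RtoC (Cmod (J (umat x) Ci)).
Proof.
rewrite J_Ci; simpl. rewrite Cexp_Ci, cos_0, sin_0.
change ((1, 0) : C) with (RtoC 1). rewrite Cmod_1. ring.
Qed.

Lemma at_angP (y : posreal) :
  (J (amat y) Ci * Cexp (Ci * RtoC 0))%C = RtoC (Cmod (J (amat y) Ci)).
Proof.
rewrite J_Ci; simpl. rewrite Cexp_Ci, cos_0, sin_0.
change ((1 / sqrt y, 0) : C) with (RtoC (1 / sqrt y)). change ((1, 0) : C) with (RtoC 1).
rewrite Cmod_R, Rabs_pos_eq; [ring|].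
pose proof (sqrt_lt_R0 y (cond_pos y)). apply Rlt_le, Rdiv_lt_0_compat; lra.
Qed.

Lemma kt_angP (t : R) :
  (J (kmat t) Ci * Cexp (Ci * RtoC t))%C = RtoC (Cmod (J (kmat t) Ci)).
Proof.
rewrite J_Ci; simpl. rewrite Cexp_Ci.
pose proof (sin2_cos2 t) as H; unfold Rsqr in H.
replace (Cmod (cos t, - sin t)) with 1.
- unfold Cmult, RtoC; simpl; f_equal; [lra|ring].
- rewrite <- (Cmod_cis 1 (- t)) by lra. rewrite cos_neg, sin_neg. f_equal. f_equal; ring.
Qed.

Definition ut (x : R) : Gt := mkGt (umat x) 0 (ut_angP x).
Definition at_ (y : posreal) : Gt := mkGt (amat y) 0 (at_angP y).
Definition kt (t : R) : Gt := mkGt (kmat t) t (kt_angP t).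
Definition wt : Gt := kt (- PI / 2).

Definition CDerive (f : R -> C) (x : R) : C :=
  (Derive (fun t => Re (f t)) x, Derive (fun t => Im (f t)) x).

Fixpoint CDerive_n (f : R -> C) (n : nat) : R -> C :=
  match n with
  | O => f
  | S n' => CDerive (CDerive_n f n')
  end.

Definition Cex_derive (f : R -> C) (x : R) : Prop :=
  ex_derive (V := C_R_NormedModule) f x.

Definition smooth (f : R -> C) : Prop :=
  forall (n : nat) (x : R), Cex_derive (CDerive_n f n) x.

Fixpoint Ck3 (n : nat) (f : R -> R -> R -> C) : Prop :=
  (forall x s t : R,
     continuous (fun p : R * R * R => f (fst (fst p)) (snd (fst p)) (snd p)) ((x, s), t)) /\
  match n with
  | O => True
  | S n' =>
      (forall x s t : R,
         Cex_derive (fun r => f r s t) x /\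
         Cex_derive (fun r => f x r t) s /\
         Cex_derive (fun r => f x s r) t) /\
      Ck3 n' (fun x s t => CDerive (fun r => f r s t) x) /\
      Ck3 n' (fun x s t => CDerive (fun r => f x r t) s) /\
      Ck3 n' (fun x s t => CDerive (fun r => f x s r) t)
  end.

Definition smooth3 (f : R -> R -> R -> C) : Prop := forall n : nat, Ck3 n f.

Definition exppos (s : R) : posreal := mkposreal (exp s) (exp_pos s).

(* Iwasawa coordinates: a global chart of the manifold [Gt] (see [iwasawa_surj]
   and [iwasawa_inj]). *)
Definition iwasawa (x s t : R) : Gt := Gmul (Gmul (ut x) (at_ (exppos s))) (kt t).

Definition smoothG (F : Gt -> C) : Prop := smooth3 (fun x s t => F (iwasawa x s t)).

Lemma is_derive_C (f : R -> C) (x : R) (l : C) :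
  is_derive (V := C_R_NormedModule) f x l <->
  is_derive (fun t => Re (f t)) x (Re l) /\ is_derive (fun t => Im (f t)) x (Im l).
Proof.
split.
- intros H; split.
  + apply (is_derive_ext (fun t => fst (f t))); [reflexivity|].
    unfold is_derive.
    apply (filterdiff_ext_lin (V:=R_NormedModule) _ (fun y : R => fst (@scal _ C_R_NormedModule y l))); [|reflexivity].
    apply (filterdiff_comp' (U:=R_NormedModule) (V:=C_R_NormedModule) (W:=R_NormedModule) f fst x (fun y : R => @scal _ C_R_NormedModule y l) fst); [exact H|].
    apply filterdiff_linear. apply is_linear_fst.
  + apply (is_derive_ext (fun t => snd (f t))); [reflexivity|].
    unfold is_derive.
    apply (filterdiff_ext_lin (V:=R_NormedModule) _ (fun y : R => snd (@scal _ C_R_NormedModule y l))); [|reflexivity].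
    apply (filterdiff_comp' (U:=R_NormedModule) (V:=C_R_NormedModule) (W:=R_NormedModule) f snd x (fun y : R => @scal _ C_R_NormedModule y l) snd); [exact H|].
    apply filterdiff_linear. apply is_linear_snd.
- intros [H1 H2].
  apply (is_derive_ext (fun t => (Re (f t), Im (f t)))).
  { intros t; destruct (f t); reflexivity. }
  unfold is_derive.
  apply (filterdiff_ext_lin (V:=C_R_NormedModule) _ (fun y : R => (@scal _ R_NormedModule y (Re l), @scal _ R_NormedModule y (Im l)))).
  2: { intros y; destruct l; reflexivity. }
  apply (filterdiff_comp'_2 (T:=R_NormedModule) (U:=R_NormedModule) (V:=R_NormedModule) (W:=C_R_NormedModule) (fun t => Re (f t)) (fun t => Im (f t)) (fun a b : R => (a, b)) x
          (fun y : R => @scal _ R_NormedModule y (Re l)) (fun y : R => @scal _ R_NormedModule y (Im l)) (fun a b : R => (a, b))); auto.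
  apply filterdiff_ext_lin with (fun p : R * R => (fst p, snd p)); [|intros [? ?]; reflexivity].
  apply filterdiff_ext with (fun p : R * R => p); [intros [? ?]; reflexivity|].
  apply filterdiff_ext_lin with (fun p : R * R => p); [|intros [? ?]; reflexivity].
  apply filterdiff_id.
Qed.

Lemma CDerive_unique (f : R -> C) (x : R) (l : C) :
  is_derive (V := C_R_NormedModule) f x l -> CDerive f x = l.
Proof.
intros H. apply is_derive_C in H. destruct H as [H1 H2]. unfold CDerive.
apply injective_projections; simpl; apply is_derive_unique; assumption.
Qed.

Lemma CDerive_correct (f : R -> C) (x : R) :
  Cex_derive f x -> is_derive (V := C_R_NormedModule) f x (CDerive f x).
Proof. intros [l H]. rewrite (CDerive_unique _ _ _ H). exact H. Qed.

Lemma is_derive_Cplus (f g : R -> C) (x : R) (a b : C) :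
  is_derive (V := C_R_NormedModule) f x a -> is_derive (V := C_R_NormedModule) g x b ->
  is_derive (V := C_R_NormedModule) (fun t => f t + g t)%C x (a + b)%C.
Proof. apply (is_derive_plus (V := C_R_NormedModule)). Qed.

Lemma is_derive_Cmult (f g : R -> C) (x : R) (a b : C) :
  is_derive (V := C_R_NormedModule) f x a -> is_derive (V := C_R_NormedModule) g x b ->
  is_derive (V := C_R_NormedModule) (fun t => f t * g t)%C x (a * g x + f x * b)%C.
Proof.
intros Hf Hg. apply is_derive_C in Hf. apply is_derive_C in Hg.
destruct Hf as [F1 F2], Hg as [G1 G2]. apply is_derive_C. split.
- eapply is_derive_ext; [intros t; symmetry; unfold Re, Cmult; simpl; reflexivity|].
  evar_last.
  { apply (is_derive_minus (V := R_NormedModule)).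
    - apply (is_derive_mult _ _ _ _ _ F1 G1). intros; apply Rmult_comm.
    - apply (is_derive_mult _ _ _ _ _ F2 G2). intros; apply Rmult_comm. }
  unfold minus, plus, opp, mult, Re, Im, Cmult, Cplus; simpl. ring.
- eapply is_derive_ext; [intros t; symmetry; unfold Im, Cmult; simpl; reflexivity|].
  evar_last.
  { apply (is_derive_plus (V := R_NormedModule)).
    - apply (is_derive_mult _ _ _ _ _ F1 G2). intros; apply Rmult_comm.
    - apply (is_derive_mult _ _ _ _ _ F2 G1). intros; apply Rmult_comm. }
  unfold minus, plus, opp, mult, Re, Im, Cmult, Cplus; simpl. ring.
Qed.

Lemma is_derive_Cconst (c : C) (x : R) :
  is_derive (V := C_R_NormedModule) (fun _ => c) x (RtoC 0).
Proof. apply (is_derive_const (V := C_R_NormedModule)). Qed.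

Lemma is_derive_RtoC (u : R -> R) (x l : R) :
  is_derive u x l -> is_derive (V := C_R_NormedModule) (fun t => RtoC (u t)) x (RtoC l).
Proof.
intros H. apply is_derive_C. split; [exact H|].
exact (is_derive_const (V := R_NormedModule) (0 : R_NormedModule) x).
Qed.

Lemma is_derive_Ccomp (f : R -> C) (h : R -> R) (x : R) (l : C) (h' : R) :
  is_derive (V := C_R_NormedModule) f (h x) l -> is_derive h x h' ->
  is_derive (V := C_R_NormedModule) (fun t => f (h t)) x (RtoC h' * l)%C.
Proof.
intros Hf Hh. evar_last.
- apply (is_derive_comp (V := C_R_NormedModule) f h x l h' Hf Hh).
- destruct l; unfold scal, Cmult, RtoC; simpl. unfold prod_scal, scal; simpl.
  unfold mult; simpl. f_equal; ring.
Qed.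

Lemma is_derive_Cexp (u : R -> C) (x : R) (l : C) :
  is_derive (V := C_R_NormedModule) u x l ->
  is_derive (V := C_R_NormedModule) (fun t => Cexp (u t)) x (l * Cexp (u x))%C.
Proof.
intros H. apply is_derive_C in H. destruct H as [H1 H2].
apply is_derive_C. unfold Cexp, Re, Im, Cmult in *; simpl in *. split.
- evar_last.
  { apply (is_derive_mult (fun t => exp (fst (u t))) (fun t => cos (snd (u t)))).
    - apply (is_derive_comp exp _ _ _ _ (is_derive_exp _) H1).
    - apply (is_derive_comp cos _ _ _ _ (is_derive_cos _) H2).
    - intros; apply Rmult_comm. }
  unfold plus, mult, scal; simpl; unfold mult; simpl. ring.
- evar_last.
  { apply (is_derive_mult (fun t => exp (fst (u t))) (fun t => sin (snd (u t)))).
    - apply (is_derive_comp exp _ _ _ _ (is_derive_exp _) H1).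
    - apply (is_derive_comp sin _ _ _ _ (is_derive_sin _) H2).
    - intros; apply Rmult_comm. }
  unfold plus, mult, scal; simpl; unfold mult; simpl. ring.
Qed.

Lemma CDerive_comb (a b : C) (f g : R -> C) (x : R) :
  Cex_derive f x -> Cex_derive g x ->
  is_derive (V := C_R_NormedModule) (fun t => a * f t + b * g t)%C x
    (a * CDerive f x + b * CDerive g x)%C.
Proof.
intros Hf Hg. evar_last.
{ apply is_derive_Cplus; apply is_derive_Cmult.
  - apply is_derive_Cconst.
  - apply CDerive_correct, Hf.
  - apply is_derive_Cconst.
  - apply CDerive_correct, Hg. }
simpl. ring.
Qed.

Lemma CDerive_n_shift (n : nat) (f : R -> C) : CDerive_n f (S n) = CDerive_n (CDerive f) n.
Proof. induction n as [|n IH]; [reflexivity|]. change (CDerive (CDerive_n f (S n)) = CDerive (CDerive_n (CDerive f) n)). now rewrite IH. Qed.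

Lemma smooth_ex (f : R -> C) (x : R) : smooth f -> Cex_derive f x.
Proof. intros H. exact (H O x). Qed.

Lemma smooth_D (f : R -> C) : smooth f -> smooth (CDerive f).
Proof. intros H n x. rewrite <- CDerive_n_shift. apply H. Qed.

Lemma smooth_coind (P : (R -> C) -> Prop) :
  (forall f, P f -> (forall x, Cex_derive f x) /\ P (CDerive f)) ->
  forall f, P f -> smooth f.
Proof.
intros HP f Hf n. revert f Hf. induction n as [|n IH]; intros f Hf.
- apply (HP f Hf).
- rewrite CDerive_n_shift. apply IH. apply (HP f Hf).
Qed.

Lemma smooth_comb (a b : C) (f g : R -> C) :
  smooth f -> smooth g -> smooth (fun x => a * f x + b * g x)%C.
Proof.
intros Hf Hg.
apply (smooth_coind (fun h => exists f g, smooth f /\ smooth g /\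
                                h = (fun x => a * f x + b * g x)%C)); [|eauto].
clear. intros h (f & g & Hf & Hg & ->).
assert (D : forall x, is_derive (V := C_R_NormedModule) (fun t => a * f t + b * g t)%C x
              (a * CDerive f x + b * CDerive g x)%C)
  by (intros x; apply CDerive_comb; apply smooth_ex; assumption).
split; [intros x; eexists; apply D|].
exists (CDerive f), (CDerive g). split; [|split]; [apply smooth_D; assumption..|].
apply functional_extensionality; intros x. apply CDerive_unique, D.
Qed.

Lemma smooth_const (c : C) : smooth (fun _ => c).
Proof.
apply (smooth_coind (fun h => exists c, h = fun _ => c)); [|eauto].
clear. intros h (c & ->).
split; [intros x; eexists; apply is_derive_Cconst|].
exists (RtoC 0). apply functional_extensionality; intros x.
apply CDerive_unique, is_derive_Cconst.
Qed.

Lemma smooth_mult (f g : R -> C) : smooth f -> smooth g -> smooth (fun x => f x * g x)%C.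
Proof.
intros Hf Hg n. revert f g Hf Hg.
enough (K : forall n (f g : R -> C), smooth f -> smooth g ->
          (forall x, Cex_derive (CDerive_n (fun x => f x * g x)%C n) x) /\
          forall m x, (m <= n)%nat -> CDerive_n (fun x => f x * g x)%C (S m) x
           = (CDerive_n (fun x => CDerive f x * g x)%C m x
              + CDerive_n (fun x => f x * CDerive g x)%C m x)%C).
{ intros f g Hf Hg. apply (K n f g Hf Hg). }
clear n. induction n as [|n IH]; intros f g Hf Hg.
- assert (D : forall x, is_derive (V := C_R_NormedModule) (fun t => f t * g t)%C x
              (CDerive f x * g x + f x * CDerive g x)%C).
  { intros x; apply is_derive_Cmult; apply CDerive_correct, smooth_ex; assumption. }
  split; [intros x; eexists; apply D|].
  intros m x Hm. replace m with O by lia. simpl. apply CDerive_unique, D.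
- pose proof (IH f g Hf Hg) as [_ H2].
  pose proof (IH _ g (smooth_D f Hf) Hg) as [A1 _].
  pose proof (IH f _ Hf (smooth_D g Hg)) as [A2 _].
  assert (E : CDerive_n (fun x => f x * g x)%C (S n) =
     fun x => (CDerive_n (fun x => CDerive f x * g x)%C n x
              + CDerive_n (fun x => f x * CDerive g x)%C n x)%C).
  { apply functional_extensionality; intros x. apply H2. lia. }
  assert (D : forall x, is_derive (V := C_R_NormedModule) (CDerive_n (fun x => f x * g x)%C (S n)) x
     (CDerive_n (fun x => CDerive f x * g x)%C (S n) x
              + CDerive_n (fun x => f x * CDerive g x)%C (S n) x)%C).
  { intros x. rewrite E. apply is_derive_Cplus; simpl; apply CDerive_correct; auto. }
  split; [intros x; eexists; apply D|].
  intros m x Hm. destruct (Nat.eq_dec m (S n)) as [->|].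
  + apply CDerive_unique, D.
  + apply H2. lia.
Qed.

Lemma smooth_RtoC_id : smooth RtoC.
Proof.
assert (D : forall x, is_derive (V := C_R_NormedModule) RtoC x (RtoC 1)).
{ intros x. apply (is_derive_RtoC (fun t => t)). apply (is_derive_id (K := R_AbsRing)). }
intros [|n].
- intros x. eexists; apply D.
- rewrite CDerive_n_shift. replace (CDerive RtoC) with (fun _ : R => RtoC 1).
  + apply smooth_const.
  + apply functional_extensionality; intros x. symmetry. apply CDerive_unique, D.
Qed.

Lemma smooth_expl (c : C) : smooth (fun s => Cexp (c * RtoC s)%C).
Proof.
apply (smooth_coind (fun h => exists a, h = fun s => (a * Cexp (c * RtoC s))%C)).
2: { exists 1. apply functional_extensionality; intros s. ring. }
intros h (a & ->).
assert (D : forall x, is_derive (V := C_R_NormedModule) (fun s => a * Cexp (c * RtoC s))%C x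
              (a * c * Cexp (c * RtoC x))%C).
{ intros x. evar_last.
  { apply is_derive_Cmult; [apply is_derive_Cconst|].
    apply (is_derive_Cexp (fun s => c * RtoC s)%C).
    apply is_derive_Cmult; [apply is_derive_Cconst|].
    apply (is_derive_RtoC (fun t => t)). apply (is_derive_id (K := R_AbsRing)). }
  simpl. unfold one; simpl. ring. }
split; [intros x; eexists; apply D|].
exists (a * c)%C. apply functional_extensionality; intros x. apply CDerive_unique, D.
Qed.

Record Cc := mkCc {
  cfun :> R -> C;
  csmooth : smooth cfun;
  csupp : exists u : R, forall x, u < Rabs x -> cfun x = 0 }.

(* Test functions on the punctured line, extended by 0 at the origin. *)
Record Cx := mkCx {
  xfun :> Cc;
  xsupp : exists e : R, 0 < e /\ forall x, Rabs x < e -> xfun x = 0 }.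

Lemma Ccomb_supp (a b : C) (f g : Cc) :
  exists u : R, forall x, u < Rabs x -> (a * f x + b * g x)%C = 0.
Proof.
destruct (csupp f) as [u Hu], (csupp g) as [v Hv].
exists (Rmax u v). intros x Hx.
rewrite Hu, Hv; [ring| |].
- eapply Rle_lt_trans; [apply Rmax_r|exact Hx].
- eapply Rle_lt_trans; [apply Rmax_l|exact Hx].
Qed.

Definition Ccomb (a b : C) (f g : Cc) : Cc :=
  mkCc (fun x => a * f x + b * g x)%C
    (smooth_comb a b f g (csmooth f) (csmooth g)) (Ccomb_supp a b f g).

Lemma CDerive_loc0 (f : R -> C) (x : R) :
  locally x (fun t => f t = 0) -> is_derive (V := C_R_NormedModule) f x (RtoC 0).
Proof.
intros H. apply (is_derive_ext_loc (K := R_AbsRing) (V := C_R_NormedModule) (fun _ => RtoC 0)).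
- refine (filter_imp _ _ _ H). intros t Ht. now symmetry.
- apply is_derive_Cconst.
Qed.

Lemma locally_R (P : R -> Prop) (x d : R) :
  0 < d -> (forall t : R, Rabs (t - x) < d -> P t) -> locally x P.
Proof. intros Hd H. exists (mkposreal d Hd). intros t Ht. apply H, Ht. Qed.

Lemma locally_gt (u x : R) : u < Rabs x -> locally x (fun t => u < Rabs t).
Proof.
intros H. apply (locally_R _ x (Rabs x - u)); [lra|]. intros t Ht.
pose proof (Rabs_triang_inv x (x - t)) as K.
replace (x - (x - t)) with t in K by ring.
replace (x - t) with (- (t - x)) in K by ring. rewrite Rabs_Ropp in K. lra.
Qed.

Lemma locally_lt (u x : R) : Rabs x < u -> locally x (fun t => Rabs t < u).
Proof.
intros H. apply (locally_R _ x (u - Rabs x)); [lra|]. intros t Ht.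
pose proof (Rabs_triang x (t - x)) as K.
replace (x + (t - x)) with t in K by ring. lra.
Qed.

(* The operator [p f + q f'] for smooth [p], [q], on test functions. *)
Lemma Dop_smooth (p q : R -> C) (f : Cc) : smooth p -> smooth q ->
  smooth (fun x => p x * f x + q x * CDerive f x)%C.
Proof.
intros Hp Hq.
replace (fun x => p x * f x + q x * CDerive f x)%C
  with (fun x => 1 * (p x * f x) + 1 * (q x * CDerive f x))%C
  by (apply functional_extensionality; intros x; ring).
apply (smooth_comb 1 1 (fun x => p x * f x)%C (fun x => q x * CDerive f x)%C);
  apply smooth_mult; auto.
- apply csmooth.
- apply smooth_D, csmooth.
Qed.

Lemma Dop_supp (p q : R -> C) (f : Cc) :
  exists u : R, forall x, u < Rabs x -> (p x * f x + q x * CDerive f x)%C = 0.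
Proof.
destruct (csupp f) as [u Hu]. exists u. intros x Hx.
rewrite (CDerive_unique f x (RtoC 0)).
- rewrite Hu by exact Hx. ring.
- apply CDerive_loc0. exact (filter_imp _ _ Hu (locally_gt _ _ Hx)).
Qed.

Lemma Dop_xsupp (p q : R -> C) (f : Cx) :
  exists e : R, 0 < e /\ forall x, Rabs x < e -> (p x * f x + q x * CDerive f x)%C = 0.
Proof.
destruct (xsupp f) as [e [He Hv]]. exists e. split; [exact He|]. intros x Hx.
rewrite (CDerive_unique f x (RtoC 0)).
- rewrite Hv by exact Hx. ring.
- apply CDerive_loc0. exact (filter_imp _ _ Hv (locally_lt _ _ Hx)).
Qed.

Lemma is_derive_Rcpow (h : R -> R) (s : C) (x h' : R) : 0 < h x -> is_derive h x h' ->
  is_derive (V := C_R_NormedModule) (fun t => Rcpow (h t) s) x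
    (s * RtoC (h' / h x) * Rcpow (h x) s)%C.
Proof.
intros H0 H. unfold Rcpow. evar_last.
{ apply (is_derive_Cexp (fun t => s * RtoC (ln (h t)))%C).
  apply is_derive_Cmult; [apply is_derive_Cconst|].
  apply (is_derive_RtoC (fun t => ln (h t))).
  apply (is_derive_comp ln h x (/ h x) h'); [|exact H].
  apply is_derive_Reals, derivable_pt_lim_ln, H0. }
simpl. unfold scal; simpl; unfold mult; simpl. unfold Rdiv. ring.
Qed.

Lemma locally_pos_sign (x : R) : x <> 0 ->
  locally x (fun t => t <> 0 /\ sign t = sign x).
Proof.
intros N. pose proof (Rabs_pos_lt x N) as P.
apply (locally_R _ x (Rabs x) P). intros t Ht.
apply Rabs_def2 in Ht.
destruct (Rdichotomy x 0 N) as [H|H].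
- rewrite Rabs_left in Ht by lra. rewrite !sign_eq_m1; lra.
- rewrite Rabs_pos_eq in Ht by lra. rewrite !sign_eq_1; lra.
Qed.

(* [finf_fun mu nu f] is [f_{mu,nu,oo}], extended by 0 at 0. *)
Definition finf_fun (mu nu : C) (f : R -> C) (x : R) : C :=
  if Req_EM_T x 0 then RtoC 0
  else (Cexp (- (RtoC (sign x) * RtoC PI * Ci * mu / RtoC 2))
        * Rcpow (Rabs x) (- RtoC 2 * nu - RtoC 1) * f (- 1 / x)%R)%C.

Lemma finf_locally0 (mu nu : C) (f : Cc) :
  exists e : R, 0 < e /\ forall x, Rabs x < e -> finf_fun mu nu f x = 0.
Proof.
destruct (csupp f) as [u Hu].
exists (/ (Rmax u 0 + 1)).
pose proof (Rmax_l u 0). pose proof (Rmax_r u 0).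
split; [apply Rinv_0_lt_compat; lra|]. intros x Hx. unfold finf_fun.
destruct (Req_EM_T x 0) as [|N]; [reflexivity|].
rewrite Hu; [ring|].
unfold Rdiv. rewrite Rabs_mult, Rabs_inv, Rabs_left by lra.
pose proof (Rabs_pos_lt x N) as P.
assert (Rmax u 0 + 1 < / Rabs x); [|lra].
rewrite <- (Rinv_inv (Rmax u 0 + 1)). apply Rinv_lt_contravar; [|exact Hx].
apply Rmult_lt_0_compat; [exact P|]. apply Rinv_0_lt_compat; lra.
Qed.

Lemma finf_supp (mu nu : C) (f : Cx) :
  exists u : R, forall x, u < Rabs x -> finf_fun mu nu f x = 0.
Proof.
destruct (xsupp f) as [e [He Hv]].
exists (/ e). intros x Hx. unfold finf_fun.
destruct (Req_EM_T x 0) as [|N]; [reflexivity|].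
rewrite Hv; [ring|].
unfold Rdiv. rewrite Rabs_mult, Rabs_inv, Rabs_left by lra.
pose proof (Rinv_0_lt_compat e He).
assert (/ Rabs x < e); [|lra].
rewrite <- (Rinv_inv e). apply Rinv_lt_contravar; [|exact Hx].
apply Rmult_lt_0_compat; lra.
Qed.

Lemma finf_step (mu nu : C) (f : Cx) : exists g : Cx, forall x,
  is_derive (V := C_R_NormedModule) (finf_fun mu nu f) x (finf_fun mu nu g x).
Proof.
set (p := fun y : R => ((RtoC 2 * nu + RtoC 1) * RtoC y + RtoC 0 * RtoC 0)%C).
set (q := fun y : R => (RtoC y * RtoC y)%C).
assert (Hp : smooth p) by (apply (smooth_comb _ _ RtoC (fun _ => RtoC 0)); [apply smooth_RtoC_id|apply smooth_const]).
assert (Hq : smooth q) by (apply smooth_mult; apply smooth_RtoC_id).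
exists (mkCx (mkCc _ (Dop_smooth p q f Hp Hq) (Dop_supp p q f)) (Dop_xsupp p q f)).
intros x. destruct (Req_dec x 0) as [->|N].
- unfold finf_fun at 2. destruct (Req_EM_T 0 0) as [_|]; [|lra].
  apply CDerive_loc0. destruct (finf_locally0 mu nu f) as [e [He Hv]].
  refine (filter_imp _ _ Hv (locally_lt e 0 _)). rewrite Rabs_R0; lra.
- unfold finf_fun at 2. destruct (Req_EM_T x 0) as [|_]; [lra|].
  set (K := Cexp (- (RtoC (sign x) * RtoC PI * Ci * mu / RtoC 2))).
  set (s := (- RtoC 2 * nu - RtoC 1)%C).
  assert (Sx : sign x * sign x = 1).
  { destruct (Rdichotomy x 0 N); [rewrite sign_eq_m1|rewrite sign_eq_1]; lra. }
  assert (Ax : sign x * x = Rabs x).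
  { destruct (Rdichotomy x 0 N);
    [rewrite sign_eq_m1, Rabs_left|rewrite sign_eq_1, Rabs_pos_eq]; lra. }
  pose proof (Rabs_pos_lt x N) as Px.
  apply (is_derive_ext_loc (K := R_AbsRing) (V := C_R_NormedModule) (fun t => K * Rcpow (sign x * t) s * f (- 1 / t)%R)%C).
  + refine (filter_imp _ _ _ (locally_pos_sign x N)). intros t [Nt St]. unfold finf_fun.
    destruct (Req_EM_T t 0) as [|_]; [lra|]. rewrite St. fold K.
    f_equal. f_equal. f_equal. rewrite <- St.
    destruct (Rdichotomy t 0 Nt);
    [rewrite sign_eq_m1, Rabs_left|rewrite sign_eq_1, Rabs_pos_eq]; lra.
  + evar_last.
    { apply is_derive_Cmult.
      - apply is_derive_Cmult; [apply is_derive_Cconst|].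
        apply (is_derive_Rcpow (fun t => sign x * t) s x (sign x)); [lra|].
        auto_derive; [trivial|ring].
      - apply (is_derive_Ccomp f (fun t => - 1 / t) x (CDerive f (- 1 / x)) (/ (x * x))).
        + apply CDerive_correct, smooth_ex, csmooth.
        + auto_derive; [exact N|field; exact N]. }
    simpl. rewrite Ax. set (E := Rcpow (Rabs x) s). unfold p, q, s.
    replace (sign x / Rabs x) with (/ x).
    2: { rewrite <- Ax. field_simplify_eq; [|split; [exact N|intros Z; rewrite Z in Sx; lra]]. ring. }
    replace (- 1 / x)%R with (- / x) by (unfold Rdiv; ring).
    rewrite Rinv_mult, !RtoC_opp, !RtoC_mult. ring.
Qed.

Lemma finf_smooth (mu nu : C) (f : Cx) : smooth (finf_fun mu nu f).
Proof.
apply (smooth_coind (fun h => exists g : Cx, h = finf_fun mu nu g)); [|eauto].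
clear. intros h (f & ->). destruct (finf_step mu nu f) as [g Hg].
split; [intros x; eexists; apply Hg|].
exists g. apply functional_extensionality; intros x. apply CDerive_unique, Hg.
Qed.

Definition finf (mu nu : C) (f : Cx) : Cx :=
  mkCx (mkCc (finf_fun mu nu f) (finf_smooth mu nu f) (finf_supp mu nu f))
    (finf_locally0 mu nu f).

Lemma Gt_eq (g h : Gt) :
  ma (mat g) = ma (mat h) -> mb (mat g) = mb (mat h) ->
  mc (mat g) = mc (mat h) -> md (mat g) = md (mat h) -> ang g = ang h -> g = h.
Proof.
destruct g as [[a b c d D] t P], h as [[a' b' c' d' D'] t' P']; simpl.
intros -> -> -> -> ->.
assert (D = D') by apply proof_irrelevance. subst D'. f_equal. apply proof_irrelevance.
Qed.

Lemma mobius_kmat (t : R) : mobius (kmat t) Ci = Ci.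
Proof.
unfold mobius. replace (RtoC (ma (kmat t)) * Ci + RtoC (mb (kmat t)))%C with (Ci * J (kmat t) Ci)%C.
- field. apply J_Ci_neq0.
- rewrite J_Ci. unfold Cmult, Cplus, Ci, RtoC; simpl. f_equal; ring.
Qed.

Lemma ang_mul_k (g : Gt) (t : R) : ang (Gmul g (kt t)) = ang g + t.
Proof.
simpl. rewrite mobius_kmat.
replace (J (mat g) Ci / J (mat g) Ci)%C with (RtoC 1) by (field; apply J_Ci_neq0).
rewrite Carg_1. ring.
Qed.

Lemma ang_mul_ut (p g : Gt) : mc (mat p) = 0 -> ang (Gmul p g) = ang p + ang g.
Proof.
intros H. simpl.
pose proof (J_Ci_neq0 (mat p)) as N.
assert (E : forall z, J (mat p) z = RtoC (md (mat p))) by (intros z; unfold J; rewrite H; ring).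
rewrite !E in *.
replace (RtoC (md (mat p)) / RtoC (md (mat p)))%C with (RtoC 1) by (field; exact N).
rewrite Carg_1. ring.
Qed.

Lemma mobius_mul_k (g : Gt) (t : R) : mobius (mat (Gmul g (kt t))) Ci = mobius (mat g) Ci.
Proof.
change (mat (Gmul g (kt t))) with (SL2mul (mat g) (kmat t)).
pose proof (J_mul (mat g) (kmat t) Ci (J_Ci_neq0 _)) as E. rewrite mobius_kmat in E.
pose proof (J_Ci_neq0 (mat g)) as N1. pose proof (J_Ci_neq0 (kmat t)) as N2.
unfold mobius. rewrite E.
replace (RtoC (ma (SL2mul (mat g) (kmat t))) * Ci + RtoC (mb (SL2mul (mat g) (kmat t))))%C
  with ((RtoC (ma (mat g)) * Ci + RtoC (mb (mat g))) * J (kmat t) Ci)%C.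
- field. split; assumption.
- rewrite J_Ci. unfold Cmult, Cplus, Ci, RtoC; simpl. f_equal; ring.
Qed.

Lemma Gmul_assoc_k (p g : Gt) (t : R) : Gmul (Gmul p g) (kt t) = Gmul p (Gmul g (kt t)).
Proof.
apply Gt_eq; [simpl; ring..|].
rewrite ang_mul_k. unfold Gmul at 2; cbn [ang].
rewrite mobius_mul_k, ang_mul_k. simpl. ring.
Qed.

Lemma mc_ua (x : R) (y : posreal) : mc (mat (Gmul (ut x) (at_ y))) = 0.
Proof. simpl; ring. Qed.

Lemma md_ua (x : R) (y : posreal) : md (mat (Gmul (ut x) (at_ y))) = / sqrt y.
Proof. simpl. unfold Rdiv. ring. Qed.

Lemma ang_ua (x : R) (y : posreal) : ang (Gmul (ut x) (at_ y)) = 0.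
Proof. rewrite ang_mul_ut by reflexivity. simpl. ring. Qed.

Lemma ang_iwasawa (x s t : R) : ang (iwasawa x s t) = t.
Proof. unfold iwasawa. rewrite ang_mul_k, ang_ua. ring. Qed.

Lemma mc_iwasawa (x s t : R) : mc (mat (iwasawa x s t)) = - sin t / sqrt (exp s).
Proof.
unfold iwasawa. change (mc (mat (Gmul ?p (kt t)))) with (mc (mat p) * cos t + md (mat p) * - sin t).
rewrite mc_ua, md_ua. simpl. unfold Rdiv. ring.
Qed.

Lemma md_iwasawa (x s t : R) : md (mat (iwasawa x s t)) = cos t / sqrt (exp s).
Proof.
unfold iwasawa. change (md (mat (Gmul ?p (kt t)))) with (mc (mat p) * sin t + md (mat p) * cos t).
rewrite mc_ua, md_ua. simpl. unfold Rdiv. ring.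
Qed.

Lemma sqrt_exp_gt0 (s : R) : 0 < sqrt (exp s).
Proof. apply sqrt_lt_R0, exp_pos. Qed.

Lemma iwasawa_inj (x s t x' s' t' : R) :
  iwasawa x s t = iwasawa x' s' t' -> x = x' /\ s = s' /\ t = t'.
Proof.
intros H.
assert (Et : t = t') by (rewrite <- (ang_iwasawa x s t), H; apply ang_iwasawa). subst t'.
pose proof (f_equal (fun g => mc (mat g)) H) as Hc.
pose proof (f_equal (fun g => md (mat g)) H) as Hd. cbn beta in Hc, Hd.
rewrite !mc_iwasawa in Hc. rewrite !md_iwasawa in Hd.
pose proof (sqrt_exp_gt0 s) as P. pose proof (sqrt_exp_gt0 s') as P'.
pose proof (sin2_cos2 t) as SC; unfold Rsqr in SC.
assert (K1 : forall v, v = - sin t * (- sin t * v) + cos t * (cos t * v)) by (intros v; transitivity ((sin t * sin t + cos t * cos t) * v); [rewrite SC|]; ring).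
unfold Rdiv in Hc, Hd.
assert (Es : / sqrt (exp s) = / sqrt (exp s')).
{ rewrite (K1 (/ sqrt (exp s))), Hc, Hd. symmetry. apply K1. }
apply Rinv_eq_reg in Es. apply sqrt_inj in Es; [|left; apply exp_pos..].
apply exp_inv in Es. subst s'. split; [|split; reflexivity].
pose proof (f_equal (fun g => ma (mat g)) H) as Ha.
pose proof (f_equal (fun g => mb (mat g)) H) as Hb. simpl in Ha, Hb.
set (r := sqrt (exp s)) in *.
assert (K : x * (1 / r) = x' * (1 / r)).
{ assert (A1 : - sin t * (x * (1 / r)) = - sin t * (x' * (1 / r))) by lra.
  assert (A2 : cos t * (x * (1 / r)) = cos t * (x' * (1 / r))) by lra.
  rewrite (K1 (x * (1 / r))), A1, A2. symmetry. apply K1. }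
apply Rmult_eq_reg_r in K; [exact K|]. apply Rgt_not_eq, Rdiv_lt_0_compat; lra.
Qed.

Lemma iwasawa_surj (g : Gt) : exists x s t : R, g = iwasawa x s t.
Proof.
pose proof (angP g) as P. rewrite J_Ci, Cexp_Ci in P.
set (a := ma (mat g)). set (b := mb (mat g)).
set (c := mc (mat g)) in *. set (d := md (mat g)) in *.
pose proof (mdet (mat g)) as D. fold a b c d in D.
set (r := Cmod (d, c)) in *.
assert (Hr : 0 < r).
{ apply Cmod_gt_0. intros K. injection K; intros K1 K2. rewrite K1, K2 in D. lra. }
pose proof (Cmod_sqr (d, c)) as R2. fold r in R2. unfold Re, Im in R2; simpl in R2.
unfold Cmult, RtoC in P; simpl in P. injection P; intros P2 P1.
pose proof (sin2_cos2 (ang g)) as SC; unfold Rsqr in SC.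
assert (Ed : d = r * cos (ang g)) 
  by (transitivity (d * (sin (ang g) * sin (ang g) + cos (ang g) * cos (ang g))); [rewrite SC; ring|];
      transitivity ((d * cos (ang g) - c * sin (ang g)) * cos (ang g)
        + (d * sin (ang g) + c * cos (ang g)) * sin (ang g)); [ring|rewrite P1, P2; ring]).
assert (Ec : c = - r * sin (ang g)) 
  by (transitivity (c * (sin (ang g) * sin (ang g) + cos (ang g) * cos (ang g))); [rewrite SC; ring|];
      transitivity (- (d * cos (ang g) - c * sin (ang g)) * sin (ang g)
        + (d * sin (ang g) + c * cos (ang g)) * cos (ang g)); [ring|rewrite P1, P2; ring]).
exists ((a * c + b * d) / (r * r)), (- ln (r * r)), (ang g).
assert (Hs : sqrt (exp (- ln (r * r))) = / r).
{ rewrite exp_Ropp, exp_ln by nra. rewrite sqrt_inv.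
  f_equal. apply sqrt_square; lra. }
assert (Ec' : sin (ang g) = - c / r) by (rewrite Ec; field; lra).
assert (Ed' : cos (ang g) = d / r) by (rewrite Ed; field; lra).
apply Gt_eq.
- assert (E : a * (r * r) = d + c * (a * c + b * d)).
  { rewrite R2. transitivity (a * (d * d + c * c) + d * (1 - (a * d - b * c)));
    [rewrite D|]; ring. }
  simpl. rewrite Hs. fold a. rewrite Ec', Ed'.
  apply Rmult_eq_reg_r with (r * r); [rewrite E; field; lra|nra].
- assert (E : b * (r * r) = - c + d * (a * c + b * d)).
  { rewrite R2. transitivity (b * (d * d + c * c) - c * (1 - (a * d - b * c)));
    [rewrite D|]; ring. }
  simpl. rewrite Hs. fold b. rewrite Ec', Ed'.
  apply Rmult_eq_reg_r with (r * r); [rewrite E; field; lra|nra].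
- rewrite mc_iwasawa, Hs. fold c. rewrite Ec'. field. lra.
- rewrite md_iwasawa, Hs. fold d. rewrite Ed'. field. lra.
- symmetry; apply ang_iwasawa.
Qed.

Lemma continuous_C {U : UniformSpace} (f : U -> C) (x : U) :
  continuous f x <->
  continuous (fun t => Re (f t)) x /\ continuous (fun t => Im (f t)) x.
Proof.
split.
- intros H; split.
  + apply (continuous_comp f fst); [exact H|]. destruct (f x). apply continuous_fst.
  + apply (continuous_comp f snd); [exact H|]. destruct (f x). apply continuous_snd.
- intros [H1 H2].
  apply (continuous_ext (fun t => ((Re (f t), Im (f t)) : C))).
  { intros t. destruct (f t); reflexivity. }
  apply (continuous_comp_2 (V := R_UniformSpace) (W := R_UniformSpace) (X := C_UniformSpace)
           (fun t => Re (f t)) (fun t => Im (f t)) (fun a b => (a, b)) x H1 H2).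
  apply (continuous_ext (fun p => p : C)); [intros [? ?]; reflexivity|]. apply continuous_id.
Qed.

Lemma continuous_Cplus {U : UniformSpace} (f g : U -> C) (x : U) :
  continuous f x -> continuous g x -> continuous (fun t => f t + g t)%C x.
Proof.
intros Hf Hg. apply continuous_C in Hf, Hg. apply continuous_C. split; simpl.
- apply (continuous_plus (V := R_NormedModule)); tauto.
- apply (continuous_plus (V := R_NormedModule)); tauto.
Qed.

Lemma continuous_Cmult {U : UniformSpace} (f g : U -> C) (x : U) :
  continuous f x -> continuous g x -> continuous (fun t => f t * g t)%C x.
Proof.
intros Hf Hg. apply continuous_C in Hf, Hg. apply continuous_C. split; simpl.
- apply (continuous_minus (V := R_NormedModule));
  apply (continuous_mult (K := R_AbsRing)); tauto.
- apply (continuous_plus (V := R_NormedModule));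
  apply (continuous_mult (K := R_AbsRing)); tauto.
Qed.

Lemma smooth_continuous (f : R -> C) (x : R) : smooth f -> continuous f x.
Proof.
intros H. destruct (smooth_ex f x H) as [l Hl]. apply is_derive_C in Hl.
apply continuous_C. split; apply (ex_derive_continuous (V := R_NormedModule)).
- exists (Re l). exact (proj1 Hl).
- exists (Im l). exact (proj2 Hl).
Qed.

Lemma Ck3_ext (n : nat) (f g : R -> R -> R -> C) :
  (forall x s t, f x s t = g x s t) -> Ck3 n f -> Ck3 n g.
Proof.
intros E. replace g with f; [auto|].
do 3 (apply functional_extensionality; intros ?). apply E.
Qed.

Lemma Ck3_comb (a b : C) (n : nat) : forall f g : R -> R -> R -> C,
  Ck3 n f -> Ck3 n g -> Ck3 n (fun x s t => a * f x s t + b * g x s t)%C.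
Proof.
induction n as [|n IH]; intros f g [Cf Hf] [Cg Hg]; split.
1, 3: intros x s t; apply continuous_Cplus; apply continuous_Cmult;
  [apply continuous_const|apply Cf|apply continuous_const|apply Cg].
- exact I.
- destruct Hf as (Df & F1 & F2 & F3), Hg as (Dg & G1 & G2 & G3).
  assert (D1 : forall x s t, is_derive (V := C_R_NormedModule) (fun r => a * f r s t + b * g r s t)%C x
     (a * CDerive (fun r => f r s t) x + b * CDerive (fun r => g r s t) x)%C)
    by (intros x s t; apply CDerive_comb; [exact (proj1 (Df x s t))|exact (proj1 (Dg x s t))]).
  assert (D2 : forall x s t, is_derive (V := C_R_NormedModule) (fun r => a * f x r t + b * g x r t)%C s
     (a * CDerive (fun r => f x r t) s + b * CDerive (fun r => g x r t) s)%C)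
    by (intros x s t; apply CDerive_comb; [exact (proj1 (proj2 (Df x s t)))|exact (proj1 (proj2 (Dg x s t)))]).
  assert (D3 : forall x s t, is_derive (V := C_R_NormedModule) (fun r => a * f x s r + b * g x s r)%C t
     (a * CDerive (fun r => f x s r) t + b * CDerive (fun r => g x s r) t)%C)
    by (intros x s t; apply CDerive_comb; [exact (proj2 (proj2 (Df x s t)))|exact (proj2 (proj2 (Dg x s t)))]).
  split; [|split; [|split]].
  + intros x s t. split; [|split]; eexists; [exact (D1 x s t)|exact (D2 x s t)|exact (D3 x s t)].
  + refine (Ck3_ext n _ _ (fun x s t => eq_sym (CDerive_unique _ _ _ (D1 x s t))) _). apply IH; assumption.
  + refine (Ck3_ext n _ _ (fun x s t => eq_sym (CDerive_unique _ _ _ (D2 x s t))) _). apply IH; assumption.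
  + refine (Ck3_ext n _ _ (fun x s t => eq_sym (CDerive_unique _ _ _ (D3 x s t))) _). apply IH; assumption.
Qed.

Lemma CDerive_shift (f : R -> C) (c t : R) : CDerive (fun r => f (r + c)) t = CDerive f (t + c).
Proof.
unfold CDerive. f_equal; unfold Derive; f_equal; apply Lim_ext; intros y;
replace (t + y + c) with (t + c + y) by ring; reflexivity.
Qed.

Lemma Ck3_shift (c : R) (n : nat) : forall f : R -> R -> R -> C,
  Ck3 n f -> Ck3 n (fun x s t => f x s (t + c)).
Proof.
induction n as [|n IH]; intros f [Cf Hf]; split.
1, 3: intros x s t;
  apply (continuous_comp (fun p : R * R * R => ((fst p, snd p + c) : R * R * R))
           (fun p : R * R * R => f (fst (fst p)) (snd (fst p)) (snd p)));
  [|apply Cf];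
  apply (continuous_comp_2 (fun p : R * R * R => fst p) (fun p : R * R * R => snd p + c)
           (fun a b => (a, b)));
  [apply continuous_fst
  |apply (continuous_plus (V := R_NormedModule) (fun p : R * R * R => snd p) (fun _ => c));
   [apply continuous_snd|apply continuous_const]
  |apply (continuous_ext (fun p => p)); [intros [? ?]; reflexivity|]; apply continuous_id].
- exact I.
- destruct Hf as (Df & F1 & F2 & F3).
  split; [|split; [|split]].
  + intros x s t. destruct (Df x s (t + c)) as (E1 & E2 & E3).
    split; [|split]; [exact E1|exact E2|].
    eexists. apply (is_derive_Ccomp (f x s) (fun r => r + c) t (CDerive (f x s) (t + c)) 1).
    * apply CDerive_correct, E3.
    * auto_derive; [trivial|ring].
  + apply (IH _ F1).
  + apply (IH _ F2).
  + refine (Ck3_ext n _ _ (fun x s t => eq_sym (CDerive_shift (f x s) c t)) _). apply (IH _ F3).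
Qed.

Lemma Ck3_prod (n : nat) : forall p q : R -> C,
  smooth p -> smooth q -> Ck3 n (fun _ s t => p s * q t)%C.
Proof.
induction n as [|n IH]; intros p q Hp Hq; split.
1, 3: intros x s t; apply continuous_Cmult;
  [apply (continuous_comp (fun u : R * R * R => snd (fst u)) p);
   [apply (continuous_comp (fun u : R * R * R => fst u) snd); [apply continuous_fst|apply continuous_snd]
   |apply smooth_continuous, Hp]
  |apply (continuous_comp (fun u : R * R * R => snd u) q);
   [apply continuous_snd|apply smooth_continuous, Hq]].
- exact I.
- assert (D1 : forall x s t : R, is_derive (V := C_R_NormedModule) (fun r : R => p s * q t)%C x (RtoC 0 * q t)%C).
  { intros x s t. replace (RtoC 0 * q t)%C with (RtoC 0) by ring. apply is_derive_Cconst. }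
  assert (D2 : forall x s t : R, is_derive (V := C_R_NormedModule) (fun r => p r * q t)%C s (CDerive p s * q t)%C).
  { intros x s t. evar_last.
    { apply is_derive_Cmult; [apply CDerive_correct, smooth_ex, Hp|apply is_derive_Cconst]. }
    simpl. ring. }
  assert (D3 : forall x s t : R, is_derive (V := C_R_NormedModule) (fun r => p s * q r)%C t (p s * CDerive q t)%C).
  { intros x s t. evar_last.
    { apply is_derive_Cmult; [apply is_derive_Cconst|apply CDerive_correct, smooth_ex, Hq]. }
    simpl. ring. }
  split; [|split; [|split]].
  + intros x s t. split; [|split]; eexists; [exact (D1 x s t)|exact (D2 x s t)|exact (D3 x s t)].
  + refine (Ck3_ext n _ _ (fun x s t => eq_sym (CDerive_unique _ _ _ (D1 x s t))) _). apply (IH (fun _ => RtoC 0) q); [apply smooth_const|assumption].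
  + refine (Ck3_ext n _ _ (fun x s t => eq_sym (CDerive_unique _ _ _ (D2 x s t))) _). apply IH; [apply smooth_D|]; assumption.
  + refine (Ck3_ext n _ _ (fun x s t => eq_sym (CDerive_unique _ _ _ (D3 x s t))) _). apply IH; [|apply smooth_D]; assumption.
Qed.

Definition homog (mu nu : C) (F : Gt -> C) : Prop :=
  forall (x : R) (y : posreal) (m : Z) (g : Gt),
    F (Gmul (Gmul (Gmul (ut x) (at_ y)) (kt (IZR m * PI))) g)
    = (Cexp (RtoC PI * RtoC (IZR m) * Ci * mu) * Rcpow y (nu + RtoC (1 / 2)) * F g)%C.

Record Iinf (mu nu : C) := mkI {
  ifun :> Gt -> C;
  ismooth : smoothG ifun;
  ihomog : homog mu nu ifun }.

Arguments mkI {mu nu}.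
Arguments ifun {mu nu}.
Arguments ismooth {mu nu}.
Arguments ihomog {mu nu}.

Lemma Icomb_homog (mu nu a b : C) (F1 F2 : Gt -> C) :
  homog mu nu F1 -> homog mu nu F2 -> homog mu nu (fun g => a * F1 g + b * F2 g)%C.
Proof. intros H1 H2 x y m g. rewrite H1, H2. ring. Qed.

Definition Icomb {mu nu : C} (a b : C) (F1 F2 : Iinf mu nu) : Iinf mu nu :=
  mkI (fun g => a * F1 g + b * F2 g)%C
    (fun n => Ck3_comb a b n _ _ (ismooth F1 n) (ismooth F2 n))
    (Icomb_homog mu nu a b F1 F2 (ihomog F1) (ihomog F2)).

(* [F_oo = e^(pi i mu / 2) rho(wt) F]. *)
Definition Fw_fun (mu : C) (F : Gt -> C) (g : Gt) : C :=
  (Cexp (RtoC PI * Ci * mu / RtoC 2) * F (Gmul g wt))%C.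

Lemma kt_add (t r : R) : Gmul (kt t) (kt r) = kt (t + r).
Proof.
apply Gt_eq; [simpl; rewrite ?cos_plus, ?sin_plus; ring..|].
apply ang_mul_k.
Qed.

Lemma iwasawa_wt (x s t : R) : Gmul (iwasawa x s t) wt = iwasawa x s (t + - PI / 2).
Proof.
unfold iwasawa, wt. rewrite (Gmul_assoc_k (Gmul (ut x) (at_ (exppos s))) (kt t)).
rewrite kt_add. reflexivity.
Qed.

Lemma Fw_smooth (mu nu : C) (F : Iinf mu nu) : smoothG (Fw_fun mu F).
Proof.
intros n.
refine (Ck3_ext n (fun x s t => Cexp (RtoC PI * Ci * mu / RtoC 2) * F (iwasawa x s (t + - PI / 2))
  + RtoC 0 * F (iwasawa x s (t + - PI / 2)))%C _ _ _).
- intros x s t. unfold Fw_fun. rewrite iwasawa_wt. ring.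
- apply Ck3_comb; apply (Ck3_shift _ n (fun x s t => F (iwasawa x s t))); apply ismooth.
Qed.

Lemma Fw_homog (mu nu : C) (F : Iinf mu nu) : homog mu nu (Fw_fun mu F).
Proof.
intros x y m g. unfold Fw_fun, wt. rewrite Gmul_assoc_k, (ihomog F). ring.
Qed.

Definition Fw {mu nu : C} (F : Iinf mu nu) : Iinf mu nu :=
  mkI (Fw_fun mu F) (Fw_smooth mu nu F) (Fw_homog mu nu F).

Definition iota_fun (mu nu : C) (f : R -> C) (g : Gt) : C :=
  let c := mc (mat g) in
  let d := md (mat g) in
  if Req_EM_T c 0 then RtoC 0
  else (Cexp (Ci * mu * RtoC (ang g + Carg (J (mat g) Ci / RtoC c)))
        * Rcpow (Rabs c) (- RtoC 2 * nu - RtoC 1) * f (- d / c)%R)%C.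

Lemma Rcpow_mult (a b : R) (s : C) : 0 < a -> 0 < b -> Rcpow (a * b) s = (Rcpow a s * Rcpow b s)%C.
Proof.
intros Ha Hb. unfold Rcpow. rewrite <- Cexp_add. f_equal.
rewrite ln_mult, RtoC_plus by assumption. ring.
Qed.

Lemma Rcpow_sqrt_inv (y : R) (nu : C) : 0 < y ->
  Rcpow (/ sqrt y) (- RtoC 2 * nu - RtoC 1) = Rcpow y (nu + RtoC (1 / 2)).
Proof.
intros Hy. unfold Rcpow. f_equal.
pose proof (sqrt_lt_R0 y Hy).
rewrite ln_Rinv by assumption.
replace (ln y) with (2 * ln (sqrt y)).
- rewrite RtoC_opp, RtoC_mult. replace (RtoC (1 / 2)) with (/ RtoC 2)%C.
  + assert (H2 : (/ RtoC 2 * RtoC 2)%C = 1) by (apply Cinv_l; intros K; apply RtoC_inj in K; lra).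
    transitivity ((RtoC 2 * nu + / RtoC 2 * RtoC 2) * RtoC (ln (sqrt y)))%C; [rewrite H2|]; ring.
  + rewrite RtoC_div by lra. unfold Cdiv. ring.
- rewrite <- (sqrt_sqrt y) at 2 by lra. rewrite ln_mult by assumption. ring.
Qed.

Lemma sin_kPI (m : Z) : sin (IZR m * PI) = 0.
Proof. apply sin_eq_0_1. exists m. reflexivity. Qed.

Lemma cos_kPI_sq (m : Z) : cos (IZR m * PI) * cos (IZR m * PI) = 1.
Proof.
pose proof (sin2_cos2 (IZR m * PI)) as H. unfold Rsqr in H. rewrite sin_kPI in H. lra.
Qed.

Lemma iota_homog (mu nu : C) (f : R -> C) : homog mu nu (iota_fun mu nu f).
Proof.
intros x y m g.
set (p := Gmul (Gmul (ut x) (at_ y)) (kt (IZR m * PI))).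
set (e := cos (IZR m * PI)). pose proof (cos_kPI_sq m) as He. fold e in He.
pose proof (sqrt_lt_R0 y (cond_pos y)) as Hy.
assert (Pc : mc (mat p) = 0).
{ unfold p. change (mc (mat (Gmul ?q (kt ?t)))) with (mc (mat q) * cos t + md (mat q) * - sin t).
  rewrite mc_ua, sin_kPI. ring. }
assert (Pd : md (mat p) = e / sqrt y).
{ unfold p. change (md (mat (Gmul ?q (kt ?t)))) with (mc (mat q) * sin t + md (mat q) * cos t).
  rewrite mc_ua, md_ua. unfold e, Rdiv. ring. }
assert (Pa : ang (Gmul p g) = IZR m * PI + ang g).
{ rewrite ang_mul_ut by exact Pc. unfold p. rewrite ang_mul_k, ang_ua. ring. }
assert (Qc : mc (mat (Gmul p g)) = e / sqrt y * mc (mat g)).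
{ change (mc (mat (Gmul p g))) with (mc (mat p) * ma (mat g) + md (mat p) * mc (mat g)).
  rewrite Pc, Pd. ring. }
assert (Qd : md (mat (Gmul p g)) = e / sqrt y * md (mat g)).
{ change (md (mat (Gmul p g))) with (mc (mat p) * mb (mat g) + md (mat p) * md (mat g)).
  rewrite Pc, Pd. ring. }
assert (N : e / sqrt y <> 0).
{ intros K. assert (e = 0) by (replace e with (e / sqrt y * sqrt y) by (field; lra); rewrite K; ring).
  nra. }
set (k := e / sqrt y) in *.
unfold iota_fun. rewrite Qc, Qd, Pa.
destruct (Req_EM_T (mc (mat g)) 0) as [E|E].
- rewrite E, Rmult_0_r. destruct (Req_EM_T 0 0); [|lra]. ring.
- destruct (Req_EM_T (k * mc (mat g)) 0) as [E'|E'].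
  { exfalso. apply Rmult_integral in E'. tauto. }
  replace (- (k * md (mat g)) / (k * mc (mat g))) with (- md (mat g) / mc (mat g))
    by (field; split; assumption).
  replace (J (mat (Gmul p g)) Ci / RtoC (k * mc (mat g)))%C with (J (mat g) Ci / RtoC (mc (mat g)))%C.
  2: { rewrite !J_Ci, Qc, Qd.
       replace ((k * md (mat g), k * mc (mat g)) : C) with (RtoC k * (md (mat g), mc (mat g)))%C
         by (unfold Cmult, RtoC; simpl; f_equal; ring).
       rewrite RtoC_mult. field.
       split; intros K; apply RtoC_inj in K; contradiction. }
  rewrite Rabs_mult, Rcpow_mult by (apply Rabs_pos_lt; assumption).
  replace (Rabs k) with (/ sqrt y).
  2: { unfold k, Rdiv. rewrite Rabs_mult, Rabs_inv, (Rabs_pos_eq (sqrt y)) by lra.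
       assert (R1 : Rabs e = 1).
       { pose proof (Rabs_pos e). assert (Rabs e * Rabs e = 1) by (rewrite <- Rabs_mult, He; apply Rabs_R1). nra. }
       rewrite R1. ring. }
  rewrite Rcpow_sqrt_inv by apply cond_pos.
  replace (Ci * mu * RtoC (IZR m * PI + ang g + Carg (J (mat g) Ci / RtoC (mc (mat g)))))%C
    with (RtoC PI * RtoC (IZR m) * Ci * mu + Ci * mu * RtoC (ang g + Carg (J (mat g) Ci / RtoC (mc (mat g)))))%C
    by (rewrite !RtoC_plus, RtoC_mult; ring).
  rewrite Cexp_add. ring.
Qed.

Lemma Cdiv_cancel (m z : C) : m <> 0 -> (m * z / m)%C = z.
Proof. intros H. field. exact H. Qed.

Lemma iota_kt (mu nu : C) (f : R -> C) (t : R) : sin t <> 0 ->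
  iota_fun mu nu f (kt t)
  = (Cexp (Ci * mu * RtoC (t + Carg ((- (cos t / sin t))%R, 1%R)))
     * Rcpow (Rabs (sin t)) (- RtoC 2 * nu - RtoC 1) * f (cos t / sin t)%R)%C.
Proof.
intros N. unfold iota_fun. rewrite J_Ci. simpl.
destruct (Req_EM_T (- sin t) 0) as [K|_]; [lra|].
rewrite Rabs_Ropp. replace (- cos t / - sin t) with (cos t / sin t) by (field; lra).
replace ((cos t, (- sin t)%R) / RtoC (- sin t))%C with (((- (cos t / sin t))%R, 1%R) : C); [reflexivity|].
assert (M : RtoC (- sin t) <> 0) by (intros K; apply RtoC_inj in K; lra).
replace ((cos t, - sin t) : C) with (RtoC (- sin t) * ((- (cos t / sin t))%R, 1%R))%C.
- symmetry. apply Cdiv_cancel, M.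
- unfold Cmult, RtoC; simpl; f_equal; field; exact N.
Qed.

Lemma iota_near0 (mu nu : C) (f : Cc) (t : R) : sin t = 0 ->
  locally t (fun r => iota_fun mu nu f (kt r) = 0).
Proof.
intros H0. destruct (csupp f) as [u Hu].
pose proof (sin2_cos2 t) as SC; unfold Rsqr in SC. rewrite H0 in SC.
set (h := fun r => Rabs (cos r) - (Rabs u + 1) * Rabs (sin r)).
assert (Hc : continuous h t).
{ unfold h. apply (continuous_minus (V := R_NormedModule)).
  - apply (continuous_comp cos Rabs); [apply continuous_cos|apply continuous_Rabs].
  - apply (continuous_mult (K := R_AbsRing)); [apply continuous_const|].
    apply (continuous_comp sin Rabs); [apply continuous_sin|apply continuous_Rabs]. }
assert (Hp : 0 < h t).
{ unfold h. rewrite H0, Rabs_R0, Rmult_0_r. unfold Rminus. rewrite Ropp_0, Rplus_0_r.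
  apply Rabs_pos_lt. intros K. rewrite K in SC. lra. }
assert (L : locally t (fun r => 0 < h r)) by exact (Hc (fun v => 0 < v) (open_gt 0 (h t) Hp)).
refine (filter_imp _ _ _ L).
intros r Hr. unfold h in Hr.
unfold iota_fun. simpl. destruct (Req_EM_T (- sin r) 0) as [|N]; [reflexivity|].
rewrite Hu; [ring|].
replace (- cos r / - sin r) with (cos r * / sin r) by (field; lra).
assert (Q : 0 < Rabs (sin r)) by (apply Rabs_pos_lt; lra).
rewrite Rabs_mult, Rabs_inv.
apply Rmult_lt_reg_r with (Rabs (sin r)); [exact Q|].
rewrite Rmult_assoc, Rinv_l, Rmult_1_r by lra.
pose proof (Rle_abs u). nra.
Qed.

Lemma arg_locally_const (t : R) : sin t <> 0 ->
  locally t (fun r => sin r * sin t > 0 /\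
     r + Carg ((- (cos r / sin r))%R, 1%R) = t + Carg ((- (cos t / sin t))%R, 1%R)).
Proof.
intros N.
set (z := (((- (cos t / sin t))%R, 1%R) : C)). set (al := Carg z).
assert (Nz : z <> 0) by (intros K; injection K; lra).
pose proof (Cpolar z Nz) as P. rewrite Cexp_Ci in P. fold al in P.
set (r0 := Cmod z) in *.
assert (Hr0 : 0 < r0) by (apply Cmod_gt_0; exact Nz).
assert (Hal : 0 < al < PI).
{ pose proof PI_RGT_0.
  assert (Z2 : r0 * sin al = 1).
  { apply (f_equal Im) in P. unfold z, Im, Cmult, RtoC in P; simpl in P. lra. }
  assert (Al : 0 <= al <= PI).
  { unfold al, Carg. replace (Im z) with 1 by reflexivity.
    destruct (Rle_dec 0 1); [apply acos_bound|lra]. }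
  destruct (Req_dec al 0) as [K|K]; [rewrite K, sin_0 in Z2; lra|].
  destruct (Req_dec al PI) as [K'|K']; [rewrite K', sin_PI in Z2; lra|]. lra. }
assert (L1 : locally t (fun r => sin r * sin t > 0)).
{ assert (Hc : continuous (fun r => sin r * sin t) t).
  { apply (continuous_mult (K := R_AbsRing)); [apply continuous_sin|apply continuous_const]. }
  apply (Hc (fun v => v > 0)). apply open_gt. nra. }
assert (L2 : locally t (fun r => Rabs (r - t) < Rmin al (PI - al))).
{ apply (locally_R _ t (Rmin al (PI - al))); [apply Rmin_glb_lt; lra|]. auto. }
refine (filter_imp _ _ _ (filter_and _ _ L1 L2)). intros r [S D]. split; [exact S|].
assert (D1 : Rabs (r - t) < al) by (eapply Rlt_le_trans; [exact D|apply Rmin_l]).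
assert (D2 : Rabs (r - t) < PI - al) by (eapply Rlt_le_trans; [exact D|apply Rmin_r]).
apply Rabs_def2 in D1. apply Rabs_def2 in D2.
assert (Nr : sin r <> 0) by (intros K; rewrite K in S; lra).
assert (E : Carg ((- (cos r / sin r))%R, 1%R) = al - (r - t)); [|rewrite E; ring].
assert (Hq : 0 < sin t / sin r).
{ replace (sin t / sin r) with (sin r * sin t * / (sin r * sin r)) by (field; exact Nr).
  apply Rmult_lt_0_compat; [lra|]. apply Rinv_0_lt_compat. nra. }
rewrite <- (Carg_cis (r0 * (sin t / sin r)) (al - (r - t))).
2: { apply Rmult_lt_0_compat; lra. }
2: lra.
assert (P1 : - (cos t / sin t) = r0 * cos al).
{ apply (f_equal Re) in P. unfold z, Re, Cmult, RtoC in P; simpl in P. lra. }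
assert (P2 : 1 = r0 * sin al).
{ apply (f_equal Im) in P. unfold z, Im, Cmult, RtoC in P; simpl in P. lra. }
pose proof (sin2_cos2 t) as SC; unfold Rsqr in SC.
f_equal. f_equal.
- rewrite cos_minus, cos_minus, sin_minus.
  transitivity ((r0 * cos al) * (sin t / sin r) * (cos r * cos t + sin r * sin t)
     + (r0 * sin al) * (sin t / sin r) * (sin r * cos t - cos r * sin t)); [|ring].
  rewrite <- P1, <- P2. field_simplify_eq; [|split; assumption].
  transitivity (- cos r * (sin t * sin t + cos t * cos t)); [rewrite SC|]; ring.
- rewrite sin_minus, cos_minus, sin_minus.
  transitivity ((r0 * sin al) * (sin t / sin r) * (cos r * cos t + sin r * sin t)
     - (r0 * cos al) * (sin t / sin r) * (sin r * cos t - cos r * sin t)); [|ring].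
  rewrite <- P1, <- P2. field_simplify_eq; [|split; assumption].
  transitivity (sin r * (sin t * sin t + cos t * cos t)); [rewrite SC|]; ring.
Qed.

Lemma iota_step (mu nu : C) (f : Cc) : exists g : Cc, forall t,
  is_derive (V := C_R_NormedModule) (fun r => iota_fun mu nu f (kt r)) t (iota_fun mu nu g (kt t)).
Proof.
set (s := (- RtoC 2 * nu - RtoC 1)%C).
set (p := fun y : R => (s * RtoC y + RtoC 0 * RtoC 0)%C).
set (q := fun y : R => (RtoC (-1) * (RtoC y * RtoC y) + RtoC (-1) * RtoC 1)%C).
assert (Hp : smooth p) by (apply (smooth_comb _ _ RtoC (fun _ => RtoC 0)); [apply smooth_RtoC_id|apply smooth_const]).
assert (Hq : smooth q).
{ apply (smooth_comb _ _ (fun y => RtoC y * RtoC y)%C (fun _ => RtoC 1)); [|apply smooth_const].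
  apply smooth_mult; apply smooth_RtoC_id. }
exists (mkCc _ (Dop_smooth p q f Hp Hq) (Dop_supp p q f)).
intros t. destruct (Req_dec (sin t) 0) as [H0|N].
- replace (iota_fun mu nu _ (kt t)) with (RtoC 0).
  + apply CDerive_loc0, iota_near0, H0.
  + unfold iota_fun; simpl. destruct (Req_EM_T (- sin t) 0) as [|K]; [reflexivity|lra].
- rewrite iota_kt by exact N.
  set (A := Cexp (Ci * mu * RtoC (t + Carg ((- (cos t / sin t))%R, 1%R)))).
  fold s.
  set (e := sign (sin t)).
  assert (Se : e * e = 1).
  { unfold e. destruct (Rdichotomy _ _ N); [rewrite sign_eq_m1|rewrite sign_eq_1]; lra. }
  assert (Ae : e * sin t = Rabs (sin t)).
  { unfold e. destruct (Rdichotomy _ _ N);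
    [rewrite sign_eq_m1, Rabs_left|rewrite sign_eq_1, Rabs_pos_eq]; lra. }
  pose proof (Rabs_pos_lt _ N) as Pt.
  apply (is_derive_ext_loc (K := R_AbsRing) (V := C_R_NormedModule)
          (fun r => A * Rcpow (e * sin r) s * f (cos r / sin r)%R)%C).
  + refine (filter_imp _ _ _ (arg_locally_const t N)). intros r [S E].
    assert (Nr : sin r <> 0) by (intros K; rewrite K in S; lra).
    rewrite iota_kt by exact Nr. rewrite E. fold A s. f_equal. f_equal. f_equal.
    unfold e. destruct (Rdichotomy _ _ N) as [K|K].
    * rewrite sign_eq_m1 by exact K. rewrite Rabs_left; [ring|nra].
    * rewrite sign_eq_1 by exact K. rewrite Rabs_pos_eq; [ring|nra].
  + pose proof (sin2_cos2 t) as SC; unfold Rsqr in SC.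
    evar_last.
    { apply is_derive_Cmult.
      - apply is_derive_Cmult; [apply is_derive_Cconst|].
        apply (is_derive_Rcpow (fun r => e * sin r) s t (e * cos t)); [lra|].
        auto_derive; [trivial|ring].
      - apply (is_derive_Ccomp f (fun r => cos r / sin r) t (CDerive f (cos t / sin t))
                 (- (1 + (cos t / sin t) * (cos t / sin t)))).
        + apply CDerive_correct, smooth_ex, csmooth.
        + auto_derive; [exact N|]. field_simplify_eq; [|exact N]. ring. }
    simpl. rewrite Ae. set (E := Rcpow (Rabs (sin t)) s). unfold p, q.
    replace (e * cos t / Rabs (sin t)) with (cos t / sin t).
    2: { rewrite <- Ae. field. split; [exact N|]. intros Z; rewrite Z in Se; lra. }
    set (y := cos t / sin t).
    rewrite !RtoC_opp, RtoC_plus, RtoC_mult. ring.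
Qed.

Lemma iota_smooth1 (mu nu : C) (f : Cc) : smooth (fun t => iota_fun mu nu f (kt t)).
Proof.
apply (smooth_coind (fun h => exists g : Cc, h = fun t => iota_fun mu nu g (kt t))); [|eauto].
clear. intros h (f & ->). destruct (iota_step mu nu f) as [g Hg].
split; [intros x; eexists; exact (Hg x)|].
exists g. apply functional_extensionality; intros x. apply CDerive_unique, Hg.
Qed.

Lemma iota_iwasawa (mu nu : C) (f : R -> C) (x s t : R) :
  iota_fun mu nu f (iwasawa x s t)
  = (Cexp ((nu + RtoC (1 / 2)) * RtoC s) * iota_fun mu nu f (kt t))%C.
Proof.
pose proof (iota_homog mu nu f x (exppos s) 0%Z (kt t)) as H.
rewrite Gmul_assoc_k, kt_add in H.
replace (IZR 0 * PI + t) with t in H by ring. fold (iwasawa x s t) in H.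
rewrite H. unfold Rcpow. simpl. rewrite ln_exp.
replace (RtoC PI * RtoC 0 * Ci * mu)%C with (RtoC 0) by ring. rewrite Cexp_0. ring.
Qed.

Lemma iota_smooth (mu nu : C) (f : Cc) : smoothG (iota_fun mu nu f).
Proof.
intros n.
refine (Ck3_ext n _ _ (fun x s t => eq_sym (iota_iwasawa mu nu f x s t)) _).
apply (Ck3_prod n (fun s => Cexp ((nu + RtoC (1 / 2)) * RtoC s)%C));
  [apply smooth_expl|apply iota_smooth1].
Qed.

Definition iota (mu nu : C) (f : Cc) : Iinf mu nu :=
  mkI (iota_fun mu nu f) (iota_smooth mu nu f) (iota_homog mu nu f).

Lemma iota_wt (mu nu : C) (f : Cc) (x : R) : iota mu nu f (Gmul wt (ut (- x))) = f x.
Proof.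
assert (C0 : cos (- PI / 2) = 0).
{ replace (- PI / 2) with (- (PI / 2)) by field. rewrite cos_neg. apply cos_PI2. }
assert (S1 : sin (- PI / 2) = -1).
{ replace (- PI / 2) with (- (PI / 2)) by field. rewrite sin_neg, sin_PI2. ring. }
change (iota_fun mu nu f (Gmul wt (ut (- x))) = f x).
unfold iota_fun. rewrite J_Ci.
assert (E1 : mc (mat (Gmul wt (ut (- x)))) = 1) by (simpl; rewrite C0, S1; ring).
assert (E2 : md (mat (Gmul wt (ut (- x)))) = - x) by (simpl; rewrite C0, S1; ring).
rewrite E1, E2. destruct (Req_EM_T 1 0) as [|_]; [lra|].
replace (- - x / 1) with x by field.
rewrite Rabs_R1. unfold Rcpow. rewrite ln_1.
replace ((- RtoC 2 * nu - RtoC 1) * RtoC 0)%C with (RtoC 0) by ring. rewrite Cexp_0.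
set (z := (((- x)%R, 1%R) : C)).
replace (z / RtoC 1)%C with z by (rewrite <- (Cmult_1_l z) at 2; symmetry; apply Cdiv_cancel; exact C1_nz).
assert (A : ang (Gmul wt (ut (- x))) = - PI / 2 - Carg (z / Ci)).
{ simpl. f_equal; [ring|]. f_equal. f_equal.
  - unfold J. simpl. rewrite C0, S1. replace (- -1) with 1 by ring.
    replace (mobius (umat (- x)) Ci) with z; [ring|].
    unfold mobius, J. simpl.
    replace (RtoC 0 * Ci + RtoC 1)%C with (RtoC 1) by ring.
    replace (RtoC 1 * Ci + RtoC (- x))%C with (RtoC 1 * z)%C.
    + symmetry. apply Cdiv_cancel. exact C1_nz.
    + unfold z, Cmult, Cplus, Ci, RtoC; simpl; f_equal; ring.
  - f_equal. rewrite J_Ci; simpl. rewrite C0, S1. unfold Ci. f_equal; ring. }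
rewrite A.
assert (Nz : z <> 0) by (intros K; injection K; lra).
pose proof (Cpolar z Nz) as P. rewrite Cexp_Ci in P.
pose proof (proj1 (Cmod_gt_0 z) Nz) as Hr.
set (r := Cmod z) in *. set (al := Carg z) in *.
assert (Hal : 0 <= al <= PI).
{ unfold al, Carg. replace (Im z) with 1 by reflexivity.
  destruct (Rle_dec 0 1); [apply acos_bound|lra]. }
assert (P1 : - x = r * cos al).
{ apply (f_equal Re) in P. unfold z, Re, Cmult, RtoC in P; simpl in P. lra. }
assert (P2 : 1 = r * sin al).
{ apply (f_equal Im) in P. unfold z, Im, Cmult, RtoC in P; simpl in P. lra. }
assert (B : Carg (z / Ci) = al - PI / 2).
{ pose proof PI_RGT_0.
  rewrite <- (Carg_cis r (al - PI / 2)) by lra. f_equal.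
  rewrite cos_minus, sin_minus, cos_PI2, sin_PI2.
  transitivity (Ci * (1%R, x) / Ci)%C.
  - f_equal. unfold z, Cmult, Ci; simpl; f_equal; ring.
  - rewrite Cdiv_cancel by exact Ci_nz. f_equal; lra. }
rewrite B. replace (- PI / 2 - (al - PI / 2) + al) with 0 by field.
replace (Ci * mu * RtoC 0)%C with (RtoC 0) by ring. rewrite Cexp_0. ring.
Qed.

Lemma lift_angP (g : SL2) :
  (J g Ci * Cexp (Ci * RtoC (- Carg (J g Ci))))%C = RtoC (Cmod (J g Ci)).
Proof. apply Cexp_angle; [apply J_Ci_neq0|]. apply Cexp_Carg_opp, J_Ci_neq0. Qed.

Definition lift (g : SL2) : Gt := mkGt g (- Carg (J g Ci)) (lift_angP g).

(* The traceless matrix with rows [(xa, xb)] and [(xc, - xa)]; its square is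
   [sl2disc] times the identity. *)
Record sl2 := mksl2 { xa : R; xb : R; xc : R }.

Definition sl2disc (X : sl2) : R := xa X * xa X + xb X * xc X.

(* [exp (t X) = sl2ch X t * Id + sl2sh X t * X]. *)
Definition sl2ch (X : sl2) (t : R) : R :=
  if Rlt_dec 0 (sl2disc X) then cosh (t * sqrt (sl2disc X))
  else if Rlt_dec (sl2disc X) 0 then cos (t * sqrt (- sl2disc X))
  else 1.

Definition sl2sh (X : sl2) (t : R) : R :=
  if Rlt_dec 0 (sl2disc X) then sinh (t * sqrt (sl2disc X)) / sqrt (sl2disc X)
  else if Rlt_dec (sl2disc X) 0 then sin (t * sqrt (- sl2disc X)) / sqrt (- sl2disc X)
  else t.

Lemma sl2ch_sh (X : sl2) (t : R) :
  sl2ch X t * sl2ch X t - sl2disc X * (sl2sh X t * sl2sh X t) = 1.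
Proof.
unfold sl2ch, sl2sh. set (D := sl2disc X).
destruct (Rlt_dec 0 D) as [H|H]; [|destruct (Rlt_dec D 0) as [H'|H']].
- pose proof (sqrt_lt_R0 D H). set (u := t * sqrt D).
  replace (D * (sinh u / sqrt D * (sinh u / sqrt D))) with (sinh u * sinh u).
  + unfold cosh, sinh. pose proof (exp_plus u (- u)) as E.
    rewrite Rplus_opp_r, exp_0 in E. nra.
  + rewrite <- (sqrt_sqrt D) at 1 by lra. field. lra.
- assert (0 < - D) as K by lra. pose proof (sqrt_lt_R0 (- D) K). set (u := t * sqrt (- D)).
  replace (D * (sin u / sqrt (- D) * (sin u / sqrt (- D)))) with (- (sin u * sin u)).
  + pose proof (sin2_cos2 u) as E. unfold Rsqr in E. lra.
  + replace D with (- (sqrt (- D) * sqrt (- D))) at 1 by (rewrite sqrt_sqrt; lra). field. lra.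
- replace D with 0 by lra. ring.
Qed.

Lemma sl2exp_det (X : sl2) (t : R) :
  (sl2ch X t + sl2sh X t * xa X) * (sl2ch X t + sl2sh X t * - xa X)
  - sl2sh X t * xb X * (sl2sh X t * xc X) = 1.
Proof. rewrite <- (sl2ch_sh X t). unfold sl2disc. ring. Qed.

Definition sl2exp (X : sl2) (t : R) : SL2 := mkSL2 _ _ _ _ (sl2exp_det X t).

(* Terms denoting the elements of the universal enveloping algebra of
   [sl2 (x) C]. Terms denoting the same element have the same action [rho] on
   smooth functions. *)
Inductive Uterm :=
| Uscal (c : C)
| Ulie (X : sl2)
| Uadd (A B : Uterm)
| Umul (A B : Uterm).

(* For [t] near 0, [lift (sl2exp X t)] is the one-parameter subgroup of [Gt]
   generated by [X], so this gives the derived action. *)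
Fixpoint rho (A : Uterm) (F : Gt -> C) : Gt -> C :=
  match A with
  | Uscal c => fun g => (c * F g)%C
  | Ulie X => fun g => CDerive (fun t => F (Gmul g (lift (sl2exp X t)))) 0
  | Uadd A1 A2 => fun g => (rho A1 F g + rho A2 F g)%C
  | Umul A1 A2 => rho A1 (rho A2 F)
  end.

(* The supremum is finite for the continuous functions on [-PI, PI] and the
   test functions it is applied to. *)
Definition supnorm (D : R -> Prop) (f : R -> C) : R :=
  real (Lub_Rbar (fun r => exists x, D x /\ r = Cmod (f x))).

Definition Qnorm (A : Uterm) (F : Gt -> C) : R :=
  supnorm (fun t => - PI <= t < PI) (fun t => rho A F (kt t)).

(* Neighbourhood filter of [F0] for the topology defined by the seminorms [Qnorm A]. *)
Definition Inbhs {mu nu : C} (F0 : Iinf mu nu) (P : Iinf mu nu -> Prop) : Prop :=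
  exists (As : list Uterm) (eps : posreal),
    forall F : Iinf mu nu,
      (forall A, In A As -> Qnorm A (Icomb 1 (- (1)) F F0) < eps) -> P F.

Definition Idual {mu nu : C} (lam : Iinf mu nu -> C) : Prop :=
  (forall (a b : C) (F1 F2 : Iinf mu nu),
     lam (Icomb a b F1 F2) = (a * lam F1 + b * lam F2)%C) /\
  (forall F0 : Iinf mu nu, filterlim lam (Inbhs F0) (locally (lam F0))).

Definition dualw {mu nu : C} (lam : Iinf mu nu -> C) : Iinf mu nu -> C :=
  fun F => lam (Fw F).

Definition Tdist {mu nu : C} (lam : Iinf mu nu -> C) : Cc -> C :=
  fun f => lam (iota mu nu f).

Definition distribution (T : Cc -> C) : Prop :=
  (forall (a b : C) (f g : Cc), T (Ccomb a b f g) = (a * T f + b * T g)%C) /\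
  (forall u : R, 0 < u -> exists (m : nat) (c : R), 0 < c /\
     forall f : Cc, (forall x : R, u < Rabs x -> f x = 0) ->
       Cmod (T f) <= c * sum_f_R0 (fun i => supnorm (fun _ => True) (CDerive_n f i)) m).

Definition AJ (mu nu : C) (T : (Cc -> C) * (Cc -> C)) : Prop :=
  distribution (fst T) /\ distribution (snd T) /\
  forall f : Cx, fst T f = snd T (finf mu nu f).

Definition is_partition {mu nu : C} (F : Iinf mu nu) (f1 f2 : Cc) : Prop :=
  forall g : Gt, (iota mu nu f1 g + Fw (iota mu nu f2) g)%C = F g.

(* [T1 f1 + T2 f2] for some partition [(f1, f2)] of [F]. *)
Definition Lambda {mu nu : C} (T1 T2 : Cc -> C) (F : Iinf mu nu) : C :=
  epsilon (inhabits (RtoC 0))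
    (fun z => exists f1 f2 : Cc, is_partition F f1 f2 /\ z = (T1 f1 + T2 f2)%C).

(* Main.v *)
Require Import Defs.
From Stdlib Require Import Reals.
From Coquelicot Require Import Coquelicot.
From Stdlib Require Import Lra Lia ZArith List.
From Stdlib Require Import ClassicalEpsilon FunctionalExtensionality ProofIrrelevance.
(* Coquelicot has another [iota]: the last import decides. *)
Require Import Defs.

(** The idea is to replace the group by the circle. By the Iwasawa decomposition
    an element [F] of [Iinf mu nu] is determined by the smooth function
    [circ F : t |-> F (kt t)], which is multiplied by [exp (pi i mu)] under
    translation by [PI]. In these terms:

    - The topology is that of uniform convergence of all derivatives of [circ F]
      over a period. A Lie algebra element acts on [circ F] by a first order
      operator with trigonometric coefficients ([rho_lie_homform]), so every
      seminorm is bounded by finitely many derivatives ([Qnorm_bnd]); conversely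
      the powers of the generator of rotations give all derivatives
      ([rho_rot_pow]). Hence a linear functional is continuous exactly when it is
      bounded in terms of finitely many derivatives ([Idual_bounded],
      [bounded_Idual]). The map [Fw] is a quarter turn up to a constant, so it
      preserves continuity.

    - The line is the part [- PI < t < 0] of the circle, with coordinate
      [x = cot t], and [iota f] is [f] times a power of [1 + x^2] there
      ([circ_iota_tau]). The derivative of [iota f] along the circle is
      [iota g], where [g] is a first order operator with polynomial coefficients
      applied to [f] ([CDerive_circ_iota]). So derivatives of [iota f] are bounded
      by derivatives of [f] when the support of [f] is fixed ([iota_bnd]), and
      [Tdist lam] is a distribution.

    - A smooth function [cutoff] on the circle that vanishes near [sin t = 0] and
      satisfies [cutoff t + cutoff (t - PI / 2) = 1] gives a partition of each [F]
      ([piece_partition]) whose two members have support in [-2 <= x <= 2] and depend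
      continuously on [F] ([piece_bnd]). This makes [Lambda T1 T2] continuous.

    - The gluing map [finf] on the punctured line is defined so that
      [iota f = Fw (iota (finf f))] ([iota_finf]). This is the compatibility of
      [Tdist lam] with [Tdist (dualw lam)]. It also gives the independence of the
      partition: if [iota a + Fw (iota b) = 0], then [a] vanishes near 0, because
      [Fw (iota b)] vanishes near the point at infinity of [b], and so
      [finf a = - b] and [T1 a = T2 (finf a) = - T2 b] ([AJ_cancel]).

    The two constructions are then inverse to each other by linearity: a partition
    of [F] recovers [lam F], while [iota f] has the partition [(f, 0)] and
    [Fw (iota f)] has the partition [(0, f)]. *)

(** * Smooth functions *)

(** The powers of [/ x] make this family stable under differentiation up to
    linear combinations ([is_derive_flat]), which is how [flat 0] is shown to be
    smooth. *)
Definition flat (n : nat) (x : R) : R :=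
  if Rlt_dec 0 x then (/ x) ^ n * exp (- / x) else 0.

Lemma flat_neg (n : nat) (x : R) : x <= 0 -> flat n x = 0.
Proof. intros H. unfold flat. destruct (Rlt_dec 0 x); [lra|reflexivity]. Qed.

Lemma exp_INR_mult (k : nat) (x : R) : exp (INR k * x) = exp x ^ k.
Proof.
induction k as [|k IH]; [simpl; rewrite Rmult_0_l; apply exp_0|].
rewrite S_INR, Rmult_plus_distr_r, Rmult_1_l, exp_plus, IH. simpl. ring.
Qed.

Lemma pow_le_exp (k : nat) (y : R) : (0 < k)%nat -> 0 <= y -> y ^ k <= INR k ^ k * exp y.
Proof.
intros Hk Hy. pose proof (lt_0_INR k Hk) as K.
replace (exp y) with (exp (y / INR k) ^ k).
- rewrite <- Rpow_mult_distr. apply pow_incr. split; [exact Hy|].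
  pose proof (exp_ineq1_le (y / INR k)) as E.
  replace y with (INR k * (y / INR k)) at 1 by (field; lra).
  apply Rmult_le_compat_l; lra.
- rewrite <- exp_INR_mult. f_equal. field. lra.
Qed.

(** With [y = / x] this is the boundedness of [y ^ (n + 2) exp (- y)]; a quadratic
    bound suffices for a zero derivative at the origin. *)
Lemma flat_quadratic (n : nat) : exists K, 0 < K /\ forall x, Rabs (flat n x) <= K * (x * x).
Proof.
exists (INR (S (S n)) ^ (S (S n))).
assert (P : 0 < INR (S (S n)) ^ (S (S n))) by (apply pow_lt, lt_0_INR; lia).
split; [exact P|]. intros x. unfold flat. destruct (Rlt_dec 0 x) as [H|H].
2: { rewrite Rabs_R0. apply Rmult_le_pos; [lra|nra]. }
pose proof (Rinv_0_lt_compat x H) as Hi.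
rewrite Rabs_pos_eq.
2: { apply Rmult_le_pos; [apply pow_le; lra|left; apply exp_pos]. }
pose proof (pow_le_exp (S (S n)) (/ x) ltac:(lia) ltac:(lra)) as E.
rewrite exp_Ropp. pose proof (exp_pos (/ x)) as Ep.
apply (Rmult_le_reg_r (exp (/ x))); [exact Ep|].
rewrite Rmult_assoc, Rinv_l, Rmult_1_r by lra.
set (K := INR (S (S n)) ^ (S (S n))) in *.
replace ((/ x) ^ n) with ((/ x) ^ (S (S n)) * (x * x)) by (simpl; field; lra).
nra.
Qed.

Lemma is_derive_quadratic0 (f : R -> R) (K : R) : 0 < K ->
  (forall x, Rabs (f x) <= K * (x * x)) -> is_derive f 0 0.
Proof.
intros HK H. assert (f0 : f 0 = 0).
{ pose proof (H 0) as E. pose proof (Rabs_pos (f 0)).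
  assert (Z : Rabs (f 0) = 0) by lra. revert Z. apply Rabs_eq_0. }
apply is_derive_Reals. intros eps He.
assert (Hd : 0 < eps / K) by (apply Rdiv_lt_0_compat; lra).
exists (mkposreal _ Hd). intros h Nh Hh. simpl in Hh.
rewrite Rplus_0_l, f0, !Rminus_0_r. unfold Rdiv. rewrite Rabs_mult, Rabs_inv.
pose proof (Rabs_pos_lt h Nh) as Ph.
apply (Rmult_lt_reg_r (Rabs h)); [exact Ph|].
rewrite Rmult_assoc, Rinv_l, Rmult_1_r by lra.
eapply Rle_lt_trans; [apply H|].
replace (h * h) with (Rabs h * Rabs h) by (rewrite <- Rabs_mult; apply Rabs_pos_eq; nra).
assert (K * Rabs h < eps); [|nra].
apply (Rmult_lt_compat_l K) in Hh; [|exact HK].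
replace (K * (eps / K)) with eps in Hh by (field; lra). exact Hh.
Qed.

Lemma is_derive_flat (n : nat) (x : R) :
  is_derive (flat n) x (- INR n * flat (S n) x + flat (S (S n)) x).
Proof.
destruct (Rtotal_order x 0) as [H|[->|H]].
- rewrite !flat_neg by lra. replace (- INR n * 0 + 0) with 0 by ring.
  apply (is_derive_ext_loc (fun _ => 0)).
  + apply (locally_R _ x (- x)); [lra|]. intros t Ht. apply Rabs_def2 in Ht.
    rewrite flat_neg; [reflexivity|lra].
  + apply (is_derive_const (V := R_NormedModule)).
- rewrite !flat_neg by lra. replace (- INR n * 0 + 0) with 0 by ring.
  destruct (flat_quadratic n) as (K & HK & B). exact (is_derive_quadratic0 _ K HK B).
- apply (is_derive_ext_loc (fun t => (/ t) ^ n * exp (- / t))).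
  + apply (locally_R _ x x); [lra|]. intros t Ht. apply Rabs_def2 in Ht.
    unfold flat. destruct (Rlt_dec 0 t); [reflexivity|lra].
  + unfold flat. destruct (Rlt_dec 0 x) as [_|]; [|lra].
    auto_derive; [lra|]. destruct n as [|n].
    * simpl. field. lra.
    * change (pred (S n)) with n. simpl pow. field. lra.
Qed.

(** Every member of this class has a derivative in the class, so all of them are
    smooth. This gives the stability of smooth functions under the operations
    below without a formula for higher derivatives. *)
Inductive smooth_closure : (R -> C) -> Prop :=
| sc_smooth f : smooth f -> smooth_closure f
| sc_plus f g : smooth_closure f -> smooth_closure g ->
    smooth_closure (fun x => f x + g x)%C
| sc_mult f g : smooth_closure f -> smooth_closure g ->
    smooth_closure (fun x => f x * g x)%C
| sc_comp f h : smooth_closure f -> smooth_closure (fun x => RtoC (h x)) ->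
    smooth_closure (fun x => f (h x))
| sc_exp f : smooth_closure f -> smooth_closure (fun x => Cexp (f x))
| sc_inv h : (forall x, h x <> 0) -> smooth_closure (fun x => RtoC (h x)) ->
    smooth_closure (fun x => RtoC (/ h x))
| sc_ln h : (forall x, 0 < h x) -> smooth_closure (fun x => RtoC (h x)) ->
    smooth_closure (fun x => RtoC (ln (h x)))
| sc_atan : smooth_closure (fun x => RtoC (atan x))
| sc_sin : smooth_closure (fun x => RtoC (sin x))
| sc_cos : smooth_closure (fun x => RtoC (cos x))
| sc_flat n : smooth_closure (fun x => RtoC (flat n x)).

Lemma is_derive_of_RtoC (h : R -> R) (x : R) (l : C) :
  is_derive (V := C_R_NormedModule) (fun t => RtoC (h t)) x l ->
  is_derive h x (Re l) /\ RtoC (Re l) = l.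
Proof.
intros H. apply is_derive_C in H. destruct H as [H1 H2]. split; [exact H1|].
assert (E : Im l = 0).
{ rewrite <- (is_derive_unique _ _ _ H2). apply (Derive_const 0). }
destruct l as [a b]; simpl in *. rewrite E. reflexivity.
Qed.

Lemma is_derive_RtoC_real (h : R -> R) (x l : R) :
  is_derive h x l -> is_derive (V := C_R_NormedModule) (fun t => RtoC (h t)) x (RtoC l).
Proof. intros H. apply (is_derive_RtoC h x l H). Qed.

Lemma smooth_closure_derive (f : R -> C) : smooth_closure f ->
  exists f', smooth_closure f' /\ forall x, is_derive (V := C_R_NormedModule) f x (f' x).
Proof.
assert (cst : forall c, smooth_closure (fun _ => c)) by (intros c; apply sc_smooth, smooth_const).
assert (sid : smooth_closure (fun x => RtoC x)) by (apply sc_smooth, smooth_RtoC_id).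
intros H. induction H as [f Hf|f g Hf (f' & Sf & Df) Hg (g' & Sg & Dg)
  |f g Hf (f' & Sf & Df) Hg (g' & Sg & Dg)|f h Hf (f' & Sf & Df) Hh (h' & Sh & Dh)
  |f Hf (f' & Sf & Df)|h N Hh (h' & Sh & Dh)|h N Hh (h' & Sh & Dh)| | | |n].
- exists (CDerive f). split; [apply sc_smooth, smooth_D, Hf|].
  intros x. apply CDerive_correct, smooth_ex, Hf.
- exists (fun x => f' x + g' x)%C. split; [apply sc_plus; assumption|].
  intros x. apply is_derive_Cplus; auto.
- exists (fun x => f' x * g x + f x * g' x)%C.
  split; [apply sc_plus; apply sc_mult; assumption|].
  intros x. apply is_derive_Cmult; auto.
- exists (fun x => h' x * f' (h x))%C.
  split; [apply sc_mult; [|apply (sc_comp f' h)]; assumption|].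
  intros x. destruct (is_derive_of_RtoC h x _ (Dh x)) as [D E].
  rewrite <- E. apply is_derive_Ccomp; auto.
- exists (fun x => f' x * Cexp (f x))%C.
  split; [apply sc_mult; [|apply sc_exp]; assumption|].
  intros x. apply is_derive_Cexp, Df.
- exists (fun x => RtoC (-1) * (h' x * (RtoC (/ h x) * RtoC (/ h x))))%C.
  split; [repeat apply sc_mult; auto; apply sc_inv; auto|].
  intros x. destruct (is_derive_of_RtoC h x _ (Dh x)) as [D E]. rewrite <- E.
  rewrite <- !RtoC_mult. apply is_derive_RtoC_real. evar_last.
  { apply is_derive_inv; [exact D|apply N]. }
  field. apply N.
- exists (fun x => h' x * RtoC (/ h x))%C.
  split; [apply sc_mult; [assumption|]; apply sc_inv; [|assumption];
    intros x; specialize (N x); lra|].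
  intros x. destruct (is_derive_of_RtoC h x _ (Dh x)) as [D E]. rewrite <- E.
  rewrite <- !RtoC_mult. apply is_derive_RtoC_real. evar_last.
  { apply (is_derive_comp ln h x (/ h x) (Re (h' x))); [|exact D].
    apply is_derive_Reals, derivable_pt_lim_ln, N. }
  reflexivity.
- assert (N : forall x, 1 + x * x <> 0) by (intros x; nra).
  exists (fun x => RtoC (/ (1 + x * x))). split.
  + apply sc_inv; [exact N|].
    replace (fun x => RtoC (1 + x * x)) with (fun x => RtoC 1 + RtoC x * RtoC x)%C
      by (apply functional_extensionality; intros x; rewrite RtoC_plus, RtoC_mult; reflexivity).
    apply sc_plus; [auto|]. apply sc_mult; auto.
  + intros x. apply is_derive_RtoC_real. apply is_derive_Reals.
    replace (/ (1 + x * x)) with (/ (1 + x ^ 2)) by (f_equal; ring).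
    apply derivable_pt_lim_atan.
- exists (fun x => RtoC (cos x)). split; [apply sc_cos|].
  intros x. apply is_derive_RtoC_real, is_derive_sin.
- exists (fun x => RtoC (-1) * RtoC (sin x))%C. split; [apply sc_mult; [auto|apply sc_sin]|].
  intros x. rewrite <- RtoC_mult. replace (-1 * sin x) with (- sin x) by ring.
  apply is_derive_RtoC_real, is_derive_cos.
- exists (fun x => RtoC (- INR n) * RtoC (flat (S n) x) + RtoC (flat (S (S n)) x))%C.
  split; [apply sc_plus; [apply sc_mult; [auto|]|]; apply sc_flat|].
  intros x. rewrite <- RtoC_mult, <- RtoC_plus. apply is_derive_RtoC_real, is_derive_flat.
Qed.

Lemma smooth_closure_smooth (f : R -> C) : smooth_closure f -> smooth f.
Proof.
apply smooth_coind. clear. intros f Hf.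
destruct (smooth_closure_derive f Hf) as (f' & Sf & Df).
split; [intros x; eexists; apply Df|].
replace (CDerive f) with f'; [exact Sf|].
apply functional_extensionality; intros x. symmetry. apply CDerive_unique, Df.
Qed.

Lemma smooth_plus (f g : R -> C) : smooth f -> smooth g -> smooth (fun x => f x + g x)%C.
Proof. intros Hf Hg. apply smooth_closure_smooth, sc_plus; apply sc_smooth; assumption. Qed.

Lemma smooth_comp (f : R -> C) (h : R -> R) :
  smooth f -> smooth (fun x => RtoC (h x)) -> smooth (fun x => f (h x)).
Proof. intros Hf Hh. apply smooth_closure_smooth, sc_comp; apply sc_smooth; assumption. Qed.

Lemma CDerive_plus (f g : R -> C) (x : R) : smooth f -> smooth g ->
  CDerive (fun x => f x + g x)%C x = (CDerive f x + CDerive g x)%C.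
Proof.
intros Hf Hg. apply CDerive_unique, is_derive_Cplus; apply CDerive_correct, smooth_ex; assumption.
Qed.

Lemma CDerive_mult (f g : R -> C) (x : R) : smooth f -> smooth g ->
  CDerive (fun x => f x * g x)%C x = (CDerive f x * g x + f x * CDerive g x)%C.
Proof.
intros Hf Hg. apply CDerive_unique, is_derive_Cmult; apply CDerive_correct, smooth_ex; assumption.
Qed.

Lemma CDerive_comp (f : R -> C) (h : R -> R) (x : R) :
  smooth f -> smooth (fun x => RtoC (h x)) ->
  CDerive (fun x => f (h x)) x = (CDerive (fun x => RtoC (h x)) x * CDerive f (h x))%C.
Proof.
intros Hf Hh. apply CDerive_unique.
pose proof (CDerive_correct _ x (smooth_ex _ x Hh)) as D.
destruct (is_derive_of_RtoC h x _ D) as [D1 E]. rewrite <- E.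
apply is_derive_Ccomp; [|exact D1]. apply CDerive_correct, smooth_ex, Hf.
Qed.

(** * Bounds for derivatives *)

(** A bound [M] on [E] for the derivatives of order at most [n]: the seminorms of
    all function spaces below are compared through such bounds. *)
Definition bnd (E : R -> Prop) (n : nat) (f : R -> C) (M : R) : Prop :=
  forall j t, (j <= n)%nat -> E t -> Cmod (CDerive_n f j t) <= M.

Lemma bnd_S (E : R -> Prop) (n : nat) (f : R -> C) (M : R) :
  bnd E (S n) f M <-> (forall t, E t -> Cmod (f t) <= M) /\ bnd E n (CDerive f) M.
Proof.
split.
- intros H; split.
  + intros t Ht. apply (H O t ltac:(lia) Ht).
  + intros j t Hj Ht. rewrite <- CDerive_n_shift. apply H; [lia|exact Ht].
- intros [H0 H] [|j] t Hj Ht; [apply H0, Ht|].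
  rewrite CDerive_n_shift. apply H; [lia|exact Ht].
Qed.

Lemma bnd_0 (E : R -> Prop) (f : R -> C) (M : R) :
  bnd E 0 f M <-> (forall t, E t -> Cmod (f t) <= M).
Proof.
split.
- intros H t Ht. apply (H O t ltac:(lia) Ht).
- intros H j t Hj Ht. replace j with O by lia. apply H, Ht.
Qed.

Lemma bnd_ext (E : R -> Prop) (n : nat) (f g : R -> C) (M : R) :
  (forall x, f x = g x) -> bnd E n f M -> bnd E n g M.
Proof. intros H. replace g with f; [auto|]. apply functional_extensionality, H. Qed.

Lemma bnd_le (E : R -> Prop) (n m : nat) (f : R -> C) (M N : R) :
  (n <= m)%nat -> M <= N -> bnd E m f M -> bnd E n f N.
Proof.
intros H1 H2 H j t Hj Ht. eapply Rle_trans; [apply H; [lia|exact Ht]|exact H2].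
Qed.

Lemma bnd_plus (E : R -> Prop) (n : nat) (f g : R -> C) (M N : R) :
  smooth f -> smooth g -> bnd E n f M -> bnd E n g N -> bnd E n (fun x => f x + g x)%C (M + N).
Proof.
revert f g. induction n as [|n IH]; intros f g Sf Sg Hf Hg.
- rewrite bnd_0 in *. intros t Ht. eapply Rle_trans; [apply Cmod_triangle|].
  apply Rplus_le_compat; auto.
- rewrite bnd_S in *. destruct Hf as [Hf0 Hf], Hg as [Hg0 Hg]. split.
  + intros t Ht. eapply Rle_trans; [apply Cmod_triangle|]. apply Rplus_le_compat; auto.
  + refine (bnd_ext _ _ _ _ _ (fun x => eq_sym (CDerive_plus f g x Sf Sg)) _).
    apply IH; auto using smooth_D.
Qed.

(** The Leibniz rule doubles the number of terms with each derivative, hence the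
    factor [2 ^ n]. *)
Lemma bnd_mult (E : R -> Prop) (n : nat) (f g : R -> C) (M N : R) :
  smooth f -> smooth g -> bnd E n f M -> bnd E n g N ->
  bnd E n (fun x => f x * g x)%C (2 ^ n * (M * N)).
Proof.
assert (B : forall (f g : R -> C) M N t, Cmod (f t) <= M -> Cmod (g t) <= N ->
   0 <= M * N /\ Cmod (f t * g t)%C <= M * N).
{ clear. intros f g M N t Hf Hg.
  pose proof (Cmod_ge_0 (f t)). pose proof (Cmod_ge_0 (g t)).
  split; [apply Rmult_le_pos; lra|]. rewrite Cmod_mult. apply Rmult_le_compat; lra. }
revert f g. induction n as [|n IH]; intros f g Sf Sg Hf Hg.
- rewrite bnd_0 in *. intros t Ht. simpl. rewrite Rmult_1_l. apply B; auto.
- rewrite bnd_S in *. pose proof Hf as Hf'. pose proof Hg as Hg'.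
  destruct Hf as [Hf0 Hf], Hg as [Hg0 Hg]. split.
  + intros t Ht. destruct (B f g M N t) as [P Q]; auto.
    eapply Rle_trans; [exact Q|].
    pose proof (pow_R1_Rle 2 (S n) ltac:(lra)). nra.
  + refine (bnd_ext _ _ _ _ _ (fun x => eq_sym (CDerive_mult f g x Sf Sg)) _).
    replace (2 ^ S n * (M * N)) with (2 ^ n * (M * N) + 2 ^ n * (M * N)) by (simpl; ring).
    rewrite <- bnd_S in Hf', Hg'.
    apply bnd_plus; auto using smooth_D, smooth_mult.
    * apply IH; auto using smooth_D. eapply bnd_le; [| |exact Hg']; [lia|lra].
    * apply IH; auto using smooth_D. eapply bnd_le; [| |exact Hf']; [lia|lra].
Qed.

Lemma CDerive_n_scal (n : nat) (c : C) (f : R -> C) (t : R) : smooth f ->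
  CDerive_n (fun x => c * f x)%C n t = (c * CDerive_n f n t)%C.
Proof.
revert f. induction n as [|n IH]; intros f Sf; [reflexivity|].
rewrite !CDerive_n_shift, <- (IH _ (smooth_D f Sf)). f_equal.
apply functional_extensionality; intros x.
rewrite (CDerive_mult (fun _ => c) f x (smooth_const c) Sf).
rewrite (CDerive_unique (fun _ => c) x 0 (is_derive_Cconst c x)). ring.
Qed.

Lemma bnd_scal (E : R -> Prop) (n : nat) (c : C) (f : R -> C) (M : R) :
  smooth f -> bnd E n f M -> bnd E n (fun x => c * f x)%C (Cmod c * M).
Proof.
intros Sf Hf j t Hj Ht. rewrite CDerive_n_scal, Cmod_mult by exact Sf.
apply Rmult_le_compat_l; [apply Cmod_ge_0|auto].
Qed.

(** By induction on [n], applying the induction hypothesis to [f'] in the chain rule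
    [(f o h)' = h' (f' o h)]. *)
Lemma bnd_comp (D E : R -> Prop) (n : nat) (h : R -> R) (A : R) :
  smooth (fun x => RtoC (h x)) -> (forall x, D x -> E (h x)) ->
  bnd D n (fun x => RtoC (h x)) A ->
  exists K, 0 <= K /\ forall f M, smooth f -> bnd E n f M -> bnd D n (fun x => f (h x)) (K * M).
Proof.
intros Sh HE. revert A. induction n as [|n IH]; intros A Hh.
- exists 1. split; [lra|]. intros f M Sf Hf. rewrite bnd_0 in *.
  intros t Ht. rewrite Rmult_1_l. auto.
- rewrite bnd_S in Hh. pose proof Hh as [_ Hh'].
  rewrite <- bnd_S in Hh.
  destruct (IH A) as (K & HK & B); [eapply bnd_le; [| |exact Hh]; [lia|lra]|].
  exists (1 + Rabs (2 ^ n * (A * K))).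
  pose proof (Rabs_pos (2 ^ n * (A * K))).
  split; [lra|]. intros f M Sf Hf. rewrite bnd_S in *. destruct Hf as [Hf0 Hf]. split.
  + intros t Ht. pose proof (Hf0 _ (HE t Ht)). pose proof (Cmod_ge_0 (f (h t))). nra.
  + refine (bnd_ext _ _ _ _ _ (fun x => eq_sym (CDerive_comp f h x Sf Sh)) _).
    assert (Z : bnd D n (fun x => CDerive (fun x => RtoC (h x)) x * CDerive f (h x))%C
                 (2 ^ n * (A * (K * M)))).
    { apply bnd_mult; auto using smooth_D.
      apply (smooth_comp (CDerive f) h); auto using smooth_D. }
    intros j t Hj Ht. pose proof (Hf0 _ (HE t Ht)). pose proof (Cmod_ge_0 (f (h t))).
    eapply Rle_trans; [apply Z; assumption|].
    pose proof (Rle_abs (2 ^ n * (A * K))). nra.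
Qed.

Lemma continuous_Cmod (f : R -> C) (x : R) : continuous f x -> continuous (fun t => Cmod (f t)) x.
Proof.
intros H. apply continuous_C in H. destruct H as [H1 H2].
apply (continuous_ext (fun t => sqrt (Re (f t) * Re (f t) + Im (f t) * Im (f t)))).
- intros t. rewrite <- Cmod_sqr. apply sqrt_square, Cmod_ge_0.
- apply (continuous_comp (fun t => Re (f t) * Re (f t) + Im (f t) * Im (f t)) sqrt).
  + apply (continuous_plus (V := R_NormedModule)); apply (continuous_mult (K := R_AbsRing)); assumption.
  + apply continuous_sqrt.
Qed.

Lemma smooth_Dn (n : nat) (f : R -> C) : smooth f -> smooth (CDerive_n f n).
Proof. intros H. induction n as [|n IH]; [exact H|]. apply smooth_D, IH. Qed.

Lemma bnd_compact (a b : R) (n : nat) (f : R -> C) : smooth f ->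
  exists M, 0 <= M /\ bnd (fun t => a <= t <= b) n f M.
Proof.
intros Sf. destruct (Rle_dec a b) as [L|L].
2: { exists 0. split; [lra|]. intros j t _ Ht. lra. }
assert (K0 : forall j, exists M, forall t, a <= t <= b -> Cmod (CDerive_n f j t) <= M).
{ intros j. destruct (continuity_ab_maj (fun t => Cmod (CDerive_n f j t)) a b L) as (x & Hx & _).
  - intros c _. apply continuity_pt_filterlim. apply continuous_Cmod.
    apply smooth_continuous, smooth_Dn, Sf.
  - exists (Cmod (CDerive_n f j x)). exact Hx. }
induction n as [|n (M & HM & IH)].
- destruct (K0 O) as [M HM]. exists (Rmax 0 M). split; [apply Rmax_l|].
  apply bnd_0. intros t Ht. eapply Rle_trans; [apply (HM t Ht)|apply Rmax_r].
- destruct (K0 (S n)) as [M' HM']. exists (Rmax M M').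
  split; [eapply Rle_trans; [exact HM|apply Rmax_l]|].
  intros j t Hj Ht. destruct (Nat.eq_dec j (S n)) as [->|].
  + eapply Rle_trans; [apply HM', Ht|apply Rmax_r].
  + eapply Rle_trans; [apply IH; [lia|exact Ht]|apply Rmax_l].
Qed.

Lemma supnorm_le (D : R -> Prop) (f : R -> C) (M x0 : R) : D x0 ->
  (forall x, D x -> Cmod (f x) <= M) -> supnorm D f <= M.
Proof.
intros H0 H. unfold supnorm.
set (P := fun r => exists x, D x /\ r = Cmod (f x)).
destruct (Lub_Rbar_correct P) as [U L].
assert (L1 : Rbar_le (Lub_Rbar P) M) by (apply L; intros r (x & Hx & ->); apply H, Hx).
assert (U1 : Rbar_le (Cmod (f x0)) (Lub_Rbar P)) by (apply U; exists x0; auto).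
destruct (Lub_Rbar P); simpl in *; tauto.
Qed.

Lemma supnorm_ge (D : R -> Prop) (f : R -> C) (M x : R) :
  (forall x, D x -> Cmod (f x) <= M) -> D x -> Cmod (f x) <= supnorm D f.
Proof.
intros H Hx. unfold supnorm.
set (P := fun r => exists x, D x /\ r = Cmod (f x)).
destruct (Lub_Rbar_correct P) as [U L].
assert (L1 : Rbar_le (Lub_Rbar P) M) by (apply L; intros r (y & Hy & ->); apply H, Hy).
assert (U1 : Rbar_le (Cmod (f x)) (Lub_Rbar P)) by (apply U; exists x; auto).
destruct (Lub_Rbar P); simpl in *; tauto.
Qed.

(** * The circle model *)

Definition circ {mu nu : C} (F : Iinf mu nu) (t : R) : C := F (kt t).

(** This is [exp (- s)] in Iwasawa coordinates. *)
Definition bot (g : Gt) : R := mc (mat g) * mc (mat g) + md (mat g) * md (mat g).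

(** Left equivariance under the upper triangular subgroup, written with the
    bottom row and the angle only: these are explicit for a product in [Gt],
    while the Iwasawa coordinates are not. *)
Definition homform (nu : C) (F : Gt -> C) (phi : R -> C) : Prop :=
  forall g, F g = (Rcpow (bot g) (- (nu + RtoC (1 / 2))) * phi (ang g))%C.

Lemma iwasawa_00 (t : R) : iwasawa 0 0 t = kt t.
Proof.
assert (S1 : sqrt (exp 0) = 1) by (rewrite exp_0; apply sqrt_1).
apply Gt_eq; [simpl; rewrite ?S1; field..|apply ang_iwasawa].
Qed.

Lemma bot_iwasawa (x s t : R) : bot (iwasawa x s t) = exp (- s).
Proof.
unfold bot. rewrite mc_iwasawa, md_iwasawa, exp_Ropp.
pose proof (sqrt_exp_gt0 s) as P. pose proof (exp_pos s) as E.
rewrite <- (sqrt_sqrt (exp s)) at 5 by lra.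
pose proof (sin2_cos2 t) as SC; unfold Rsqr in SC.
transitivity ((sin t * sin t + cos t * cos t) / (sqrt (exp s) * sqrt (exp s))).
- field. lra.
- rewrite SC. field. lra.
Qed.

Lemma bot_gt0 (g : Gt) : 0 < bot g.
Proof. destruct (iwasawa_surj g) as (x & s & t & ->). rewrite bot_iwasawa. apply exp_pos. Qed.

Lemma Rcpow_1 (s : C) : Rcpow 1 s = 1.
Proof. unfold Rcpow. rewrite ln_1. replace (s * RtoC 0)%C with (RtoC 0) by ring. apply Cexp_0. Qed.

Lemma bot_kt (t : R) : bot (kt t) = 1.
Proof. rewrite <- iwasawa_00, bot_iwasawa, Ropp_0. apply exp_0. Qed.

Lemma homform_kt (nu : C) (F : Gt -> C) (phi : R -> C) (t : R) :
  homform nu F phi -> F (kt t) = phi t.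
Proof. intros H. rewrite H, bot_kt, Rcpow_1. simpl. ring. Qed.

Lemma Iinf_homform {mu nu : C} (F : Iinf mu nu) : homform nu F (circ F).
Proof.
intros g. destruct (iwasawa_surj g) as (x & s & t & ->).
rewrite bot_iwasawa, ang_iwasawa.
pose proof (ihomog F x (exppos s) 0%Z (kt t)) as H.
rewrite Gmul_assoc_k, kt_add in H. replace (IZR 0 * PI + t) with t in H by ring.
fold (iwasawa x s t) in H. rewrite H. unfold Rcpow, circ. simpl. rewrite !ln_exp.
replace (RtoC PI * RtoC 0 * Ci * mu)%C with (RtoC 0) by ring. rewrite Cexp_0, Cmult_1_l.
f_equal. f_equal. rewrite RtoC_opp. ring.
Qed.

Lemma Iinf_eq {mu nu : C} (F G : Iinf mu nu) : (forall g, F g = G g) -> F = G.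
Proof.
destruct F as [f sf hf], G as [g sg hg]; simpl. intros H.
assert (f = g) by (apply functional_extensionality, H). subst g.
f_equal; apply proof_irrelevance.
Qed.

Lemma circ_inj {mu nu : C} (F G : Iinf mu nu) : (forall t, circ F t = circ G t) -> F = G.
Proof. intros H. apply Iinf_eq. intros g. rewrite !Iinf_homform, H. reflexivity. Qed.

Lemma circ_shift {mu nu : C} (F : Iinf mu nu) (m : Z) (t : R) :
  circ F (IZR m * PI + t) = (Cexp (RtoC PI * RtoC (IZR m) * Ci * mu) * circ F t)%C.
Proof.
pose proof (ihomog F 0 (exppos 0) m (kt t)) as H.
change (Gmul (Gmul (ut 0) (at_ (exppos 0))) (kt (IZR m * PI)))
  with (iwasawa 0 0 (IZR m * PI)) in H.
rewrite iwasawa_00, kt_add in H. unfold circ. rewrite H.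
change (pos (exppos 0)) with (exp 0). rewrite exp_0, Rcpow_1. ring.
Qed.

Lemma circ_Fw {mu nu : C} (F : Iinf mu nu) (t : R) :
  circ (Fw F) t = (Cexp (RtoC PI * Ci * mu / RtoC 2) * circ F (t - PI / 2))%C.
Proof.
unfold circ. change (Fw F (kt t)) with (Fw_fun mu F (kt t)). unfold Fw_fun, wt.
rewrite kt_add. replace (t - PI / 2) with (t + - PI / 2) by field. reflexivity.
Qed.

Lemma circ_comb {mu nu : C} (a b : C) (F G : Iinf mu nu) (t : R) :
  circ (Icomb a b F G) t = (a * circ F t + b * circ G t)%C.
Proof. reflexivity. Qed.

Lemma Fw_Fw {mu nu : C} (F : Iinf mu nu) : Fw (Fw F) = F.
Proof.
apply circ_inj. intros t. rewrite !circ_Fw.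
replace (t - PI / 2 - PI / 2) with (IZR (-1) * PI + t) by field.
rewrite circ_shift, !Cmult_assoc, <- !Cexp_add.
replace (_ + _ + _)%C with (RtoC 0).
- rewrite Cexp_0. ring.
- field.
Qed.

Lemma Fw_comb {mu nu : C} (a b : C) (F G : Iinf mu nu) :
  Fw (Icomb a b F G) = Icomb a b (Fw F) (Fw G).
Proof. apply circ_inj. intros t. rewrite circ_comb, !circ_Fw, circ_comb. ring. Qed.

(** Only the third Iwasawa coordinate varies along the circle. *)
Lemma Ck3_slice (n : nat) : forall f, Ck3 (S n) f ->
  forall x s t, Cex_derive (CDerive_n (f x s) n) t.
Proof.
induction n as [|n IH]; intros f [_ (D & _ & _ & H)] x s t.
- apply (D x s t).
- rewrite CDerive_n_shift. apply (IH _ H x s t).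
Qed.

Lemma circ_smooth {mu nu : C} (F : Iinf mu nu) : smooth (circ F).
Proof.
intros n t. pose proof (Ck3_slice n _ (ismooth F (S n)) 0 0 t) as H.
replace (circ F) with (fun t => F (iwasawa 0 0 t)); [exact H|].
apply functional_extensionality; intros r. now rewrite iwasawa_00.
Qed.

(** * The Lie algebra in the circle model *)

Lemma Carg_atan (z : C) : 0 < Re z -> Carg z = atan (Im z / Re z).
Proof.
destruct z as [x y]; unfold Re, Im; simpl. intros Hx.
set (u := y / x). assert (P : 0 < 1 + Rsqr u) by (pose proof (Rle_0_sqr u); lra).
pose proof (sqrt_lt_R0 _ P) as Q.
pose proof (atan_bound u) as B. pose proof PI_RGT_0.
rewrite <- (Carg_cis (x * sqrt (1 + Rsqr u)) (atan u)); [|apply Rmult_lt_0_compat; lra|lra].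
rewrite cos_atan, sin_atan. f_equal. unfold u. f_equal; field; unfold u in *; lra.
Qed.

Lemma is_derive_Carg_1 (z : R -> C) (x a b : R) : z x = 1 ->
  is_derive (fun t => Re (z t)) x a -> is_derive (fun t => Im (z t)) x b ->
  is_derive (fun t => Carg (z t)) x b.
Proof.
intros Z Da Db.
apply (is_derive_ext_loc (fun t => atan (Im (z t) / Re (z t)))).
- assert (Hc : continuous (fun t => Re (z t)) x)
    by (apply (ex_derive_continuous (V := R_NormedModule)); eexists; exact Da).
  assert (P : 0 < Re (z x)) by (rewrite Z; simpl; lra).
  assert (L : locally x (fun t => 0 < Re (z t)))
    by exact (Hc (fun v => 0 < v) (open_gt 0 _ P)).
  refine (filter_imp _ _ _ L). intros t Ht. symmetry. apply Carg_atan, Ht.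
- assert (Ex : Re (z x) = 1) by (rewrite Z; reflexivity).
  assert (Ey : Im (z x) = 0) by (rewrite Z; reflexivity).
  evar_last.
  { apply (is_derive_comp atan (fun t => Im (z t) / Re (z t))).
    - apply is_derive_atan.
    - apply is_derive_div; [exact Db|exact Da|rewrite Ex; lra]. }
  unfold scal; simpl; unfold mult; simpl. unfold Rsqr. rewrite !Ex, !Ey. field.
Qed.

Lemma sl2ch_0 (X : sl2) : sl2ch X 0 = 1.
Proof.
unfold sl2ch. rewrite !Rmult_0_l.
repeat destruct (Rlt_dec _ _); [apply cosh_0|apply cos_0|reflexivity].
Qed.

Lemma sl2sh_0 (X : sl2) : sl2sh X 0 = 0.
Proof.
unfold sl2sh. rewrite !Rmult_0_l, sinh_0, sin_0. unfold Rdiv. rewrite !Rmult_0_l.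
repeat destruct (Rlt_dec _ _); reflexivity.
Qed.

Lemma is_derive_sl2ch (X : sl2) : is_derive (sl2ch X) 0 0.
Proof.
unfold sl2ch. destruct (Rlt_dec 0 (sl2disc X)); [|destruct (Rlt_dec (sl2disc X) 0)].
- unfold cosh. auto_derive; [trivial|]. rewrite Rmult_0_l, Ropp_0, exp_0. field.
- auto_derive; [trivial|]. rewrite Rmult_0_l, sin_0. ring.
- apply (is_derive_const (V := R_NormedModule)).
Qed.

Lemma is_derive_sl2sh (X : sl2) : is_derive (sl2sh X) 0 1.
Proof.
unfold sl2sh. destruct (Rlt_dec 0 (sl2disc X)) as [H|]; [|destruct (Rlt_dec (sl2disc X) 0) as [H|]].
- pose proof (sqrt_lt_R0 _ H). unfold sinh. auto_derive; [trivial|].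
  rewrite Rmult_0_l, Ropp_0, exp_0. field. lra.
- assert (K : 0 < - sl2disc X) by lra. pose proof (sqrt_lt_R0 _ K).
  auto_derive; [trivial|]. rewrite Rmult_0_l, cos_0. field. lra.
- apply (is_derive_id (K := R_AbsRing)).
Qed.

Lemma mobius_Ci (h : SL2) :
  mobius h Ci = ((ma h * mc h + mb h * md h) / (mc h * mc h + md h * md h),
                 / (mc h * mc h + md h * md h)).
Proof.
assert (N : mc h * mc h + md h * md h <> 0).
{ intros K. pose proof (mdet h) as D.
  assert (mc h = 0) by nra. assert (md h = 0) by nra. nra. }
unfold mobius. set (w := (_, _)).
replace (RtoC (ma h) * Ci + RtoC (mb h))%C with (J h Ci * w)%C.
- apply Cdiv_cancel, J_Ci_neq0.
- rewrite J_Ci. pose proof (mdet h) as D.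
  unfold w, Cmult, Cplus, Ci, RtoC; simpl. f_equal.
  + field_simplify_eq; [|exact N]. apply Rminus_diag_uniq.
    transitivity (mc h * (ma h * md h - mb h * mc h - 1)); [ring|rewrite D; ring].
  + field_simplify_eq; [|exact N]. apply Rminus_diag_uniq.
    transitivity (md h * (1 - (ma h * md h - mb h * mc h))); [ring|rewrite D; ring].
Qed.

Lemma J_quotient (g : SL2) (u v : R) :
  (J g (u, v) / J g Ci)%C =
  (((mc g * u + md g) * md g + mc g * mc g * v) / (mc g * mc g + md g * md g),
   (mc g * md g * v - mc g * (mc g * u + md g)) / (mc g * mc g + md g * md g)).
Proof.
assert (N : mc g * mc g + md g * md g <> 0).
{ intros K. pose proof (mdet g) as D.
  assert (mc g = 0) by nra. assert (md g = 0) by nra. nra. }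
set (w := (_ / _, _ / _)). rewrite <- (Cdiv_cancel (J g Ci) w) by apply J_Ci_neq0.
f_equal. rewrite J_Ci. unfold w, J, Cmult, Cplus, RtoC; simpl. f_equal; field; exact N.
Qed.

(** The logarithmic derivative at [r = 0] of [bot (g exp (r X)) ^ - (nu + 1/2)]. The
    bottom row of [g] is [sqrt (bot g) (- sin t, cos t)], so that of
    [bot (g exp (r X))] is twice the real factor below. *)
Definition lie_mult (nu : C) (X : sl2) (t : R) : C :=
  (RtoC (-2) * (nu + RtoC (1 / 2))
   * RtoC ((sin t * sin t - cos t * cos t) * xa X - sin t * cos t * (xb X + xc X)))%C.

(** The velocity of the angle of [g exp (r X)] at [r = 0]. *)
Definition lie_field (X : sl2) (t : R) : C :=
  RtoC (sin t * sin t * (xb X + xc X) + 2 * xa X * (sin t * cos t) - xc X).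

(** The derivatives at 0 of the angle and of the bottom row of [g exp (r X)] give
    the vector field and the multiplier by which [X] acts on the circle. *)
Lemma rho_lie_homform (nu : C) (X : sl2) (F : Gt -> C) (phi : R -> C) :
  homform nu F phi -> smooth phi ->
  homform nu (rho (Ulie X) F)
    (fun t => lie_mult nu X t * phi t + lie_field X t * CDerive phi t)%C.
Proof.
intros HF Sp g. simpl rho. apply CDerive_unique.
pose proof (bot_gt0 g) as Hb0.
assert (Hcd : mc (mat g) = - sqrt (bot g) * sin (ang g) /\ md (mat g) = sqrt (bot g) * cos (ang g)).
{ destruct (iwasawa_surj g) as (x & s & t & ->).
  rewrite bot_iwasawa, ang_iwasawa, mc_iwasawa, md_iwasawa, exp_Ropp, sqrt_inv.
  pose proof (sqrt_exp_gt0 s). split; field; lra. }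
destruct Hcd as [Ec Ed]. pose proof (sqrt_lt_R0 _ Hb0) as Hq.
pose proof (sqrt_sqrt (bot g) ltac:(lra)) as Hqq.
set (q := sqrt (bot g)) in *. set (th := ang g) in *.
pose proof (sin2_cos2 th) as SC; unfold Rsqr in SC.
pose proof (is_derive_sl2ch X) as Dc. pose proof (is_derive_sl2sh X) as Ds.
pose proof (sl2ch_0 X) as c0. pose proof (sl2sh_0 X) as s0.
assert (ec : ex_derive (sl2ch X) 0) by (eexists; exact Dc).
assert (es : ex_derive (sl2sh X) 0) by (eexists; exact Ds).
apply is_derive_unique in Dc, Ds.
assert (Db : is_derive (fun r => bot (Gmul g (lift (sl2exp X r)))) 0
  (q * q * (2 * ((sin th * sin th - cos th * cos th) * xa X - sin th * cos th * (xb X + xc X))))).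
{ unfold bot; simpl. auto_derive; [repeat split; assumption|].
  change (fun x => sl2ch X x) with (sl2ch X). change (fun x => sl2sh X x) with (sl2sh X).
  rewrite Dc, Ds, c0, s0, Ec, Ed. ring. }
assert (Da : is_derive (fun r => ang (Gmul g (lift (sl2exp X r)))) 0
  (sin th * sin th * (xb X + xc X) + 2 * xa X * (sin th * cos th) - xc X)).
{ simpl. fold th.
  assert (D1 : is_derive (fun r => Carg (J (sl2exp X r) Ci)) 0 (xc X)).
  { apply (is_derive_Carg_1 _ 0 (- xa X)).
    - rewrite J_Ci. simpl. rewrite c0, s0. unfold RtoC. f_equal; ring.
    - apply (is_derive_ext (fun r => sl2ch X r + sl2sh X r * - xa X));
        [intros r; rewrite J_Ci; reflexivity|].
      auto_derive; [repeat split; assumption|].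
      change (fun x => sl2ch X x) with (sl2ch X). change (fun x => sl2sh X x) with (sl2sh X).
      rewrite Dc, Ds. ring.
    - apply (is_derive_ext (fun r => sl2sh X r * xc X));
        [intros r; rewrite J_Ci; reflexivity|].
      auto_derive; [repeat split; assumption|].
      change (fun x => sl2sh X x) with (sl2sh X). rewrite Ds. ring. }
  assert (D2 : is_derive (fun r => Carg (J (mat g) (mobius (sl2exp X r) Ci) / J (mat g) Ci)%C) 0
     (- (sin th * sin th * (xb X + xc X) + 2 * xa X * (sin th * cos th)))).
  { assert (Nb : mc (mat g) * mc (mat g) + md (mat g) * md (mat g) <> 0)
      by (fold (bot g); lra).
    eapply is_derive_Carg_1.
    - rewrite mobius_Ci, J_quotient. simpl. rewrite c0, s0. unfold RtoC.
      f_equal; field; exact Nb.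
    - eapply is_derive_ext; [intros r; rewrite mobius_Ci, J_quotient; simpl; reflexivity|].
      auto_derive; [rewrite c0, s0; repeat split; try assumption; lra|reflexivity].
    - eapply is_derive_ext; [intros r; rewrite mobius_Ci, J_quotient; simpl; reflexivity|].
      auto_derive; [rewrite c0, s0; repeat split; try assumption; lra|].
      change (fun x => sl2ch X x) with (sl2ch X). change (fun x => sl2sh X x) with (sl2sh X).
      rewrite Dc, Ds, c0, s0. fold (bot g). rewrite <- Hqq, Ec, Ed.
      field. lra. }
  evar_last.
  { apply (is_derive_minus (V := R_NormedModule)); [|exact D2].
    apply (is_derive_plus (V := R_NormedModule)); [apply (is_derive_const (V := R_NormedModule))|].
    apply (is_derive_opp (V := R_NormedModule)); exact D1. }
  unfold minus, plus, opp, zero; simpl. ring. }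
assert (B0 : bot (Gmul g (lift (sl2exp X 0))) = bot g)
  by (unfold bot; simpl; rewrite c0, s0; ring).
assert (A0 : ang (Gmul g (lift (sl2exp X 0))) = th).
{ assert (I0 : mobius (sl2exp X 0) Ci = Ci).
  { rewrite mobius_Ci. simpl. rewrite c0, s0. unfold Ci. f_equal; field. }
  assert (J0 : J (sl2exp X 0) Ci = 1).
  { rewrite J_Ci. simpl. rewrite c0, s0. unfold RtoC. f_equal; ring. }
  simpl. rewrite I0, J0. fold th.
  replace (J (mat g) Ci / J (mat g) Ci)%C with (RtoC 1) by (field; apply J_Ci_neq0).
  rewrite Carg_1. ring. }
apply (is_derive_ext (fun r => Rcpow (bot (Gmul g (lift (sl2exp X r)))) (- (nu + RtoC (1 / 2)))
         * phi (ang (Gmul g (lift (sl2exp X r)))))%C); [intros r; symmetry; apply HF|].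
evar_last.
{ apply is_derive_Cmult.
  - apply (is_derive_Rcpow (fun r => bot (Gmul g (lift (sl2exp X r)))));
      [rewrite B0; exact Hb0|exact Db].
  - apply (is_derive_Ccomp phi (fun r => ang (Gmul g (lift (sl2exp X r)))) 0 (CDerive phi th));
      [|exact Da].
    rewrite A0. apply CDerive_correct, smooth_ex, Sp. }
cbv beta. rewrite B0, A0, Hqq. unfold lie_mult, lie_field. fold th.
replace (bot g * _ / bot g) with
  (2 * ((sin th * sin th - cos th * cos th) * xa X - sin th * cos th * (xb X + xc X)))
  by (field; lra).
rewrite RtoC_mult. replace (RtoC (-2)) with (- RtoC 2)%C by (rewrite <- RtoC_opp; reflexivity).
ring.
Qed.

(** The action of the enveloping algebra on [circ F]. It is defined on all
    functions, so that estimates for it can be composed without the equivariance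
    of [F]. *)
Fixpoint circ_op (nu : C) (A : Uterm) (phi : R -> C) : R -> C :=
  match A with
  | Uscal c => fun t => (c * phi t)%C
  | Ulie X => fun t => (lie_mult nu X t * phi t + lie_field X t * CDerive phi t)%C
  | Uadd A1 A2 => fun t => (circ_op nu A1 phi t + circ_op nu A2 phi t)%C
  | Umul A1 A2 => circ_op nu A1 (circ_op nu A2 phi)
  end.

Lemma smooth_sin : smooth (fun t => RtoC (sin t)).
Proof. apply smooth_closure_smooth, sc_sin. Qed.

Lemma smooth_cos : smooth (fun t => RtoC (cos t)).
Proof. apply smooth_closure_smooth, sc_cos. Qed.

Lemma smooth_lie_mult (nu : C) (X : sl2) : smooth (lie_mult nu X).
Proof.
pose proof smooth_sin as S. pose proof smooth_cos as Co.
replace (lie_mult nu X) with (fun t =>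
  RtoC (-2) * (nu + RtoC (1 / 2)) *
   ((RtoC (sin t) * RtoC (sin t) + RtoC (-1) * (RtoC (cos t) * RtoC (cos t))) * RtoC (xa X)
    + RtoC (sin t) * RtoC (cos t) * RtoC (- (xb X + xc X))))%C.
- repeat first [assumption | simple apply smooth_const | simple apply smooth_mult | simple apply smooth_plus].
- apply functional_extensionality; intros t. unfold lie_mult. f_equal.
  rewrite <- !RtoC_mult, <- !RtoC_plus, <- !RtoC_mult, <- !RtoC_plus. f_equal. ring.
Qed.

Lemma smooth_lie_field (X : sl2) : smooth (lie_field X).
Proof.
pose proof smooth_sin as S. pose proof smooth_cos as Co.
replace (lie_field X) with (fun t =>
  RtoC (sin t) * RtoC (sin t) * RtoC (xb X + xc X)
    + (RtoC (sin t) * RtoC (cos t) * RtoC (2 * xa X) + RtoC (- xc X)))%C.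
- repeat first [assumption | simple apply smooth_const | simple apply smooth_mult | simple apply smooth_plus].
- apply functional_extensionality; intros t. unfold lie_field.
  rewrite <- !RtoC_mult, <- !RtoC_plus. f_equal. ring.
Qed.

Lemma circ_op_smooth (nu : C) (A : Uterm) (phi : R -> C) :
  smooth phi -> smooth (circ_op nu A phi).
Proof.
revert phi. induction A as [c|X|A1 IH1 A2 IH2|A1 IH1 A2 IH2]; intros phi Hp; simpl.
- apply smooth_mult; [apply smooth_const|exact Hp].
- apply smooth_plus; apply smooth_mult; auto using smooth_lie_mult, smooth_lie_field, smooth_D.
- apply smooth_plus; auto.
- auto.
Qed.

Lemma rho_homform (nu : C) (A : Uterm) (F : Gt -> C) (phi : R -> C) :
  homform nu F phi -> smooth phi -> homform nu (rho A F) (circ_op nu A phi).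
Proof.
revert F phi. induction A as [c|X|A1 IH1 A2 IH2|A1 IH1 A2 IH2]; intros F phi HF Hp.
- intros g. simpl. rewrite (HF g). ring.
- apply rho_lie_homform; assumption.
- intros g. simpl. rewrite (IH1 _ _ HF Hp g), (IH2 _ _ HF Hp g). ring.
- simpl. apply IH1; [apply IH2; assumption|apply circ_op_smooth, Hp].
Qed.

Definition period (t : R) : Prop := - PI <= t < PI.

Lemma period_0 : period 0.
Proof. pose proof PI_RGT_0. unfold period; lra. Qed.

Lemma bnd_ge0 (E : R -> Prop) (t : R) (n : nat) (f : R -> C) (M : R) :
  E t -> bnd E n f M -> 0 <= M.
Proof. intros Ht H. eapply Rle_trans; [apply Cmod_ge_0|apply (H O t ltac:(lia) Ht)]. Qed.

Lemma bnd_period (n : nat) (f : R -> C) : smooth f -> exists M, 0 <= M /\ bnd period n f M.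
Proof.
intros Sf. destruct (bnd_compact (- PI) PI n f Sf) as (M & HM & B).
exists M. split; [exact HM|]. intros j t Hj [H1 H2]. apply B; [exact Hj|lra].
Qed.

(** Bounds in all orders [n] at once are needed, as the outer factor of a product
    differentiates the result of the inner one. *)
Lemma circ_op_bnd (nu : C) (A : Uterm) (n : nat) :
  exists (m : nat) (K : R), 0 <= K /\ forall phi M,
    smooth phi -> bnd period m phi M -> bnd period n (circ_op nu A phi) (K * M).
Proof.
revert n. induction A as [c|X|A1 IH1 A2 IH2|A1 IH1 A2 IH2]; intros n; simpl circ_op.
- exists n, (Cmod c). split; [apply Cmod_ge_0|]. intros phi M Sp Hp.
  apply bnd_scal; assumption.
- destruct (bnd_period n _ (smooth_lie_mult nu X)) as (P & HP & BP).
  destruct (bnd_period n _ (smooth_lie_field X)) as (Q & HQ & BQ).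
  pose proof (pow_lt 2 n ltac:(lra)) as T.
  exists (S n), (2 ^ n * P + 2 ^ n * Q). split; [nra|]. intros phi M Sp Hp.
  replace (_ * M) with (2 ^ n * (P * M) + 2 ^ n * (Q * M)) by ring.
  pose proof (smooth_lie_mult nu X). pose proof (smooth_lie_field X). pose proof (smooth_D _ Sp).
  apply bnd_plus; [apply smooth_mult; assumption..| |]; apply bnd_mult; try assumption.
  + eapply bnd_le; [| |exact Hp]; [lia|lra].
  + apply bnd_S in Hp. tauto.
- destruct (IH1 n) as (m1 & K1 & HK1 & B1). destruct (IH2 n) as (m2 & K2 & HK2 & B2).
  exists (Nat.max m1 m2), (K1 + K2). split; [lra|]. intros phi M Sp Hp.
  rewrite Rmult_plus_distr_r. apply bnd_plus; auto using circ_op_smooth.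
  + apply B1; [exact Sp|]. eapply bnd_le; [| |exact Hp]; [lia|lra].
  + apply B2; [exact Sp|]. eapply bnd_le; [| |exact Hp]; [lia|lra].
- destruct (IH1 n) as (m1 & K1 & HK1 & B1). destruct (IH2 m1) as (m2 & K2 & HK2 & B2).
  exists m2, (K1 * K2). split; [apply Rmult_le_pos; assumption|]. intros phi M Sp Hp.
  rewrite Rmult_assoc. apply B1; auto using circ_op_smooth.
Qed.

Lemma Qnorm_bnd (mu nu : C) (A : Uterm) : exists (m : nat) (K : R), 0 <= K /\
  forall (F : Iinf mu nu) M, bnd period m (circ F) M -> Qnorm A F <= K * M.
Proof.
destruct (circ_op_bnd nu A 0) as (m & K & HK & B).
exists m, K. split; [exact HK|]. intros F M HF.
unfold Qnorm. apply (supnorm_le _ _ _ 0 period_0). intros t Ht.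
rewrite (homform_kt nu _ _ t (rho_homform nu A F (circ F) (Iinf_homform F) (circ_smooth F))).
exact (proj1 (bnd_0 _ _ _) (B _ _ (circ_smooth F) HF) t Ht).
Qed.

Lemma Qnorms_bnd (mu nu : C) (As : list Uterm) : exists (m : nat) (K : R), 0 < K /\
  forall A, In A As -> forall (F : Iinf mu nu) M,
    bnd period m (circ F) M -> Qnorm A F <= K * M.
Proof.
induction As as [|A As (m & K & HK & IH)].
- exists O, 1. split; [lra|]. intros A [].
- destruct (Qnorm_bnd mu nu A) as (m' & K' & HK' & B).
  exists (Nat.max m m'), (K + K'). split; [lra|]. intros A' HA F M HF.
  pose proof (bnd_ge0 _ 0 _ _ _ period_0 HF) as HM.
  assert (H1 : bnd period m (circ F) M) by (eapply bnd_le; [| |exact HF]; [lia|lra]).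
  assert (H2 : bnd period m' (circ F) M) by (eapply bnd_le; [| |exact HF]; [lia|lra]).
  destruct HA as [<-|HA].
  + specialize (B F M H2). nra.
  + specialize (IH A' HA F M H1). nra.
Qed.

(** The generator of the rotations [kt], whose powers give all derivatives on
    the circle. *)
Definition rot : sl2 := mksl2 0 1 (-1).

Fixpoint rot_pow (n : nat) : Uterm :=
  match n with
  | O => Uscal 1
  | S n' => Umul (Ulie rot) (rot_pow n')
  end.

Lemma lift_rot (r : R) : - PI < r < PI -> lift (sl2exp rot r) = kt r.
Proof.
intros Hr.
assert (D : sl2disc rot = -1) by (unfold sl2disc; simpl; ring).
assert (E1 : sl2ch rot r = cos r).
{ unfold sl2ch. rewrite D. destruct (Rlt_dec 0 (-1)); [lra|].
  destruct (Rlt_dec (-1) 0); [|lra]. replace (- -1) with 1 by ring. rewrite sqrt_1. f_equal. ring. }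
assert (E2 : sl2sh rot r = sin r).
{ unfold sl2sh. rewrite D. destruct (Rlt_dec 0 (-1)); [lra|].
  destruct (Rlt_dec (-1) 0); [|lra]. replace (- -1) with 1 by ring. rewrite sqrt_1.
  rewrite Rmult_1_r. field. }
apply Gt_eq; simpl; rewrite ?E1, ?E2; try ring.
rewrite J_Ci; simpl. rewrite E1, E2.
transitivity (- Carg (1 * cos (- r), 1 * sin (- r))); [|rewrite Carg_cis by lra; ring].
rewrite cos_neg, sin_neg. f_equal. f_equal. f_equal; ring.
Qed.

Lemma CDerive_ext_loc (f g : R -> C) (x : R) :
  locally x (fun t => f t = g t) -> CDerive f x = CDerive g x.
Proof.
intros H. unfold CDerive. f_equal; apply Derive_ext_loc;
refine (filter_imp _ _ _ H); intros t ->; reflexivity.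
Qed.

Lemma rho_rot_pow (n : nat) (F : Gt -> C) (t : R) :
  rho (rot_pow n) F (kt t) = CDerive_n (fun t => F (kt t)) n t.
Proof.
revert t. induction n as [|n IH]; intros t; [simpl; ring|].
cbn [rot_pow rho CDerive_n].
replace (CDerive_n (fun t => F (kt t)) n) with (fun t => rho (rot_pow n) F (kt t))
  by (apply functional_extensionality; exact IH).
replace (CDerive (fun t => rho (rot_pow n) F (kt t)) t)
  with (CDerive (fun t => rho (rot_pow n) F (kt t)) (0 + t)) by (f_equal; ring).
rewrite <- (CDerive_shift (fun t => rho (rot_pow n) F (kt t)) t 0).
apply CDerive_ext_loc. pose proof PI_RGT_0.
apply (locally_R _ 0 PI); [lra|]. intros r Hr. apply Rabs_def2 in Hr.
rewrite lift_rot by lra. rewrite kt_add. f_equal. f_equal. ring.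
Qed.

Lemma bnd_Qnorm {mu nu : C} (F : Iinf mu nu) (n : nat) (M : R) :
  (forall j, (j <= n)%nat -> Qnorm (rot_pow j) F <= M) -> bnd period n (circ F) M.
Proof.
intros H j t Hj Ht. eapply Rle_trans; [|apply (H j Hj)].
destruct (bnd_period j _ (circ_smooth F)) as (B & _ & HB).
unfold Qnorm. change (circ F) with (fun t => F (kt t)). rewrite <- (rho_rot_pow j F t).
apply (supnorm_ge period (fun t => rho (rot_pow j) F (kt t)) B t); [|exact Ht].
intros x Hx. rewrite rho_rot_pow. apply HB; auto.
Qed.

(** * Continuity of functionals *)

Definition linear_fun {mu nu : C} (lam : Iinf mu nu -> C) : Prop :=
  forall (a b : C) (F G : Iinf mu nu), lam (Icomb a b F G) = (a * lam F + b * lam G)%C.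

Definition bounded_fun {mu nu : C} (lam : Iinf mu nu -> C) : Prop :=
  exists (n : nat) (K : R), 0 <= K /\
    forall F M, bnd period n (circ F) M -> Cmod (lam F) <= K * M.

Lemma Cmod_ball (z w : C) (eps : posreal) :
  Cmod (w - z)%C < eps -> ball z eps w.
Proof.
intros H. pose proof (Rmax_Cmod (w - z)%C) as K.
split; (eapply Rle_lt_trans; [|exact H]); (eapply Rle_trans; [|exact K]).
- apply Rmax_l.
- apply Rmax_r.
Qed.

Lemma bounded_Idual {mu nu : C} (lam : Iinf mu nu -> C) :
  linear_fun lam -> bounded_fun lam -> Idual lam.
Proof.
intros L (n & K & HK & B). split; [exact L|].
intros F0 P [eps HP]. 
assert (He : 0 < eps / (K + 1)) by (apply Rdiv_lt_0_compat; [apply cond_pos|lra]).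
exists (map rot_pow (seq 0 (S n))), (mkposreal _ He). intros F HF. cbn [pos] in HF.
apply HP, Cmod_ball.
replace (lam F - lam F0)%C with (lam (Icomb 1 (- (1)) F F0)) by (rewrite L; ring).
apply Rle_lt_trans with (K * (eps / (K + 1))).
- apply B, bnd_Qnorm. intros j Hj. left. apply HF.
  apply in_map, in_seq. lia.
- pose proof (cond_pos eps). 
  replace (pos eps) with ((K + 1) * (eps / (K + 1))) at 2 by (field; lra). lra.
Qed.

Definition Czero : Cc :=
  mkCc (fun _ => RtoC 0) (smooth_const 0) (ex_intro _ 0 (fun x _ => eq_refl)).

Definition Izero (mu nu : C) : Iinf mu nu :=
  Icomb 0 0 (iota mu nu Czero) (iota mu nu Czero).

(** Scaling turns continuity at the origin into a bound: an element whose
    seminorms are at most [M] is a multiple of one in the neighbourhood of 0 on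
    which the functional is bounded by a constant. *)
Lemma Idual_bounded {mu nu : C} (lam : Iinf mu nu -> C) : Idual lam -> bounded_fun lam.
Proof.
intros [L Hc]. set (F0 := Izero mu nu).
assert (l0 : lam F0 = 0) by (unfold F0, Izero; rewrite L; ring).
destruct (Hc F0 (fun z => ball (lam F0) 1 z)) as (As & eps & H).
{ exists (mkposreal 1 Rlt_0_1). auto. }
destruct (Qnorms_bnd mu nu As) as (n & K & HK & B).
exists n, (4 * K / eps). pose proof (cond_pos eps) as He.
assert (HK' : 0 < 4 * K / eps) by (apply Rdiv_lt_0_compat; lra).
split; [lra|]. intros F M HF. pose proof (bnd_ge0 _ 0 _ _ _ period_0 HF) as HM.
apply le_epsilon. intros d Hd.
(* [c F] has seminorms at most [eps / 2] in the given neighbourhood, also when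
   [M = 0]; the 2 in the bound for [lam (c F)] is the price of the balls of [C]
   being squares. *)
set (d' := d / (4 * K / eps)). assert (Hd' : 0 < d') by (apply Rdiv_lt_0_compat; lra).
set (c := eps / (2 * K * (M + d'))).
assert (HKM : 0 < 2 * K * (M + d')) by (apply Rmult_lt_0_compat; lra).
assert (Hc0 : 0 < c) by (apply Rdiv_lt_0_compat; assumption).
assert (Z : Cmod (lam (Icomb (RtoC c) 0 F F)) <= 2).
{ assert (Q : ball (lam F0) 1 (lam (Icomb (RtoC c) 0 F F))).
  { apply H. intros A HA.
    apply Rle_lt_trans with (K * (c * M)).
    - apply (B A HA).
      assert (E : forall t, circ (Icomb 1 (- (1)) (Icomb (RtoC c) 0 F F) F0) t = (RtoC c * circ F t)%C).
      { intros t. rewrite !circ_comb. unfold F0, Izero. rewrite circ_comb. ring. }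
      apply (bnd_ext _ _ _ _ _ (fun t => eq_sym (E t))).
      pose proof (bnd_scal period n (RtoC c) _ M (circ_smooth F) HF) as Y.
      rewrite Cmod_R, Rabs_pos_eq in Y by lra. exact Y.
    - apply Rle_lt_trans with (K * (c * (M + d'))).
      + apply Rmult_le_compat_l; [lra|]. apply Rmult_le_compat_l; lra.
      + replace (K * (c * (M + d'))) with (eps / 2) by (unfold c; field; lra). lra. }
  rewrite l0 in Q. destruct Q as [Q1 Q2].
  assert (Q1' : Rabs (Re (lam (Icomb (RtoC c) 0 F F)) - 0) < 1) by exact Q1.
  assert (Q2' : Rabs (Im (lam (Icomb (RtoC c) 0 F F)) - 0) < 1) by exact Q2.
  rewrite Rminus_0_r in Q1', Q2'. apply Rabs_def2 in Q1', Q2'.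
  pose proof (Cmod_sqr (lam (Icomb (RtoC c) 0 F F))) as S.
  pose proof (Cmod_ge_0 (lam (Icomb (RtoC c) 0 F F))).
  assert (Re (lam (Icomb (RtoC c) 0 F F)) * Re (lam (Icomb (RtoC c) 0 F F)) <= 1) by nra.
  assert (Im (lam (Icomb (RtoC c) 0 F F)) * Im (lam (Icomb (RtoC c) 0 F F)) <= 1) by nra.
  nra. }
rewrite L in Z. replace (RtoC c * lam F + 0 * lam F)%C with (RtoC c * lam F)%C in Z by ring.
rewrite Cmod_mult, Cmod_R, Rabs_pos_eq in Z by lra.
assert (E1 : 4 * K / eps * d' = d) by (unfold d'; field; lra).
assert (E2 : 2 / c = 4 * K / eps * (M + d')) by (unfold c; field; lra).
rewrite <- E1, <- Rmult_plus_distr_l, <- E2.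
apply (Rmult_le_reg_l c); [exact Hc0|]. replace (c * (2 / c)) with 2 by (field; lra). exact Z.
Qed.

Lemma CDerive_n_translate (n : nat) (f : R -> C) (c t : R) :
  CDerive_n (fun r => f (r + c)) n t = CDerive_n f n (t + c).
Proof.
revert f. induction n as [|n IH]; intros f; [reflexivity|].
rewrite !CDerive_n_shift, <- IH. f_equal.
apply functional_extensionality; intros x. apply CDerive_shift.
Qed.

Lemma circ_Dn_shift {mu nu : C} (F : Iinf mu nu) (n : nat) (m : Z) (t : R) :
  CDerive_n (circ F) n (t + IZR m * PI)
  = (Cexp (RtoC PI * RtoC (IZR m) * Ci * mu) * CDerive_n (circ F) n t)%C.
Proof.
rewrite <- CDerive_n_translate, <- CDerive_n_scal by apply circ_smooth. f_equal.
apply functional_extensionality; intros x. rewrite Rplus_comm. apply circ_shift.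
Qed.

(** A quarter turn leaves the period by at most [PI / 2], and equivariance brings
    the point back at the cost of a constant phase. *)
Lemma Fw_bnd (mu nu : C) : exists K, 0 <= K /\ forall (F : Iinf mu nu) n M,
  bnd period n (circ F) M -> bnd period n (circ (Fw F)) (K * M).
Proof.
set (c := Cexp (RtoC PI * Ci * mu / RtoC 2)).
set (e := Cexp (RtoC PI * RtoC (IZR (-1)) * Ci * mu)).
pose proof (Cmod_ge_0 c) as Hc. pose proof (Cmod_ge_0 e) as He.
exists (Cmod c * (1 + Cmod e)). split; [apply Rmult_le_pos; lra|].
intros F n M HF. pose proof (bnd_ge0 _ 0 _ _ _ period_0 HF) as HM.
rewrite Rmult_assoc.
apply (bnd_ext _ _ (fun t => c * circ F (t + - (PI / 2)))%C).
{ intros t. rewrite circ_Fw. reflexivity. }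
intros j t Hj Ht.
rewrite (CDerive_n_scal j c (fun t => circ F (t + - (PI / 2)))), Cmod_mult.
2: { intros k x. replace (CDerive_n (fun t => circ F (t + - (PI / 2))) k)
       with (fun t => CDerive_n (circ F) k (t + - (PI / 2)))
       by (apply functional_extensionality; intros; symmetry; apply CDerive_n_translate).
     eexists. apply (is_derive_Ccomp (CDerive_n (circ F) k) (fun r => r + - (PI / 2)) x
       (CDerive_n (circ F) (S k) (x + - (PI / 2))) 1).
     - apply CDerive_correct, circ_smooth.
     - auto_derive; [trivial|ring]. }
apply Rmult_le_compat_l; [exact Hc|]. rewrite CDerive_n_translate.
pose proof PI_RGT_0. unfold period in Ht.
destruct (Rle_dec (- PI) (t + - (PI / 2))) as [L|L].
- eapply Rle_trans; [apply HF; [exact Hj|unfold period; lra]|nra].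
- replace (t + - (PI / 2)) with (t + PI / 2 + IZR (-1) * PI) by field.
  rewrite circ_Dn_shift, Cmod_mult. fold e.
  assert (B : Cmod (CDerive_n (circ F) j (t + PI / 2)) <= M)
    by (apply HF; [exact Hj|unfold period; lra]).
  pose proof (Cmod_ge_0 (CDerive_n (circ F) j (t + PI / 2))). nra.
Qed.

Lemma dualw_Idual {mu nu : C} (lam : Iinf mu nu -> C) : Idual lam -> Idual (dualw lam).
Proof.
intros H. apply bounded_Idual.
- intros a b F G. unfold dualw. rewrite Fw_comb. apply (proj1 H).
- destruct (Idual_bounded lam H) as (n & K & HK & B).
  destruct (Fw_bnd mu nu) as (K' & HK' & B').
  exists n, (K * K'). split; [apply Rmult_le_pos; assumption|].
  intros F M HF. rewrite Rmult_assoc. apply B, B', HF.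
Qed.

(** * The line model *)

(** The angle of [wt ut(- x)], that is the [t] in [(- PI, 0)] with [cot t = x]. *)
Definition tau (x : R) : R := - PI / 2 - atan x.

Lemma tau_bound (x : R) : - PI < tau x < 0.
Proof. unfold tau. pose proof (atan_bound x). lra. Qed.

Lemma sin_tau (x : R) : sin (tau x) = - / sqrt (1 + x * x).
Proof.
unfold tau. replace (- PI / 2 - atan x) with (- (PI / 2 + atan x)) by field.
rewrite sin_neg, <- cos_sin, cos_atan. unfold Rsqr, Rdiv. ring.
Qed.

Lemma cos_tau (x : R) : cos (tau x) = - (x / sqrt (1 + x * x)).
Proof.
unfold tau. replace (- PI / 2 - atan x) with (- (PI / 2 + atan x)) by field.
rewrite cos_neg, cos_plus, cos_PI2, sin_PI2, sin_atan. unfold Rsqr. ring.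
Qed.

Lemma sqrt_1sq (x : R) : 1 <= 1 + x * x /\ 0 < sqrt (1 + x * x).
Proof. split; [nra|]. apply sqrt_lt_R0. nra. Qed.

Lemma circ_iota_tau (mu nu : C) (f : Cc) (x : R) :
  circ (iota mu nu f) (tau x) = (Rcpow (1 + x * x) (nu + RtoC (1 / 2)) * f x)%C.
Proof.
destruct (sqrt_1sq x) as [P Q]. pose proof (Rinv_0_lt_compat _ Q) as Qi.
assert (N : sin (tau x) <> 0) by (rewrite sin_tau; lra).
assert (E : cos (tau x) / sin (tau x) = x).
{ rewrite sin_tau, cos_tau. field. lra. }
unfold circ. change (iota mu nu f (kt (tau x))) with (iota_fun mu nu f (kt (tau x))).
rewrite (iota_kt mu nu f (tau x) N), E.
assert (A : Carg ((- x)%R, 1%R) = PI / 2 + atan x).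
{ pose proof (atan_bound x). pose proof PI_RGT_0.
  rewrite <- (Carg_cis (sqrt (1 + x * x)) (PI / 2 + atan x)) by lra.
  rewrite <- cos_sin, cos_plus, cos_PI2, sin_PI2, cos_atan, sin_atan. unfold Rsqr.
  f_equal. f_equal; field; lra. }
rewrite A. replace (tau x + (PI / 2 + atan x)) with 0 by (unfold tau; field).
replace (Ci * mu * RtoC 0)%C with (RtoC 0) by ring. rewrite Cexp_0, Cmult_1_l. f_equal.
rewrite sin_tau, Rabs_Ropp, Rabs_pos_eq by lra. apply Rcpow_sqrt_inv. lra.
Qed.

Lemma circ_iota_pole (mu nu : C) (f : Cc) (t : R) : sin t = 0 -> circ (iota mu nu f) t = 0.
Proof.
intros H. unfold circ. change (iota_fun mu nu f (kt t) = 0). unfold iota_fun. simpl.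
destruct (Req_EM_T (- sin t) 0); [reflexivity|lra].
Qed.

(** The circle modulo [PI] is the line with one point at infinity, [sin t = 0]. *)
Lemma circle_cases (t : R) :
  (exists m : Z, t = IZR m * PI) \/ (exists (m : Z) (x : R), t = IZR m * PI + tau x).
Proof.
pose proof PI_RGT_0 as P. destruct (archimed (t / PI)) as [H1 H2].
set (n := up (t / PI)) in *.
assert (E : t = t / PI * PI) by (field; lra).
assert (L1 : t < IZR n * PI) by (rewrite E; apply Rmult_lt_compat_r; lra).
assert (L2 : IZR n * PI - PI <= t) by (rewrite E; nra).
destruct (Req_dec (IZR n * PI - PI) t) as [K|K].
- left. exists (n - 1)%Z. rewrite minus_IZR. lra.
- right. exists n, (tan (- PI / 2 - (t - IZR n * PI))). unfold tau.
  rewrite atan_tan by lra. ring.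
Qed.

Lemma circ_ext {mu nu : C} (F G : Iinf mu nu) :
  (forall x, circ F (tau x) = circ G (tau x)) -> circ F 0 = circ G 0 -> F = G.
Proof.
intros H H0. apply circ_inj. intros t. destruct (circle_cases t) as [(m & ->)|(m & x & ->)].
- replace (IZR m * PI) with (IZR m * PI + 0) by ring. rewrite !circ_shift, H0. reflexivity.
- rewrite !circ_shift, H. reflexivity.
Qed.

(** The restriction of [F] to [wt ut(- x)], whose Iwasawa coordinates are
    [s = - ln (1 + x^2)] and [t = tau x]. *)
Definition section {mu nu : C} (F : Iinf mu nu) (x : R) : C :=
  (Rcpow (1 + x * x) (- (nu + RtoC (1 / 2))) * circ F (tau x))%C.

Lemma Rcpow_opp (y : R) (s : C) : (Rcpow y s * Rcpow y (- s))%C = 1.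
Proof.
unfold Rcpow. rewrite <- Cexp_add.
replace (_ + _)%C with (RtoC 0) by ring. apply Cexp_0.
Qed.

Lemma section_iota (mu nu : C) (f : Cc) (x : R) : section (iota mu nu f) x = f x.
Proof.
unfold section. rewrite circ_iota_tau.
rewrite Cmult_assoc, (Cmult_comm (Rcpow _ (- _))), Rcpow_opp. ring.
Qed.

Lemma circ_section {mu nu : C} (F : Iinf mu nu) (x : R) :
  circ F (tau x) = (Rcpow (1 + x * x) (nu + RtoC (1 / 2)) * section F x)%C.
Proof. unfold section. rewrite Cmult_assoc, Rcpow_opp. ring. Qed.

Lemma Cc_eq (f g : Cc) : (forall x, f x = g x) -> f = g.
Proof.
destruct f as [f sf hf], g as [g sg hg]; simpl. intros H.
assert (f = g) by (apply functional_extensionality, H). subst g.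
f_equal; apply proof_irrelevance.
Qed.

Lemma iota_inj (mu nu : C) (f g : Cc) : iota mu nu f = iota mu nu g -> f = g.
Proof. intros H. apply Cc_eq. intros x. rewrite <- !(section_iota mu nu), H. reflexivity. Qed.

Lemma iota_comb (mu nu a b : C) (f g : Cc) :
  iota mu nu (Ccomb a b f g) = Icomb a b (iota mu nu f) (iota mu nu g).
Proof.
apply circ_ext.
- intros x. rewrite circ_comb, !circ_iota_tau. simpl. ring.
- rewrite circ_comb, !circ_iota_pole by apply sin_0. ring.
Qed.

Lemma smooth_1sq : smooth (fun x => RtoC (1 + x * x)).
Proof.
replace (fun x => RtoC (1 + x * x)) with (fun x => RtoC 1 + RtoC x * RtoC x)%C
  by (apply functional_extensionality; intros x; rewrite RtoC_plus, RtoC_mult; reflexivity).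
pose proof smooth_RtoC_id.
apply smooth_plus; [apply smooth_const|apply smooth_mult; assumption].
Qed.

Lemma smooth_tau : smooth (fun x => RtoC (tau x)).
Proof.
replace (fun x => RtoC (tau x)) with (fun x => RtoC (- PI / 2) + RtoC (-1) * RtoC (atan x))%C.
- apply smooth_plus; [apply smooth_const|]. apply smooth_mult; [apply smooth_const|].
  apply smooth_closure_smooth, sc_atan.
- apply functional_extensionality; intros x. unfold tau. rewrite <- RtoC_mult, <- RtoC_plus.
  f_equal. ring.
Qed.

Definition weight (s : C) (x : R) : C := Rcpow (1 + x * x) s.

Lemma smooth_weight (s : C) : smooth (weight s).
Proof.
unfold weight, Rcpow. apply smooth_closure_smooth, (sc_exp (fun x => s * RtoC (ln (1 + x * x)))%C).
apply sc_mult; [apply sc_smooth, smooth_const|]. apply (sc_ln (fun x => 1 + x * x)).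
- intros x. nra.
- apply sc_smooth, smooth_1sq.
Qed.

Lemma is_derive_tau (x : R) : is_derive tau x (- / (1 + x * x)).
Proof.
unfold tau. auto_derive; [trivial|]. unfold Rsqr. field. nra.
Qed.

(** The action of the rotation generator [rot] in the line model:
    [f |-> - (1 + x^2) f' - (2 nu + 1) x f]. *)
Definition line_rot (nu : C) (f : Cc) : Cc.
Proof.
refine (mkCc _ (Dop_smooth (fun y => (- RtoC 2 * nu - RtoC 1) * RtoC y)%C
   (fun y => RtoC (-1) * RtoC (1 + y * y))%C f _ _) (Dop_supp _ _ f)).
- apply smooth_mult; [apply smooth_const|apply smooth_RtoC_id].
- apply smooth_mult; [apply smooth_const|apply smooth_1sq].
Defined.

(** The derivative of [iota f] along the circle is again [iota g] for some [g];
    taking sections and differentiating [f = section (iota f)] determines [g]. *)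
Lemma CDerive_circ_iota (mu nu : C) (f : Cc) (t : R) :
  CDerive (circ (iota mu nu f)) t = circ (iota mu nu (line_rot nu f)) t.
Proof.
destruct (iota_step mu nu f) as [g Hg].
assert (D : forall t, is_derive (V := C_R_NormedModule) (circ (iota mu nu f)) t (circ (iota mu nu g) t))
  by exact Hg.
replace (line_rot nu f) with g; [apply CDerive_unique, D|].
apply Cc_eq. intros x. set (s := (- (nu + RtoC (1 / 2)))%C).
assert (P : 0 < 1 + x * x) by nra.
assert (E : CDerive f x =
  (s * RtoC (2 * x / (1 + x * x)) * f x + RtoC (- / (1 + x * x)) * g x)%C).
{ apply CDerive_unique.
  apply (is_derive_ext (K := R_AbsRing) (V := C_R_NormedModule) (section (iota mu nu f)));
    [intros y; apply section_iota|].
  unfold section. fold s. evar_last.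
  { apply is_derive_Cmult.
    - apply (is_derive_Rcpow (fun x => 1 + x * x) s x (2 * x)); [exact P|].
      auto_derive; [trivial|ring].
    - apply (is_derive_Ccomp (circ (iota mu nu f)) tau x _ _ (D (tau x)) (is_derive_tau x)). }
  cbv beta.
  rewrite <- (section_iota mu nu f x), <- (section_iota mu nu g x). unfold section. fold s. ring. }
simpl. rewrite E.
assert (N : RtoC (1 + x * x) <> 0) by (intros K; apply RtoC_inj in K; lra).
replace (RtoC (2 * x / (1 + x * x))) with (RtoC 2 * RtoC x * RtoC (/ (1 + x * x)))%C
  by (rewrite <- !RtoC_mult; reflexivity).
rewrite RtoC_opp. 
assert (I : (RtoC (1 + x * x) * RtoC (/ (1 + x * x)))%C = 1)
  by (rewrite <- RtoC_mult, Rinv_r; [reflexivity|lra]).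
assert (H : (RtoC 2 * RtoC (1 / 2))%C = 1)
  by (rewrite <- RtoC_mult; f_equal; field).
(* In the middle term the products in [I] and [H], both equal to 1, are inserted
   where they make it polynomially equal to the right-hand side. *)
replace (RtoC (-1)) with (- RtoC 1)%C by (rewrite <- RtoC_opp; reflexivity).
transitivity ((- RtoC 2 * nu - RtoC 1) * RtoC x * f x
  + (RtoC (1 + x * x) * RtoC (/ (1 + x * x))) * (RtoC 2 * nu * RtoC x * f x)
  + (RtoC 2 * RtoC (1 / 2)) * (RtoC (1 + x * x) * RtoC (/ (1 + x * x))) * (RtoC x * f x)
  + (RtoC (1 + x * x) * RtoC (/ (1 + x * x))) * g x)%C.
- rewrite I, H. ring.
- unfold s. ring.
Qed.

Definition supported (u : R) (f : R -> C) : Prop := forall x, u < Rabs x -> f x = 0.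

Definition near0 (u x : R) : Prop := - u <= x <= u.

Lemma near0_dec (u x : R) : near0 u x \/ u < Rabs x.
Proof.
unfold near0. destruct (Rle_dec (Rabs x) u) as [H|H]; [left|right; lra].
apply Rabs_le_between in H. exact H.
Qed.

Lemma supported_D (u : R) (f : R -> C) : supported u f -> supported u (CDerive f).
Proof.
intros H x Hx. apply CDerive_unique, CDerive_loc0.
exact (filter_imp _ _ H (locally_gt _ _ Hx)).
Qed.

Lemma supported_Dn (n : nat) (u : R) (f : R -> C) : supported u f -> supported u (CDerive_n f n).
Proof. intros H. induction n as [|n IH]; [exact H|]. apply supported_D, IH. Qed.

Lemma line_rot_supported (nu : C) (u : R) (f : Cc) : supported u f -> supported u (line_rot nu f).
Proof.
intros H x Hx. simpl. rewrite (H x Hx), (supported_D u f H x Hx). ring.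
Qed.

(** A point [m PI + tau x] of the period has [m = 0] or [m = 1], so its phase
    [Cexp (PI m i mu)] is bounded. *)
Lemma iota_sup (mu nu : C) (u : R) : exists K, 0 <= K /\
  forall (f : Cc) M, supported u f -> 0 <= M -> bnd (near0 u) 0 f M ->
    bnd period 0 (circ (iota mu nu f)) (K * M).
Proof.
destruct (bnd_compact (- u) u 0 _ (smooth_weight (nu + RtoC (1 / 2)))) as (W & HW & BW).
rewrite bnd_0 in BW.
set (e := fun m => Cmod (Cexp (RtoC PI * RtoC (IZR m) * Ci * mu))).
assert (He : forall m, 0 <= e m) by (intros m; apply Cmod_ge_0).
pose proof (He 0%Z) as He0. pose proof (He 1%Z) as He1.
exists ((e 0%Z + e 1%Z) * W). split; [apply Rmult_le_pos; lra|].
intros f M Sf HM Hf. rewrite bnd_0 in *. intros t Ht.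
assert (Z0 : 0 <= (e 0%Z + e 1%Z) * W * M) by (repeat apply Rmult_le_pos; lra).
destruct (circle_cases t) as [(m & ->)|(m & x & ->)].
- rewrite circ_iota_pole by apply sin_kPI. rewrite Cmod_0. exact Z0.
- rewrite circ_shift, circ_iota_tau, !Cmod_mult. fold (e m).
  destruct (near0_dec u x) as [Hx|Hx].
  2: { rewrite (Sf x Hx), Cmod_0, !Rmult_0_r. exact Z0. }
  assert (Hm : e m <= e 0%Z + e 1%Z).
  { pose proof (tau_bound x). pose proof PI_RGT_0. unfold period in Ht.
    assert (-1 < m)%Z by (apply lt_IZR; nra).
    assert (m < 2)%Z by (apply lt_IZR; nra).
    assert (m = 0 \/ m = 1)%Z as [->| ->] by lia; lra. }
  rewrite Rmult_assoc. apply Rmult_le_compat; [apply He| |exact Hm|].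
  + apply Rmult_le_pos; apply Cmod_ge_0.
  + apply Rmult_le_compat; [apply Cmod_ge_0..|apply (BW x Hx)|apply (Hf x Hx)].
Qed.

Lemma iota_bnd (mu nu : C) (u : R) (n : nat) : 0 < u -> exists K, 0 <= K /\
  forall (f : Cc) M, supported u f -> bnd (near0 u) n f M ->
    bnd period n (circ (iota mu nu f)) (K * M).
Proof.
intros Hu. assert (H0 : near0 u 0) by (unfold near0; lra).
destruct (iota_sup mu nu u) as (K0 & HK0 & B0).
set (p := fun y => ((- RtoC 2 * nu - RtoC 1) * RtoC y)%C).
set (q := fun y => (RtoC (-1) * RtoC (1 + y * y))%C).
assert (Sp : smooth p) by (apply smooth_mult; [apply smooth_const|apply smooth_RtoC_id]).
assert (Sq : smooth q) by (apply smooth_mult; [apply smooth_const|apply smooth_1sq]).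
induction n as [|n (K & HK & B)].
- exists K0. split; [exact HK0|]. intros f M Sf Hf. apply B0; auto.
  apply (bnd_ge0 _ 0 _ _ _ H0 Hf).
- destruct (bnd_compact (- u) u n p Sp) as (P & HP & BP).
  destruct (bnd_compact (- u) u n q Sq) as (Q & HQ & BQ).
  pose proof (pow_lt 2 n ltac:(lra)) as T.
  assert (TP : 0 <= 2 ^ n * P) by nra. assert (TQ : 0 <= 2 ^ n * Q) by nra.
  assert (KT : 0 <= K * (2 ^ n * P + 2 ^ n * Q)) by (apply Rmult_le_pos; lra).
  exists (K0 + K * (2 ^ n * P + 2 ^ n * Q)). split; [lra|]. intros f M Sf Hf.
  pose proof (bnd_ge0 _ 0 _ _ _ H0 Hf) as HM.
  pose proof (csmooth f) as Smf. pose proof (smooth_D _ Smf) as SmD.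
  apply bnd_S. split.
  + apply bnd_0. apply (bnd_le _ 0 0 _ (K0 * M)); [lia|nra|].
    apply B0; auto. eapply bnd_le; [| |exact Hf]; [lia|lra].
  + apply (bnd_ext _ _ _ _ _ (fun t => eq_sym (CDerive_circ_iota mu nu f t))).
    apply (bnd_le _ n n _ (K * (2 ^ n * (P * M) + 2 ^ n * (Q * M)))); [lia|nra|].
    apply B; [apply line_rot_supported, Sf|].
    apply (bnd_plus _ _ (fun x => p x * f x)%C (fun x => q x * CDerive f x)%C);
      [apply smooth_mult; assumption..| |]; apply bnd_mult; auto.
    * eapply bnd_le; [| |exact Hf]; [lia|lra].
    * apply bnd_S in Hf. tauto.
Qed.

Lemma sum_f_R0_term (a : nat -> R) (n j : nat) :
  (forall i, 0 <= a i) -> (j <= n)%nat -> a j <= sum_f_R0 a n.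
Proof.
intros H. induction n as [|n IH]; intros Hj.
- replace j with O by lia. simpl. lra.
- simpl. destruct (Nat.eq_dec j (S n)) as [->|].
  + pose proof (cond_pos_sum a n H). lra.
  + specialize (IH ltac:(lia)). specialize (H (S n)). lra.
Qed.

Lemma Tdist_distribution {mu nu : C} (lam : Iinf mu nu -> C) : Idual lam -> distribution (Tdist lam).
Proof.
intros H. split.
- intros a b f g. unfold Tdist. rewrite iota_comb. apply (proj1 H).
- intros u Hu. destruct (Idual_bounded lam H) as (n & K & HK & B).
  destruct (iota_bnd mu nu u n Hu) as (K' & HK' & B').
  exists n, (K * K' + 1). pose proof (Rmult_le_pos _ _ HK HK'). split; [lra|].
  intros f Sf. set (a := fun i => supnorm (fun _ => True) (CDerive_n f i)).
  assert (Ha : forall i x, Cmod (CDerive_n f i x) <= a i).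
  { intros i x. destruct (bnd_compact (- u) u i f (csmooth f)) as (M & HM & BM).
    apply (supnorm_ge (fun _ => True) _ M); [|exact I]. intros y _.
    destruct (near0_dec u y) as [Hy|Hy]; [apply BM; auto|].
    rewrite (supported_Dn i u f Sf y Hy), Cmod_0. exact HM. }
  assert (Ha0 : forall i, 0 <= a i)
    by (intros i; eapply Rle_trans; [apply Cmod_ge_0|apply (Ha i 0)]).
  apply Rle_trans with (K * (K' * sum_f_R0 a n)).
  + apply B, B'; [exact Sf|]. intros j t Hj _.
    eapply Rle_trans; [apply Ha|apply sum_f_R0_term; assumption].
  + pose proof (cond_pos_sum a n Ha0). rewrite <- Rmult_assoc.
    apply Rmult_le_compat_r; lra.
Qed.

Lemma distribution_bnd (T : Cc -> C) (u : R) : distribution T -> 0 < u ->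
  exists (n : nat) (K : R), 0 <= K /\
    forall (f : Cc) M, supported u f -> bnd (near0 u) n f M -> Cmod (T f) <= K * M.
Proof.
intros [_ H] Hu. destruct (H u Hu) as (n & c & Hc & B).
exists n, (c * INR (S n)). split; [pose proof (pos_INR (S n)); nra|].
intros f M Sf Hf.
assert (HM : 0 <= M) by (apply (bnd_ge0 _ 0 _ _ _) with (2 := Hf); unfold near0; lra).
eapply Rle_trans; [apply (B f Sf)|]. rewrite Rmult_assoc. apply Rmult_le_compat_l; [lra|].
rewrite (Rmult_comm (INR _)), <- sum_cte.
apply sum_Rle. intros i Hi. apply (supnorm_le _ _ _ 0 I). intros x _.
destruct (near0_dec u x) as [Hx|Hx]; [apply Hf; assumption|].
rewrite (supported_Dn i u f Sf x Hx), Cmod_0. exact HM.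
Qed.

(** * Existence of partitions *)

(** The threshold 1/4 is below 1/2, so that [sin t ^ 2] or [cos t ^ 2] exceeds it
    for every [t]. *)
Definition bump (t : R) : R := flat 0 (sin t * sin t - 1 / 4).

Lemma bump_ge0 (t : R) : 0 <= bump t.
Proof.
unfold bump, flat. destruct (Rlt_dec 0 _); [|lra]. simpl. rewrite Rmult_1_l.
left; apply exp_pos.
Qed.

Lemma bump_gt0 (t : R) : 1 / 4 < sin t * sin t -> 0 < bump t.
Proof.
intros H. unfold bump, flat. destruct (Rlt_dec 0 _); [|lra]. simpl. rewrite Rmult_1_l.
apply exp_pos.
Qed.

Lemma bump_0 (t : R) : sin t * sin t <= 1 / 4 -> bump t = 0.
Proof. intros H. unfold bump. apply flat_neg. lra. Qed.

Lemma sin_minus_PI2 (t : R) : sin (t - PI / 2) = - cos t.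
Proof. rewrite sin_minus, cos_PI2, sin_PI2. ring. Qed.

Lemma bump_shift (m : Z) (t : R) : bump (IZR m * PI + t) = bump t.
Proof.
unfold bump. f_equal. f_equal. rewrite sin_plus, sin_kPI.
transitivity (cos (IZR m * PI) * cos (IZR m * PI) * (sin t * sin t)); [ring|].
rewrite cos_kPI_sq. ring.
Qed.

Lemma bump_sum_gt0 (t : R) : 0 < bump t + bump (t - PI / 2).
Proof.
pose proof (bump_ge0 t) as H1. pose proof (bump_ge0 (t - PI / 2)) as H2.
pose proof (sin2_cos2 t) as SC; unfold Rsqr in SC.
destruct (Rlt_dec (1 / 4) (sin t * sin t)) as [H|H].
- pose proof (bump_gt0 t H). lra.
- assert (0 < bump (t - PI / 2)); [|lra].
  apply bump_gt0. rewrite sin_minus_PI2. lra.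
Qed.

(** A function on the circle that vanishes near the poles of the line model and
    whose quarter turn is its complement to 1; it cuts [F] into the two pieces of
    a partition. *)
Definition cutoff (t : R) : R := bump t * / (bump t + bump (t - PI / 2)).

Lemma cutoff_shift (m : Z) (t : R) : cutoff (IZR m * PI + t) = cutoff t.
Proof.
unfold cutoff. replace (IZR m * PI + t - PI / 2) with (IZR m * PI + (t - PI / 2)) by ring.
rewrite !bump_shift. reflexivity.
Qed.

Lemma cutoff_quarter (t : R) : cutoff t + cutoff (t - PI / 2) = 1.
Proof.
unfold cutoff. replace (t - PI / 2 - PI / 2) with (IZR (-1) * PI + t) by field.
rewrite bump_shift. pose proof (bump_sum_gt0 t). field. lra.
Qed.

Lemma cutoff_0 (t : R) : sin t * sin t <= 1 / 4 -> cutoff t = 0.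
Proof. intros H. unfold cutoff. rewrite bump_0 by exact H. ring. Qed.

Lemma smooth_cutoff : smooth (fun t => RtoC (cutoff t)).
Proof.
assert (Sb : smooth_closure (fun t => RtoC (bump t))).
{ apply (sc_comp (fun v => RtoC (flat 0 v)) (fun t => sin t * sin t - 1 / 4)); [apply sc_flat|].
  replace (fun x => RtoC (sin x * sin x - 1 / 4))
    with (fun x => RtoC (sin x) * RtoC (sin x) + RtoC (- (1 / 4)))%C
    by (apply functional_extensionality; intros x; rewrite <- RtoC_mult, <- RtoC_plus; reflexivity).
  apply sc_plus; [apply sc_mult; apply sc_sin|apply sc_smooth, smooth_const]. }
assert (Sb' : smooth_closure (fun t => RtoC (bump (t - PI / 2)))).
{ apply (sc_comp (fun v => RtoC (bump v)) (fun t => t - PI / 2)); [exact Sb|].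
  replace (fun x => RtoC (x - PI / 2)) with (fun x => RtoC x + RtoC (- (PI / 2)))%C
    by (apply functional_extensionality; intros x; rewrite <- RtoC_plus; reflexivity).
  apply sc_plus; apply sc_smooth; [apply smooth_RtoC_id|apply smooth_const]. }
apply smooth_closure_smooth.
replace (fun t => RtoC (cutoff t))
  with (fun t => RtoC (bump t) * RtoC (/ (bump t + bump (t - PI / 2))))%C
  by (apply functional_extensionality; intros x; rewrite <- RtoC_mult; reflexivity).
apply sc_mult; [exact Sb|]. apply (sc_inv (fun t => bump t + bump (t - PI / 2))).
- intros x. pose proof (bump_sum_gt0 x). lra.
- replace (fun x => RtoC (bump x + bump (x - PI / 2)))
    with (fun x => RtoC (bump x) + RtoC (bump (x - PI / 2)))%C
    by (apply functional_extensionality; intros x; rewrite <- RtoC_plus; reflexivity).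
  apply sc_plus; assumption.
Qed.

Lemma cutoff_tau_supp (x : R) : 2 < Rabs x -> cutoff (tau x) = 0.
Proof.
intros H. apply cutoff_0. rewrite sin_tau. destruct (sqrt_1sq x) as [P Q].
replace (- / sqrt (1 + x * x) * - / sqrt (1 + x * x)) with (/ (1 + x * x)).
- assert (4 <= 1 + x * x).
  { replace (x * x) with (Rabs x * Rabs x) by (rewrite <- Rabs_mult; apply Rabs_pos_eq; nra). nra. }
  unfold Rdiv. rewrite Rmult_1_l. apply Rinv_le_contravar; lra.
- rewrite <- (sqrt_sqrt (1 + x * x)) at 1 by lra. field. lra.
Qed.

(** This is [cutoff] times [section F], with the factors that do not depend on [F]
    grouped together for [piece_bnd]. *)
Definition piece_fun {mu nu : C} (F : Iinf mu nu) (x : R) : C :=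
  (RtoC (cutoff (tau x)) * weight (- (nu + RtoC (1 / 2))) x * circ F (tau x))%C.

Lemma smooth_piece_weight (s : C) : smooth (fun x => RtoC (cutoff (tau x)) * weight s x)%C.
Proof.
apply smooth_mult; [|apply smooth_weight].
apply (smooth_comp (fun v => RtoC (cutoff v)) tau); [apply smooth_cutoff|apply smooth_tau].
Qed.

Lemma piece_smooth {mu nu : C} (F : Iinf mu nu) : smooth (piece_fun F).
Proof.
unfold piece_fun. apply smooth_mult; [apply smooth_piece_weight|].
apply smooth_comp; [apply circ_smooth|apply smooth_tau].
Qed.

Lemma piece_supported {mu nu : C} (F : Iinf mu nu) : supported 2 (piece_fun F).
Proof. intros x Hx. unfold piece_fun. rewrite cutoff_tau_supp by exact Hx. ring. Qed.

Definition piece {mu nu : C} (F : Iinf mu nu) : Cc :=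
  mkCc (piece_fun F) (piece_smooth F) (ex_intro _ 2 (piece_supported F)).

Lemma circ_iota_piece {mu nu : C} (F : Iinf mu nu) (t : R) :
  circ (iota mu nu (piece F)) t = (RtoC (cutoff t) * circ F t)%C.
Proof.
destruct (circle_cases t) as [(m & ->)|(m & x & ->)].
- rewrite circ_iota_pole by apply sin_kPI. rewrite cutoff_0; [ring|]. rewrite sin_kPI. lra.
- rewrite cutoff_shift, !circ_shift, circ_iota_tau, circ_section.
  simpl. unfold piece_fun, section, weight. ring.
Qed.

Lemma is_partition_circ {mu nu : C} (F : Iinf mu nu) (f1 f2 : Cc) :
  is_partition F f1 f2 <-> Icomb 1 1 (iota mu nu f1) (Fw (iota mu nu f2)) = F.
Proof.
split.
- intros H. apply Iinf_eq. intros g. rewrite <- (H g). simpl. ring.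
- intros <- g. simpl. ring.
Qed.

Lemma piece_partition {mu nu : C} (F : Iinf mu nu) : is_partition F (piece F) (piece (Fw F)).
Proof.
apply is_partition_circ, circ_inj. intros t.
rewrite circ_comb, circ_Fw, !circ_iota_piece.
transitivity (RtoC (cutoff t) * circ F t + RtoC (cutoff (t - PI / 2)) * circ (Fw (Fw F)) t)%C.
- rewrite (circ_Fw (Fw F)). ring.
- rewrite Fw_Fw. rewrite <- Cmult_plus_distr_r, <- RtoC_plus, cutoff_quarter. ring.
Qed.

Lemma piece_bnd (mu nu : C) (n : nat) : exists K, 0 <= K /\
  forall (F : Iinf mu nu) M, bnd period n (circ F) M -> bnd (near0 2) n (piece F) (K * M).
Proof.
set (s := (- (nu + RtoC (1 / 2)))%C).
destruct (bnd_compact (-2) 2 n _ (smooth_piece_weight s)) as (W & HW & BW).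
destruct (bnd_compact (-2) 2 n _ smooth_tau) as (A & HA & BA).
destruct (bnd_comp (near0 2) period n tau A smooth_tau) as (K & HK & B).
{ intros x _. pose proof (tau_bound x). pose proof PI_RGT_0. unfold period. lra. }
{ exact BA. }
pose proof (pow_lt 2 n ltac:(lra)) as T.
exists (2 ^ n * (W * K)). split; [apply Rmult_le_pos; [lra|apply Rmult_le_pos; lra]|].
intros F M HF.
replace (2 ^ n * (W * K) * M) with (2 ^ n * (W * (K * M))) by ring.
apply (bnd_mult _ _ (fun x => RtoC (cutoff (tau x)) * weight s x)%C (fun x => circ F (tau x))).
- apply smooth_piece_weight.
- apply smooth_comp; [apply circ_smooth|apply smooth_tau].
- exact BW.
- apply B; [apply circ_smooth|exact HF].
Qed.

(** * Compatible pairs of distributions *)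

(** The coordinate change [x |-> - 1 / x] of the line is a quarter turn of the
    circle. *)
Lemma tau_quarter (x : R) : x <> 0 -> exists m : Z,
  tau x - PI / 2 = IZR m * PI + tau (- 1 / x) /\ 2 * IZR m = - 1 - sign x.
Proof.
intros N. unfold tau. replace (- 1 / x) with (- / x) by (field; exact N).
rewrite atan_opp. destruct (Rdichotomy x 0 N) as [H|H].
- exists 0%Z. rewrite sign_eq_m1 by exact H. split; [|ring].
  replace (/ x) with (- / (- x)) by (field; exact N).
  rewrite atan_opp, atan_inv, atan_opp by lra. field.
- exists (-1)%Z. rewrite sign_eq_1 by exact H. split; [|ring].
  rewrite atan_inv by lra. field.
Qed.

(** The phase in [finf] compensates both the constant of [Fw] and the half turn by
    which the quarter turn may leave [(- PI, 0)]; its power of [x] compensates the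
    change of [1 + x^2]. *)
Lemma iota_finf (mu nu : C) (f : Cx) : iota mu nu f = Fw (iota mu nu (finf mu nu f)).
Proof.
apply circ_ext.
- intros x. rewrite circ_iota_tau, circ_Fw. destruct (Req_dec x 0) as [->|N].
  + destruct (xsupp f) as [e [He Hv]]. rewrite Hv by (rewrite Rabs_R0; exact He).
    rewrite circ_iota_pole; [ring|].
    unfold tau. rewrite atan_0. replace (- PI / 2 - 0 - PI / 2) with (- PI) by field.
    rewrite sin_neg, sin_PI. ring.
  + destruct (tau_quarter x N) as (m & -> & Em).
    rewrite circ_shift, circ_iota_tau.
    assert (Ny : - 1 / x <> 0) by (unfold Rdiv; apply Rmult_integral_contrapositive_currified;
      [lra|apply Rinv_neq_0_compat, N]).
    change (finf mu nu f (- 1 / x)) with (finf_fun mu nu f (- 1 / x)).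
    unfold finf_fun. destruct (Req_EM_T (- 1 / x) 0) as [|_]; [contradiction|].
    replace (- 1 / (- 1 / x)) with x by (field; exact N).
    assert (Px : 0 < x * x) by (destruct (Rdichotomy x 0 N); nra).
    assert (Ea : Rabs (- 1 / x) = / sqrt (x * x)).
    { unfold Rdiv. rewrite Rabs_mult, Rabs_inv, (Rabs_left (- 1)) by lra.
      change (x * x) with (Rsqr x). rewrite sqrt_Rsqr_abs. ring. }
    rewrite Ea, Rcpow_sqrt_inv by exact Px.
    assert (Es : sign (- 1 / x) = - sign x).
    { pose proof (Rinv_neq_0_compat x N). destruct (Rdichotomy x 0 N) as [L|L].
      - pose proof (Rinv_lt_0_compat x L). rewrite (sign_eq_m1 x L), sign_eq_1; lra.
      - pose proof (Rinv_0_lt_compat x L). rewrite (sign_eq_1 x L), sign_eq_m1; lra. }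
    rewrite Es. set (s := (nu + RtoC (1 / 2))%C).
    assert (Ew : Rcpow (1 + x * x) s = (Rcpow (1 + - 1 / x * (- 1 / x)) s * Rcpow (x * x) s)%C).
    { rewrite <- Rcpow_mult; [f_equal; field; exact N| |exact Px].
      pose proof (Rle_0_sqr (- 1 / x)) as Q; unfold Rsqr in Q. lra. }
    rewrite Ew.
    transitivity ((Cexp (RtoC PI * Ci * mu / RtoC 2)
      * Cexp (RtoC PI * RtoC (IZR m) * Ci * mu)
      * Cexp (- (RtoC (- sign x) * RtoC PI * Ci * mu / RtoC 2)))
      * (Rcpow (1 + - 1 / x * (- 1 / x)) s * Rcpow (x * x) s * f x))%C; [|ring].
    rewrite <- !Cexp_add.
    replace (_ + _ + _)%C with (RtoC 0); [rewrite Cexp_0; ring|].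
    replace (sign x) with (- 1 - 2 * IZR m) by lra.
    rewrite RtoC_opp, RtoC_minus, RtoC_mult. field.
- rewrite circ_iota_pole by apply sin_0. rewrite circ_Fw.
  replace (0 - PI / 2) with (tau 0) by (unfold tau; rewrite atan_0; field).
  rewrite circ_iota_tau. change (finf mu nu f 0) with (finf_fun mu nu f 0).
  unfold finf_fun. destruct (Req_EM_T 0 0); [ring|lra].
Qed.

(** The point [x = 0] of the first line is the point at infinity of the second, where
    [Fw (iota b)] vanishes because [b] has compact support; so [iota a], its opposite,
    vanishes there too. *)
Lemma cancel_near0 (mu nu : C) (a b : Cc) :
  (forall t, (circ (iota mu nu a) t + circ (Fw (iota mu nu b)) t)%C = 0) ->
  exists e, 0 < e /\ forall x, Rabs x < e -> a x = 0.
Proof.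
intros H.
assert (S0 : sin (- PI) = 0) by (rewrite sin_neg, sin_PI; ring).
pose proof (iota_near0 mu nu b (- PI) S0) as L.
assert (Hc : continuous (fun x => tau x - PI / 2) 0).
{ apply (ex_derive_continuous (V := R_NormedModule)). eexists.
  apply (is_derive_minus (V := R_NormedModule)); [apply is_derive_tau|].
  apply (is_derive_const (V := R_NormedModule)). }
assert (E0 : tau 0 - PI / 2 = - PI) by (unfold tau; rewrite atan_0; field).
rewrite <- E0 in L.
assert (L' : locally 0 (fun x => iota_fun mu nu b (kt (tau x - PI / 2)) = 0))
  by exact (Hc _ L).
destruct L' as [e He]. exists e. split; [apply cond_pos|]. intros x Hx.
specialize (H (tau x)). rewrite circ_iota_tau, circ_Fw in H.
assert (Z : circ (iota mu nu b) (tau x - PI / 2) = 0).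
{ apply He. change (Rabs (x - 0) < e). rewrite Rminus_0_r. exact Hx. }
rewrite Z in H. pose proof (Rcpow_opp (1 + x * x) (nu + RtoC (1 / 2))) as I.
rewrite Cmult_comm in I.
transitivity (Rcpow (1 + x * x) (- (nu + RtoC (1 / 2)))
  * (Rcpow (1 + x * x) (nu + RtoC (1 / 2)) * a x
     + Cexp (RtoC PI * Ci * mu / RtoC 2) * 0))%C; [|rewrite H; ring].
rewrite Cmult_0_r, Cplus_0_r, Cmult_assoc, I. ring.
Qed.

(** By [cancel_near0], [finf a] is defined, and it equals [- b] since [Fw o iota] is
    injective. *)
Lemma AJ_cancel (mu nu : C) (T1 T2 : Cc -> C) (a b : Cc) : AJ mu nu (T1, T2) ->
  (forall t, (circ (iota mu nu a) t + circ (Fw (iota mu nu b)) t)%C = 0) ->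
  (T1 a + T2 b)%C = 0.
Proof.
intros (_ & [L2 _] & HT) H. cbn [fst snd] in L2, HT.
set (ax := mkCx a (cancel_near0 mu nu a b H)).
assert (E : iota mu nu (finf mu nu ax) = iota mu nu (Ccomb (-1) 0 b b)).
{ rewrite <- (Fw_Fw (iota mu nu (finf mu nu ax))), <- (Fw_Fw (iota mu nu (Ccomb _ _ _ _))).
  f_equal. rewrite <- iota_finf, iota_comb, Fw_comb. apply circ_inj. intros t.
  rewrite circ_comb. change (circ (iota mu nu ax) t) with (circ (iota mu nu a) t).
  transitivity ((circ (iota mu nu a) t + circ (Fw (iota mu nu b)) t)
     + RtoC (-1) * circ (Fw (iota mu nu b)) t)%C; [|rewrite H; ring].
  replace (RtoC (-1)) with (- RtoC 1)%C by (rewrite <- RtoC_opp; reflexivity). ring. }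
apply iota_inj in E.
change (T1 ax + T2 b = 0)%C. rewrite HT, E, L2.
replace (RtoC (-1)) with (- RtoC 1)%C by (rewrite <- RtoC_opp; reflexivity). ring.
Qed.

Lemma partition_independent {mu nu : C} (T1 T2 : Cc -> C) (F : Iinf mu nu) (f1 f2 h1 h2 : Cc) :
  AJ mu nu (T1, T2) -> is_partition F f1 f2 -> is_partition F h1 h2 ->
  (T1 f1 + T2 f2 = T1 h1 + T2 h2)%C.
Proof.
intros HT Hf Hh. pose proof HT as ([L1 _] & [L2 _] & _). cbn [fst snd] in L1, L2.
apply is_partition_circ in Hf, Hh.
assert (Z : (T1 (Ccomb 1 (- (1)) f1 h1) + T2 (Ccomb 1 (- (1)) f2 h2))%C = 0).
{ apply (AJ_cancel mu nu T1 T2 _ _ HT). intros t.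
  rewrite !iota_comb, Fw_comb, !circ_comb.
  pose proof (f_equal (fun G => circ G t) (eq_trans Hf (eq_sym Hh))) as E.
  cbv beta in E. rewrite !circ_comb in E.
  transitivity ((1 * circ (iota mu nu f1) t + 1 * circ (Fw (iota mu nu f2)) t)
    - (1 * circ (iota mu nu h1) t + 1 * circ (Fw (iota mu nu h2)) t))%C; [ring|].
  rewrite E. ring. }
rewrite L1, L2 in Z.
transitivity ((1 * T1 f1 + - (1) * T1 h1 + (1 * T2 f2 + - (1) * T2 h2)) + (T1 h1 + T2 h2))%C; [ring|].
rewrite Z. ring.
Qed.

(** * The bijection *)

Lemma Lambda_partition {mu nu : C} (T1 T2 : Cc -> C) (F : Iinf mu nu) (f1 f2 : Cc) :
  AJ mu nu (T1, T2) -> is_partition F f1 f2 -> Lambda T1 T2 F = (T1 f1 + T2 f2)%C.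
Proof.
intros HT Hf. unfold Lambda.
match goal with |- epsilon ?i ?P = _ => pose proof (epsilon_spec i P) as S end.
destruct S as (h1 & h2 & Hh & ->).
- exists (T1 f1 + T2 f2)%C, f1, f2. auto.
- apply (partition_independent T1 T2 F h1 h2 f1 f2 HT Hh Hf).
Qed.

(** The partition by [piece] computes [Lambda]; its linearity uses another partition
    of the combination, so the independence of the choice. *)
Lemma Lambda_Idual {mu nu : C} (T1 T2 : Cc -> C) : AJ mu nu (T1, T2) ->
  Idual (fun F : Iinf mu nu => Lambda T1 T2 F).
Proof.
intros HT. pose proof HT as (D1 & D2 & _). cbn [fst snd] in D1, D2.
assert (EL : forall F : Iinf mu nu, Lambda T1 T2 F = (T1 (piece F) + T2 (piece (Fw F)))%C)
  by (intros F; apply Lambda_partition; [exact HT|apply piece_partition]).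
apply bounded_Idual.
- intros a b F G.
  rewrite (Lambda_partition T1 T2 _ (Ccomb a b (piece F) (piece G))
             (Ccomb a b (piece (Fw F)) (piece (Fw G))) HT).
  + rewrite !EL, (proj1 D1), (proj1 D2). ring.
  + apply is_partition_circ. rewrite !iota_comb, Fw_comb. apply circ_inj. intros t.
    pose proof (proj1 (is_partition_circ _ _ _) (piece_partition F)) as EF.
    pose proof (proj1 (is_partition_circ _ _ _) (piece_partition G)) as EG.
    rewrite <- EF at 3. rewrite <- EG at 3. rewrite !circ_comb. ring.
- destruct (distribution_bnd T1 2 D1 ltac:(lra)) as (n1 & K1 & HK1 & B1).
  destruct (distribution_bnd T2 2 D2 ltac:(lra)) as (n2 & K2 & HK2 & B2).
  destruct (piece_bnd mu nu n1) as (P1 & HP1 & Q1).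
  destruct (piece_bnd mu nu n2) as (P2 & HP2 & Q2).
  destruct (Fw_bnd mu nu) as (W & HW & BW).
  pose proof (Rmult_le_pos _ _ HK1 HP1). pose proof (Rmult_le_pos _ _ HK2 (Rmult_le_pos _ _ HP2 HW)).
  exists (Nat.max n1 n2), (K1 * P1 + K2 * (P2 * W)). split; [lra|].
  intros F M HF. rewrite EL. eapply Rle_trans; [apply Cmod_triangle|].
  replace ((K1 * P1 + K2 * (P2 * W)) * M) with (K1 * (P1 * M) + K2 * (P2 * (W * M))) by ring.
  apply Rplus_le_compat.
  + apply B1; [apply piece_supported|]. apply Q1.
    eapply bnd_le; [| |exact HF]; [lia|lra].
  + apply B2; [apply piece_supported|]. apply Q2, BW.
    eapply bnd_le; [| |exact HF]; [lia|lra].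
Qed.

Lemma Tdist_AJ {mu nu : C} (lam : Iinf mu nu -> C) : Idual lam ->
  AJ mu nu (Tdist lam, Tdist (dualw lam)).
Proof.
intros H. split; [|split]; cbn [fst snd].
- apply Tdist_distribution, H.
- apply Tdist_distribution, dualw_Idual, H.
- intros f. unfold Tdist, dualw. f_equal. apply iota_finf.
Qed.

Lemma Lambda_Tdist {mu nu : C} (lam : Iinf mu nu -> C) : Idual lam ->
  (fun F : Iinf mu nu => Lambda (Tdist lam) (Tdist (dualw lam)) F) = lam.
Proof.
intros H. apply functional_extensionality; intros F.
rewrite (Lambda_partition _ _ F _ _ (Tdist_AJ lam H) (piece_partition F)).
pose proof (proj1 (is_partition_circ _ _ _) (piece_partition F)) as E.
rewrite <- E at 3. rewrite (proj1 H). unfold Tdist, dualw. ring.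
Qed.

Lemma distribution_0 (T : Cc -> C) (f : Cc) : distribution T -> T (Ccomb 0 0 f f) = 0.
Proof. intros [L _]. rewrite L. ring. Qed.

Lemma Tdist_Lambda {mu nu : C} (T1 T2 : Cc -> C) : AJ mu nu (T1, T2) ->
  let lam := fun F : Iinf mu nu => Lambda T1 T2 F in
  (Tdist lam, Tdist (dualw lam)) = (T1, T2).
Proof.
intros HT lam. pose proof HT as (D1 & D2 & _). cbn [fst snd] in D1, D2.
f_equal; apply functional_extensionality; intros f; unfold Tdist, dualw, lam.
- rewrite (Lambda_partition T1 T2 _ f (Ccomb 0 0 f f) HT).
  + rewrite distribution_0 by exact D2. ring.
  + apply is_partition_circ, circ_inj. intros t.
    rewrite iota_comb, Fw_comb, !circ_comb. ring.
- rewrite (Lambda_partition T1 T2 _ (Ccomb 0 0 f f) f HT).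
  + rewrite distribution_0 by exact D1. ring.
  + apply is_partition_circ, circ_inj. intros t.
    rewrite iota_comb, !circ_comb. ring.
Qed.

Theorem proposition2p4 (mu nu : C) :
  (forall lam : Iinf mu nu -> C, Idual lam ->
     distribution (Tdist lam) /\ Idual (dualw lam) /\ dualw (dualw lam) = lam) /\
  (forall F : Iinf mu nu, exists f1 f2 : Cc, is_partition F f1 f2) /\
  (forall T1 T2 : Cc -> C, AJ mu nu (T1, T2) ->
     (forall (F : Iinf mu nu) (f1 f2 h1 h2 : Cc),
        is_partition F f1 f2 -> is_partition F h1 h2 ->
        (T1 f1 + T2 f2 = T1 h1 + T2 h2)%C) /\
     (forall (F : Iinf mu nu) (f1 f2 : Cc),
        is_partition F f1 f2 -> Lambda T1 T2 F = (T1 f1 + T2 f2)%C) /\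
     Idual (fun F : Iinf mu nu => Lambda T1 T2 F)) /\
  (forall lam : Iinf mu nu -> C, Idual lam ->
     AJ mu nu (Tdist lam, Tdist (dualw lam))) /\
  (forall (a b : C) (lam1 lam2 : Iinf mu nu -> C), Idual lam1 -> Idual lam2 ->
     let lam := fun F : Iinf mu nu => (a * lam1 F + b * lam2 F)%C in
     forall f : Cc,
       Tdist lam f = (a * Tdist lam1 f + b * Tdist lam2 f)%C /\
       Tdist (dualw lam) f = (a * Tdist (dualw lam1) f + b * Tdist (dualw lam2) f)%C) /\
  (forall T : (Cc -> C) * (Cc -> C), AJ mu nu T ->
     exists! lam : Iinf mu nu -> C,
       Idual lam /\ (Tdist lam, Tdist (dualw lam)) = T) /\
  (forall lam : Iinf mu nu -> C, Idual lam ->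
     (fun F : Iinf mu nu => Lambda (Tdist lam) (Tdist (dualw lam)) F) = lam) /\
  (forall T1 T2 : Cc -> C, AJ mu nu (T1, T2) ->
     let lam := fun F : Iinf mu nu => Lambda T1 T2 F in
     (Tdist lam, Tdist (dualw lam)) = (T1, T2)).
Proof.
split; [|split; [|split; [|split; [|split; [|split; [|split]]]]]].
- intros lam H. split; [apply Tdist_distribution, H|]. split; [apply dualw_Idual, H|].
  apply functional_extensionality; intros F. unfold dualw. rewrite Fw_Fw. reflexivity.
- intros F. exists (piece F), (piece (Fw F)). apply piece_partition.
- intros T1 T2 HT. split; [|split].
  + intros F f1 f2 h1 h2. apply partition_independent, HT.
  + intros F f1 f2. apply Lambda_partition, HT.
  + apply Lambda_Idual, HT.
- intros lam. apply Tdist_AJ.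
- intros a b lam1 lam2 _ _ lam f. split; reflexivity.
- intros [T1 T2] HT. exists (fun F : Iinf mu nu => Lambda T1 T2 F). split.
  + split; [apply Lambda_Idual, HT|apply Tdist_Lambda, HT].
  + intros lam [H E]. injection E as <- <-. apply Lambda_Tdist, H.
- intros lam. apply Lambda_Tdist.
- intros T1 T2. apply Tdist_Lambda.
Qed.
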